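(* The Mittag-Leffler function satisfies $$E_{a,b}(z)=\frac{3^{3b-\frac12}}{\pi}\int_{0}^{\infty}K_{\frac13}\left(2\sqrt{u}\right)u^{b-\frac12}E_{3a,3b}\left(3^{3a}u^{a}z\right)du$$ and its companion $$E_{a,b}(z)=\frac{3^{3(b-1)+\frac12}}{\pi}\int_{0}^{\infty}K_{\frac13}\left(2\sqrt{u}\right)u^{b-\frac32}E_{3a,3b-2}\left(3^{3a}u^{a}z\right)du .$$
   Context: The Mittag-Leffler function is $E_{a,b}(z)=\sum_{k=0}^{\infty}\frac{z^{k}}{\Gamma(b+ak)}$ for $\operatorname{Re}(a)>0$ and complex $b$, with $1/\Gamma$ the entire reciprocal Gamma function. $K_\nu$ is the modified Bessel function $K_{\nu}(z)=\frac{\pi}{2\sin\pi\nu}\left(I_{-\nu}(z)-I_{\nu}(z)\right)$ with $I_{\nu}(z)=\sum_{k=0}^{\infty}\frac{(z/2)^{\nu+2k}}{k!\,\Gamma(\nu+k+1)}$.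
   Formalization: The first formula is proved for Re b > -1/3 and the second for Re b > 2/3, the natural conditions for the integrals to converge at 0; without them the formulas fail, e.g. at z=0 with b=-1/3 (first) or b=2/3 (second). *)

(* Defs.v *)
From HB Require Import structures.
From mathcomp Require Import all_boot all_order all_algebra.
From mathcomp Require Import all_classical all_reals all_analysis.
From mathcomp Require Import complex.

Set Implicit Arguments.
Unset Strict Implicit.
Unset Printing Implicit Defensive.

Import Order.TTheory GRing.Theory Num.Theory.
Import numFieldNormedType.Exports.

Local Open Scope classical_set_scope.
Local Open Scope ring_scope.
Local Open Scope complex_scope.

Definition cexp (R : realType) (z : R[i]) : R[i] :=
  (expR (complex.Re z))%:C * (cos (complex.Im z) +i* sin (complex.Im z)).

Definition csin (R : realType) (z : R[i]) : R[i] :=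
  (cexp ('i * z) - cexp (- ('i * z))) / (2%:R * 'i).

(* x ^ s = exp (s ln x) with the real logarithm; only meaningful for 0 < x. *)
Definition cpowR (R : realType) (x : R) (s : R[i]) : R[i] :=
  cexp (s * (ln x)%:C).

(* R[i]^o is R[i] with the topology given by its modulus. *)

(* The entire function 1/Gamma, by the Gauss-Euler limit
   1/Gamma(z) = lim_n z (z + 1) ... (z + n) / (n! n^z),
   which converges for every complex z and vanishes at 0, -1, -2, ... *)
Definition rGamma (R : realType) (z : R[i]) : R[i] :=
  limn (fun n : nat => (
    (\prod_(j < n.+1) (z + j%:R)) / (n`!%:R * cpowR n%:R z)) : R[i]^o).

Definition MittagLeffler (R : realType) (a b z : R[i]) : R[i] :=
  limn (series (fun k : nat => z ^+ k * rGamma (b + a * k%:R)) : nat -> R[i]^o).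

(* I_nu and K_nu at a positive real argument x, where (x / 2)^(nu + 2k) is
   unambiguous. *)
Definition besselI (R : realType) (nu : R[i]) (x : R) : R[i] :=
  limn (series (fun k : nat =>
    cpowR (x / 2%:R) (nu + 2%:R * k%:R) / k`!%:R * rGamma (nu + k%:R + 1)) : nat -> R[i]^o).

(* Only meaningful when nu is not an integer. *)
Definition besselK (R : realType) (nu : R[i]) (x : R) : R[i] :=
  pi%:C / (2%:R * csin (pi%:C * nu)) * (besselI (- nu) x - besselI nu x).

(* Lebesgue integral on the real line of a complex-valued function, through its
   real and imaginary parts. *)
Definition cintegrable (R : realType) (D : set R) (f : R -> R[i]) : Prop :=
  (lebesgue_measure : set R -> \bar R).-integrable D
    (EFin \o (fun u => complex.Re (f u))) /\
  (lebesgue_measure : set R -> \bar R).-integrable D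
    (EFin \o (fun u => complex.Im (f u))).

Definition cintegral (R : realType) (D : set R) (f : R -> R[i]) : R[i] :=
  Rintegral lebesgue_measure D (fun u => complex.Re (f u)) +i*
  Rintegral lebesgue_measure D (fun u => complex.Im (f u)).

(* Main.v *)
Require Import Defs.
From HB Require Import structures.
From mathcomp Require Import all_boot all_order all_algebra.
From mathcomp Require Import all_classical all_reals all_analysis.
From mathcomp Require Import measurable_realfun complex ring lra.
Set Implicit Arguments.
Unset Strict Implicit.
Unset Printing Implicit Defensive.
Import Order.TTheory GRing.Theory Num.Theory.
Import numFieldNormedType.Exports.
Local Open Scope classical_set_scope.
Local Open Scope ring_scope.
Local Open Scope complex_scope.

(** With p = b + 2/3 or p = b - 1/3 the kernel is u^(p - 7/6) K_(1/3)(2 sqrt u).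
    The Macdonald integral of K_nu gives its Mellin transform at p + a k as a
    multiple of Gamma(p + a k) Gamma(p + a k - 1/3).  By the triplication formula
    this product turns the coefficient 1/Gamma(3b + 3ak) (or 1/Gamma(3b - 2 + 3ak))
    into 3^(-3ak)/Gamma(b + a k), up to a constant.  Integrating the series of
    E_(3a, .) term by term gives both identities; dominated convergence applies
    because Im(a k) only costs a geometric factor in |1/Gamma|.
    The Macdonald integral is identified with the I-series through the Wronskians
    of solutions of the Bessel equation, from their limits at 0. *)

(** Every special function here is a [limn], so its defining formula can be used only after
    convergence is proved. The Gauss product is tied to Euler's integral [GammaC] by integrating (1
    - t/N)^m against t^(s-1), a beta integral whose value is an inverse Gauss product. The cost of
    an imaginary part, and with it the nonvanishing of [GammaC], is read off these products factor
    by factor.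

    Both ranges of b say Re p > 1/3: the Macdonald integral grows like u^(-1/3) at 0, so this is
    convergence of the Mellin integral for k = 0, and larger k only raise the exponent.

    The obstacle is the summability of the integrals of absolute values, which sets a product of two
    Gammas against one reciprocal Gamma. The modulus of the k-th integrand is a constant times the
    kernel at the real parts of the parameters, so its integral is known exactly, and the
    triplication relation at these real parts turns it back into a single reciprocal Gamma. Hence
    the relation is used twice: at the complex parameters for the values of the terms, at their real
    parts for domination. *)

Local Notation Re := (@complex.Re _).
Local Notation Im := (@complex.Im _).
Local Notation normc := (@Normc.normc _).

Arguments Normc.normc : simpl never.
Arguments cexp : simpl never.
Arguments cpowR : simpl never.

(** * Complex numbers by components: modulus, limits, exponential and powers *)

Section ComplexBasics.
Variable R : realType.
Implicit Types (x y t : R) (s z w : R[i]).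

Lemma ReD z w : Re (z + w) = Re z + Re w. Proof. by case: z; case: w. Qed.
Lemma ImD z w : Im (z + w) = Im z + Im w. Proof. by case: z; case: w. Qed.
Lemma ReN z : Re (- z) = - Re z. Proof. by case: z. Qed.
Lemma ImN z : Im (- z) = - Im z. Proof. by case: z. Qed.
Lemma ReM z w : Re (z * w) = Re z * Re w - Im z * Im w.
Proof. by case: z; case: w. Qed.
Lemma ImM z w : Im (z * w) = Re z * Im w + Im z * Re w.
Proof. by case: z; case: w. Qed.
Lemma ReZr z x : Re (z * x%:C) = Re z * x.
Proof. by rewrite ReM /= mulr0 subr0. Qed.
Lemma ImZr z x : Im (z * x%:C) = Im z * x.
Proof. by rewrite ImM /= mulr0 add0r. Qed.
Lemma complex_ext z w : Re z = Re w -> Im z = Im w -> z = w.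
Proof. by case: z; case: w => /= ? ? ? ? -> ->. Qed.

Lemma natC n : n%:R = (n%:R : R)%:C. Proof. by rewrite rmorph_nat. Qed.
Lemma Re_nat n : Re n%:R = n%:R :> R. Proof. by rewrite natC. Qed.
Lemma Im_nat n : Im n%:R = 0 :> R. Proof. by rewrite natC. Qed.

Lemma normc_ge0 z : 0 <= normc z. Proof. by case: z => a b; exact: sqrtr_ge0. Qed.
Lemma normc_real x : normc x%:C = `|x|.
Proof. by rewrite /Normc.normc /= expr0n addr0 sqrtr_sqr. Qed.
Lemma normc_sum I (r : seq I) (P : pred I) (F : I -> R[i]) :
  normc (\sum_(i <- r | P i) F i) <= \sum_(i <- r | P i) normc (F i).
Proof.
elim/big_rec2: _ => [|i y1 y2 _ le]; first by rewrite Normc.normc0.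
by rewrite (le_trans (le_normcD _ _))// lerD2l.
Qed.
Lemma normc_prod I (r : seq I) (P : pred I) (F : I -> R[i]) :
  normc (\prod_(i <- r | P i) F i) = \prod_(i <- r | P i) normc (F i).
Proof.
elim/big_rec2: _ => [|i y1 y2 _ <-]; first by rewrite Normc.normc1.
by rewrite Normc.normcM.
Qed.
Lemma normcX z n : normc (z ^+ n) = normc z ^+ n.
Proof.
elim: n => [|n IH]; first by rewrite !expr0 Normc.normc1.
by rewrite !exprS Normc.normcM IH.
Qed.
Lemma normc_eq0 z : (normc z == 0) = (z == 0).
Proof.
apply/eqP/eqP => [|->]; first exact: Normc.eq0_normc.
exact: Normc.normc0.
Qed.
Lemma Re_le_normc z : `|Re z| <= normc z.
Proof.
case: z => a b; rewrite /Normc.normc /= -sqrtr_sqr ler_wsqrtr// lerDl; exact: sqr_ge0.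
Qed.
Lemma Im_le_normc z : `|Im z| <= normc z.
Proof.
case: z => a b; rewrite /Normc.normc /= -sqrtr_sqr ler_wsqrtr// lerDr; exact: sqr_ge0.
Qed.
Lemma normc_le z : normc z <= `|Re z| + `|Im z|.
Proof.
case: z => a b; rewrite /Normc.normc /= -(ler_pXn2r (n := 2)) ?nnegrE ?sqrtr_ge0 ?addr_ge0//.
rewrite sqr_sqrtr ?addr_ge0 ?sqr_ge0// sqrrD !real_normK ?num_real//.
rewrite -addrA lerD2l lerDr mulrn_wge0// mulr_ge0//.
Qed.

Lemma cvg_complexP (u : nat -> R[i]^o) (l : R[i]^o) :
  u @ \oo --> l <-> (Re \o u) @ \oo --> Re l /\ (Im \o u) @ \oo --> Im l.
Proof.
split=> [ul|[ur ui]].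
  have H (e : R) : 0 < e -> \forall n \near \oo, normc (l - u n) <= e.
    move=> e0; have /cvgrPdist_le/(_ e%:C) := ul.
    rewrite ltcR => /(_ e0); apply: filterS => n.
    by rewrite normc_def lecR; case: (l - u n).
  split; apply/cvgrPdist_le => e /H; apply: filterS => n; apply: le_trans.
    by rewrite /= -ReN -ReD Re_le_normc.
  by rewrite /= -ImN -ImD Im_le_normc.
(* The radius is itself an element of [R[i]]; its positivity forces a zero imaginary part, so it is
   a real [a], shared between the two components. *)
apply/cvgrPdist_le => e; case: e => a b; rewrite ltcE /= => /andP[/eqP b0 a0].
have a20 : 0 < a / 2 by rewrite divr_gt0.
move/cvgrPdist_le : ur => /(_ _ a20); apply: filter_app.
move/cvgrPdist_le : ui => /(_ _ a20); apply: filterS => n hi hr.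
change (`|(l - u n : R[i])| <= a +i* b); rewrite normc_def b0 lecR; apply: (le_trans (y := normc (l - u n))).
  by case: (l - u n).
rewrite (le_trans (normc_le _))// !ReD !ImD !ReN !ImN.
by rewrite (splitr a) lerD.
Qed.

Lemma cvg_normc (u : nat -> R[i]^o) (l : R[i]^o) :
  u @ \oo --> l -> (normc \o u) @ \oo --> normc l.
Proof.
move=> /cvg_norm /cvg_complexP[h _].
have E (z : R[i]^o) : normc z = Re `|z|.
  by rewrite [RHS](congr1 Re (normc_def z)); case: z.
by rewrite E (_ : normc \o u = Re \o (fun n => `|u n|)) //; apply/funext => n /=.
Qed.

Lemma cvgC_lim (u : nat -> R[i]^o) (l : R[i]^o) : u @ \oo --> l -> limn u = l.
Proof. by apply: cvg_lim; exact: norm_hausdorff. Qed.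

Lemma cexpD z w : cexp (z + w) = cexp z * cexp w :> R[i].
Proof.
rewrite /cexp ReD ImD expRD cosD sinD.
by apply: complex_ext; rewrite /=; ring.
Qed.
Lemma Re_cexp z : Re (cexp z) = expR (Re z) * cos (Im z).
Proof. by rewrite /cexp mulrC ReZr mulrC. Qed.
Lemma Im_cexp z : Im (cexp z) = expR (Re z) * sin (Im z).
Proof. by rewrite /cexp mulrC ImZr mulrC. Qed.
Lemma cexp_real x : cexp x%:C = (expR x)%:C.
Proof. by rewrite /cexp /= cos0 sin0; apply: complex_ext; rewrite /=; ring. Qed.
Lemma cexp0 : cexp 0 = 1 :> R[i].
Proof. by rewrite (_ : 0 = 0%:C) // cexp_real expR0. Qed.
Lemma normc_cexp z : normc (cexp z) = expR (Re z).
Proof.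
rewrite /cexp Normc.normcM normc_real /Normc.normc cos2Dsin2 sqrtr1 mulr1.
by rewrite ger0_norm ?expR_ge0.
Qed.
Lemma cexp_neq0 z : cexp z != 0 :> R[i].
Proof. by rewrite -normc_eq0 normc_cexp gt_eqF ?expR_gt0. Qed.
Lemma cexpN z : cexp (- z) = (cexp z)^-1 :> R[i].
Proof.
by apply: (mulfI (cexp_neq0 z)); rewrite -cexpD subrr cexp0 divff// cexp_neq0.
Qed.
Lemma cexpX z n : cexp z ^+ n = cexp (z * n%:R) :> R[i].
Proof.
elim: n => [|n IH]; first by rewrite mulr0 cexp0.
by rewrite exprS IH -cexpD -natr1 mulrDr mulr1 addrC.
Qed.

Lemma cpowRD x s (t : R[i]) : cpowR x (s + t) = cpowR x s * cpowR x t :> R[i].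
Proof. by rewrite /cpowR mulrDl cexpD. Qed.
Lemma cpowRN x s : cpowR x (- s) = (cpowR x s)^-1 :> R[i].
Proof. by rewrite /cpowR mulNr cexpN. Qed.
Lemma cpowR1 s : cpowR 1 s = 1 :> R[i].
Proof. by rewrite /cpowR ln1 mulr0 cexp0. Qed.
Lemma cpowR_neq0 x s : cpowR x s != 0 :> R[i].
Proof. exact: cexp_neq0. Qed.
Lemma cpowRX x s n : cpowR x s ^+ n = cpowR x (s * n%:R) :> R[i].
Proof. by rewrite /cpowR cexpX mulrAC. Qed.
Lemma cpowRM x y s : 0 < x -> 0 < y -> cpowR (x * y) s = cpowR x s * cpowR y s.
Proof. by move=> x0 y0; rewrite /cpowR lnM ?posrE// raddfD mulrDr cexpD. Qed.
Lemma cpowR_real x t : 0 < x -> cpowR x t%:C = (x `^ t)%:C.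
Proof. by move=> x0; rewrite /cpowR -rmorphM cexp_real /powR gt_eqF. Qed.
Lemma cpowR_r1 x : 0 < x -> cpowR x 1 = x%:C.
Proof. by move=> x0; rewrite (_ : 1 = 1%:C)// cpowR_real// powRr1 ?ltW. Qed.
Lemma cpowR_nat x n : 0 < x -> cpowR x n%:R = x%:C ^+ n.
Proof. by move=> x0; rewrite -(cpowR_r1 x0) cpowRX mul1r. Qed.
Lemma cpowRV x s : 0 < x -> cpowR x^-1 s = (cpowR x s)^-1.
Proof. by move=> x0; rewrite /cpowR lnV// raddfN mulrN cexpN. Qed.
Lemma normc_cpowR x s : 0 < x -> normc (cpowR x s) = x `^ Re s.
Proof. by move=> x0; rewrite /cpowR normc_cexp ReZr /powR gt_eqF. Qed.

End ComplexBasics.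

(** * Measurability and Lebesgue integration of complex-valued functions *)

Definition cmeasurable (R : realType) (D : set R) (f : R -> R[i]) :=
  measurable_fun D (Re \o f) /\ measurable_fun D (Im \o f).

(* [cintegrable] refers to the default measurable structure on [R], the library
   of the Lebesgue measure to the structure generated by the intervals; these
   differ by an opaque display only. *)
Definition cinteg (R : realType) (D : set R) (f : R -> R[i]) :=
  (@lebesgue_measure R).-integrable D (EFin \o (Re \o f)) /\
  (@lebesgue_measure R).-integrable D (EFin \o (Im \o f)).

Section Display.
Import HBNNSimple.

(** An integral is built from suprema over simple functions, and a simple function for one structure
    can be repacked as one for the other, so the suprema range over the same sets. *)
Lemma integrable_display (R : realType) (D : set R) (f : R -> \bar R) :
  (@lebesgue_measure R).-integrable D f ->
  (lebesgue_measure : set R -> \bar R).-integrable D f.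
Proof.
move=> /integrableP[mf fin]; apply/integrableP; split; first exact: mf.
apply: le_lt_trans fin.
rewrite /integral.
have H (g : R -> \bar R) : 
 [set sintegral lebesgue_measure h
    | h in [set h : {nnsfun R >-> R} | forall x, ((h x)%:E <= g x)%E]] =
 [set sintegral (@lebesgue_measure R) h
    | h in [set h : {nnsfun (measurableTypeR R) >-> R} | forall x, ((h x)%:E <= g x)%E]].
  apply/seteqP; split => _ [h hg <-].
    have nh x : 0 <= h x by exact: fun_ge0.
    pose h' : {nnsfun (measurableTypeR R) >-> R} := HB.pack (h : measurableTypeR R -> R)
      (isMeasurableFun.Build _ _ (measurableTypeR R) R h (measurable_funPT h)) (FiniteImage.Build _ _ h (fimfunP h)) (isNonNegFun.Build _ _ h nh).
    by exists h'.
  have nh x : 0 <= h x by exact: fun_ge0.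
  pose h' : {nnsfun R >-> R} := HB.pack (h : R -> R)
      (isMeasurableFun.Build _ _ R R h (measurable_funPT h)) (FiniteImage.Build _ _ h (fimfunP h)) (isNonNegFun.Build _ _ h nh).
    by exists h'.
by rewrite !H.
Qed.

Lemma cinteg_cintegrable (R : realType) (D : set R) (f : R -> R[i]) :
  cinteg D f -> cintegrable D f.
Proof. by move=> [fr fi]; split; apply: integrable_display. Qed.

End Display.

Section ComplexIntegral.
Variable R : realType.
Local Notation mu := (@lebesgue_measure R).
Implicit Types (D : set R) (f : R -> R[i]) (g : R -> R).

Lemma measurable_EFinR D g : measurable_fun D g ->
  @measurable_fun _ _ (measurableTypeR R) (\bar R) D (EFin \o g).
Proof. by move=> mg; have /measurable_EFinP := mg. Qed.

Lemma cmeasurableM D f h :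
  cmeasurable D f -> cmeasurable D h -> cmeasurable D (fun x => f x * h x).
Proof.
move=> [fr fi] [hr hi]; split.
  rewrite (_ : _ \o _ = fun x => (Re \o f) x * (Re \o h) x - (Im \o f) x * (Im \o h) x).
    by apply: measurable_funB; apply: measurable_funM.
  by apply/funext => x /=; rewrite ReM.
rewrite (_ : _ \o _ = fun x => (Re \o f) x * (Im \o h) x + (Im \o f) x * (Re \o h) x).
  by apply: measurable_funD; apply: measurable_funM.
by apply/funext => x /=; rewrite ImM.
Qed.

Lemma cmeasurable_real D g :
  measurable_fun D g -> cmeasurable D (fun x => (g x)%:C).
Proof. by move=> mg; split => //; apply: measurable_cst. Qed.

Lemma cmeasurable_cpowR D (s : R[i]) : cmeasurable D (fun x => cpowR x s).
Proof.
have mln : measurable_fun D (@ln R) by apply: measurable_funTS; exact: measurable_ln.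
have m1 : measurable_fun D (fun x : R => Re s * ln x) by apply: measurable_funM.
have m2 : measurable_fun D (fun x : R => Im s * ln x) by apply: measurable_funM.
have me : measurable_fun D (fun x : R => expR (Re s * ln x)).
  by apply: measurableT_comp => //; exact: measurable_expR.
split.
  rewrite (_ : _ \o _ = fun x => expR (Re s * ln x) * cos (Im s * ln x)).
    apply: measurable_funM => //; apply: measurableT_comp => //.
    by apply: continuous_measurable_fun; exact: continuous_cos.
  apply/funext => x; transitivity (Re (cexp (s * (ln x)%:C))) => //.
  by rewrite Re_cexp ReZr ImZr.
rewrite (_ : _ \o _ = fun x => expR (Re s * ln x) * sin (Im s * ln x)).
  apply: measurable_funM => //; apply: measurableT_comp => //.
  by apply: continuous_measurable_fun; exact: continuous_sin.
apply/funext => x; transitivity (Im (cexp (s * (ln x)%:C))) => //.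
by rewrite Im_cexp ReZr ImZr.
Qed.

Lemma cmeasurable_normc D f : cmeasurable D f -> measurable_fun D (normc \o f).
Proof.
move=> [mr mi].
rewrite (_ : _ \o _ = fun x => ((Re \o f) x ^+ 2 + (Im \o f) x ^+ 2) `^ 2^-1).
  apply: (measurableT_comp (measurable_powR 2^-1)).
  by apply: measurable_funD; apply: measurable_funX.
apply/funext => x /=; rewrite powR12_sqrt; first by case: (f x).
by rewrite addr_ge0 ?sqr_ge0.
Qed.

Lemma cintegrable_le D f g : measurable D -> cmeasurable D f ->
  mu.-integrable D (EFin \o g) -> (forall x, D x -> normc (f x) <= g x) ->
  cinteg D f.
Proof.
move=> mD [mr mi] ig fg; split; apply: (@le_integrable _ (measurableTypeR R) _ _ D mD _ (EFin \o g)) => //.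
- exact/measurable_EFinP.
- move=> x Dx /=; rewrite lee_fin (le_trans (Re_le_normc _))//.
  by rewrite (le_trans (fg _ Dx))// ler_norm.
- exact/measurable_EFinP.
- move=> x Dx /=; rewrite lee_fin (le_trans (Im_le_normc _))//.
  by rewrite (le_trans (fg _ Dx))// ler_norm.
Qed.

Lemma cintegral_cvg D (F : nat -> R -> R[i]) f g : measurable D ->
  (forall n, cmeasurable D (F n)) -> cmeasurable D f ->
  (forall x, D x -> (F ^~ x : nat -> R[i]^o) @ \oo --> (f x : R[i]^o)) ->
  mu.-integrable D (EFin \o g) ->
  (forall n x, D x -> normc (F n x) <= g x) ->
  cinteg D f /\
  ((fun n => cintegral D (F n)) : nat -> R[i]^o) @ \oo --> (cintegral D f : R[i]^o).
Proof.
move=> mD mF [mr mi] Ff ig Fg.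
(* [P] stands for [Re] and [Im], so that real dominated convergence is set up once for both
   components. *)
have H (P : R[i] -> R) : (forall z, `|P z| <= normc z) ->
    (forall n, measurable_fun D (P \o F n)) -> measurable_fun D (P \o f) ->
    (forall x, D x -> P (F n x) @[n --> \oo] --> P (f x)) ->
    mu.-integrable D (EFin \o (P \o f)) /\
    (fun n => Rintegral mu D (P \o F n)) @ \oo --> Rintegral mu D (P \o f).
  move=> PN mPF mPf cP.
  have [] := @dominated_convergence _ (measurableTypeR R) _ lebesgue_measure D mD (fun n => EFin \o (P \o F n))
      (EFin \o (P \o f)) (EFin \o g).
  - by move=> n; exact: measurable_EFinR.
  - exact: measurable_EFinR.
  - apply: aeW => x Dx; apply: cvg_EFin; last exact: cP.
    by apply: nearW.
  - exact: ig.
  - by apply: aeW => x n Dx /=; rewrite lee_fin (le_trans (PN _))// Fg.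
  - move=> ipf _ cv; split=> //.
    apply: fine_cvg.
    by rewrite /Rintegral fineK//; exact: integrable_fin_num.
have [] := H (@complex.Re R).
- exact: Re_le_normc.
- by move=> n; case: (mF n).
- by [].
- by move=> x /Ff /cvg_complexP[].
- move=> ir cr.
  have [] := H (@complex.Im R).
  + exact: Im_le_normc.
  + by move=> n; case: (mF n).
  + by [].
  + by move=> x /Ff /cvg_complexP[].
  + move=> ii ci; split; first by split.
    by apply/cvg_complexP; split.
Qed.

Lemma cintegrableZ D f (c : R[i]) : measurable D -> cinteg D f ->
  cinteg D (fun x => c * f x).
Proof.
move=> mD [ir ii]; split.
  rewrite (_ : _ \o _ = ((fun x => (Re c)%:E * (EFin \o (Re \o f)) x) \-
                        (fun x => (Im c)%:E * (EFin \o (Im \o f)) x))%E).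
    by apply: integrableB => //; apply: integrableZl.
  by apply/funext => x /=; rewrite ReM EFinB !EFinM.
rewrite (_ : _ \o _ = ((fun x => (Re c)%:E * (EFin \o (Im \o f)) x) \+
                        (fun x => (Im c)%:E * (EFin \o (Re \o f)) x))%E).
  by apply: integrableD => //; apply: integrableZl.
by apply/funext => x /=; rewrite ImM EFinD !EFinM.
Qed.

Lemma cintegralZ D f (c : R[i]) : measurable D -> cinteg D f ->
  cintegral D (fun x => c * f x) = c * cintegral D f.
Proof.
move=> mD [ir ii].
have iZ k (h : R -> R) : mu.-integrable D (EFin \o h) ->
    mu.-integrable D (EFin \o (fun x => k * h x)).
  move=> ih; rewrite (_ : _ \o _ = fun x => (k%:E * (EFin \o h) x)%E)//.
  exact: integrableZl.
rewrite /cintegral; apply: complex_ext; rewrite /= ?ReM ?ImM /=.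
  under eq_Rintegral do rewrite ReM.
  by rewrite RintegralB//; [rewrite !RintegralZl|apply: iZ|apply: iZ].
under eq_Rintegral do rewrite ImM.
by rewrite RintegralD//; [rewrite !RintegralZl|apply: iZ|apply: iZ].
Qed.

Lemma cintegrableD D f h : measurable D -> cinteg D f -> cinteg D h ->
  cinteg D (fun x => f x + h x).
Proof.
move=> mD [fr fi] [hr hi]; split.
  rewrite (_ : _ \o _ = ((EFin \o (Re \o f)) \+ (EFin \o (Re \o h)))%E).
    exact: integrableD.
  by apply/funext => x /=; rewrite ReD EFinD.
rewrite (_ : _ \o _ = ((EFin \o (Im \o f)) \+ (EFin \o (Im \o h)))%E).
  exact: integrableD.
by apply/funext => x /=; rewrite ImD EFinD.
Qed.

Lemma cintegralD D f h : measurable D -> cinteg D f -> cinteg D h ->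
  cintegral D (fun x => f x + h x) = cintegral D f + cintegral D h.
Proof.
move=> mD [fr fi] [hr hi].
rewrite /cintegral; apply: complex_ext; rewrite /=.
  by under eq_Rintegral do rewrite ReD; rewrite RintegralD.
by under eq_Rintegral do rewrite ImD; rewrite RintegralD.
Qed.

Lemma eq_cintegral D f h : (forall x, D x -> f x = h x) ->
  cintegral D f = cintegral D h.
Proof.
move=> fh; rewrite /cintegral.
by congr (_ +i* _); apply: eq_Rintegral => x; rewrite inE => /fh ->.
Qed.

Lemma eq_cintegrable D f h : measurable D -> (forall x, D x -> f x = h x) ->
  cinteg D f -> cinteg D h.
Proof.
move=> mD fh [ir ii]; split.
  by apply: (@eq_integrable _ (measurableTypeR R)) ir => // x; rewrite inE => /fh /= ->.
by apply: (@eq_integrable _ (measurableTypeR R)) ii => // x; rewrite inE => /fh /= ->.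
Qed.

Lemma cintegrable_cmeasurable D f : cinteg D f -> cmeasurable D f.
Proof.
by move=> [/measurable_int/measurable_EFinP ? /measurable_int/measurable_EFinP ?].
Qed.

Lemma cintegral_sum D (F : nat -> R -> R[i]) n : measurable D ->
  (forall k, cinteg D (F k)) ->
  cinteg D (fun x => \sum_(0 <= k < n) F k x) /\
  cintegral D (fun x => \sum_(0 <= k < n) F k x) =
  \sum_(0 <= k < n) cintegral D (F k).
Proof.
move=> mD iF; elim: n => [|n [IH1 IH2]].
  split.
    under eq_fun do rewrite big_geq//.
    by split; apply: (@eq_integrable _ (measurableTypeR R) _ _ D mD (cst 0%E)) => //; exact: integrable0.
  rewrite [RHS]big_geq//; under [LHS]eq_cintegral do rewrite big_geq//.
  by rewrite /cintegral /Rintegral !integral0.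
split.
  under eq_fun do rewrite big_nat_recr//=.
  exact: cintegrableD.
rewrite [RHS]big_nat_recr//= -IH2 -cintegralD//.
by apply: eq_cintegral => x _; rewrite big_nat_recr.
Qed.

Lemma cintegrable_normc D f : measurable D -> cinteg D f ->
  mu.-integrable D (EFin \o (normc \o f)).
Proof.
move=> mD /[dup] cf [ir ii].
apply: (@le_integrable _ (measurableTypeR R) _ _ D mD _
   ((EFin \o (fun x => `|Re (f x)|%R)) \+ (EFin \o (fun x => `|Im (f x)|%R)))%E).
- apply: measurable_EFinR; apply: cmeasurable_normc.
  exact: cintegrable_cmeasurable.
- move=> x Dx.
  suff : `|normc (f x)| <= `| `|Re (f x)| + `|Im (f x)| | by rewrite -lee_fin.
  by rewrite ger0_norm ?normc_ge0// (le_trans (normc_le _))// ler_norm.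
- by apply: integrableD => //; exact: integrable_norm.
Qed.

Lemma cintegral_real D g : cintegral D (fun x => (g x)%:C) = (Rintegral mu D g)%:C.
Proof.
by rewrite /cintegral; apply: complex_ext => //=; rewrite /Rintegral integral0.
Qed.

End ComplexIntegral.

(** * Real integrals over the half-line: primitives, exhaustion by segments, the Gamma integrand *)

Section RealIntegrals.
Variable R : realType.
Local Notation mu := (@lebesgue_measure R).
Local Notation Rpos := (`]0%R, +oo[%classic : set R).
Implicit Types (f F g : R -> R).

Lemma FTC_segment F f (x y : R) : 0 < x -> x < y ->
  (forall t : R, 0 < t -> is_derive t (1 : R) F (f t)) ->
  (forall t : R, 0 < t -> {for t, continuous f}) ->
  (\int[mu]_(t in `[x, y]) (f t)%:E = (F y - F x)%:E)%E.
Proof.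
move=> x0 xy dF cf.
have gt0 t : t \in `[x, y] -> 0 < t.
  by rewrite in_itv/= => /andP[xt _]; exact: lt_le_trans xt.
have y0 : 0 < y by exact: lt_trans xy.
rewrite EFinB; apply: continuous_FTC2 => //.
- by apply: continuous_in_subspaceT => t /set_mem/gt0 /cf.
- split.
  + move=> t txy; have /dF [] // : 0 < t by apply: gt0; exact: subset_itv_oo_cc.
  + apply: cvg_at_right_filter; apply: differentiable_continuous.
    by apply/derivable1_diffP; have [] := dF _ x0.
  + apply: cvg_at_left_filter; apply: differentiable_continuous.
    by apply/derivable1_diffP; have [] := dF _ y0.
- move=> t txy; have /dF t0 : 0 < t by apply: gt0; exact: subset_itv_oo_cc.
  by rewrite derive1E derive_val.
Qed.

Lemma measurable_fun_pos f : (forall t : R, 0 < t -> {for t, continuous f}) ->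
  measurable_fun Rpos f.
Proof.
move=> cf; apply: open_continuous_measurable_fun; first exact: interval_open.
by move=> t; rewrite inE/= in_itv/= andbT => /cf.
Qed.

Lemma bigcup_pos : Rpos = \bigcup_(n : nat) `[n.+1%:R^-1, n.+1%:R]%classic.
Proof.
apply/seteqP; split => t /=; last first.
  by move=> [n _] /=; rewrite !in_itv/= andbT => /andP[+ _]; apply: lt_le_trans.
rewrite in_itv/= andbT => t0.
pose n := (Num.truncn t + Num.truncn t^-1)%N.
exists n => //=; rewrite in_itv/=; apply/andP; split.
  rewrite -[leRHS]invrK lef_pV2 ?posrE ?invr_gt0 ?ltr0n//.
  have /ltW/le_trans -> // := truncnS_gt t^-1.
  by rewrite ler_nat ltnS leq_addl.
have /ltW/le_trans -> // := truncnS_gt t.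
by rewrite ler_nat ltnS leq_addr.
Qed.

(** The exhausting segments are parameters because [macdonald_sym] compares two exhaustions, matched
    by t -> u / t. *)
Lemma ge0_cvg_integral_pos f (a b : R^nat) : measurable_fun Rpos f ->
  (forall t : R, 0 < t -> 0 <= f t) ->
  (forall n, 0 < a n) -> {homo a : n m / (n <= m)%N >-> m <= n} ->
  {homo b : n m / (n <= m)%N >-> n <= m} ->
  Rpos = \bigcup_n `[a n, b n]%classic ->
  (\int[mu]_(t in `[a n, b n]) (f t)%:E)%E @[n --> \oo] -->
  (\int[mu]_(t in Rpos) (f t)%:E)%E.
Proof.
move=> mf f0 a0 na nb ->; apply: ge0_nondecreasing_set_cvg_integral.
- move=> n m nm; rewrite subsetEset => t /=; rewrite !in_itv/= => /andP[u v].
  by rewrite (le_trans (na _ _ nm))//= (le_trans v)// nb.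
- by [].
- move=> n; apply: measurable_EFinR; apply: measurable_funS mf => // t /=.
  by rewrite !in_itv/= andbT => /andP[u _]; apply: lt_le_trans u.
- by move=> n t /=; rewrite in_itv/= => /andP[u _]; rewrite lee_fin f0// (lt_le_trans (a0 n)).
Qed.

(** On each segment [1/(n+1), n+1] the integral is an increment of [F], hence at most [M]; monotone
    convergence keeps this bound on the half-line. *)
Lemma integrable_bounded_primitive F f (M : R) :
  (forall t : R, 0 < t -> is_derive t (1 : R) F (f t)) ->
  (forall t : R, 0 < t -> {for t, continuous f}) ->
  (forall t : R, 0 < t -> 0 <= f t) ->
  (forall t : R, 0 < t -> 0 <= F t <= M) ->
  mu.-integrable Rpos (EFin \o f).
Proof.
move=> dF cf f0 FM; have mf := measurable_fun_pos cf.
apply/integrableP; split; first exact: measurable_EFinR.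
have -> : (\int[mu]_(t in Rpos) `|(EFin \o f) t|)%E =
          (\int[mu]_(t in Rpos) (f t)%:E)%E.
  apply: eq_integral => t; rewrite inE/= in_itv/= andbT => t0.
  by rewrite ger0_norm// f0.
have Sn0 (n : nat) : (0 : R) < n.+1%:R^-1 by rewrite invr_gt0.
have := @ge0_cvg_integral_pos f (fun n => n.+1%:R^-1) (fun n => n.+1%:R) mf f0.
move=> /(_ Sn0) cv; apply: (@le_lt_trans _ _ M%:E); last exact: ltry.
apply: (cvge_le _ (cv _ _ bigcup_pos)).
(* For n = 0 the segment is the single point 1, outside the scope of [FTC_segment]. *)
- apply: nearW => n; have [n1|n1] := ltP (n.+1%:R^-1 : R) n.+1%:R.
    rewrite (FTC_segment _ n1 dF cf)// lee_fin lerBlDr.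
    have /andP[_ /le_trans->//] := FM n.+1%:R (ltr0Sn R n).
    by rewrite lerDl; have /andP[] := FM _ (Sn0 n).
  have M0 : 0 <= M by have /andP[+ +] := FM 1 ltr01; apply: le_trans.
  move: n1; rewrite le_eqVlt => /predU1P[<-|n1].
    by rewrite set_itv1 integral_set1.
  by rewrite set_itv_ge ?integral_set0// bnd_simp -ltNge.
- by move=> n m nm; rewrite lef_pV2 ?posrE// ler_nat.
- by move=> n m nm; rewrite ler_nat.
Qed.

Lemma is_derive_continuous f (x df : R) :
  is_derive x (1 : R) f df -> {for x, continuous f}.
Proof.
by move=> [dfx _]; apply: differentiable_continuous; exact/derivable1_diffP.
Qed.

Lemma continuous_powR (p x : R) : 0 < x -> {for x, continuous (@powR R ^~ p)}.
Proof. by move=> x0; apply: is_derive_continuous; exact: is_derive1_powR. Qed.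

Lemma is_derive_powR1D (p x : R) : 0 < x ->
  is_derive x (1 : R) (fun t => (1 + t) `^ p) (p * (1 + x) `^ (p - 1)).
Proof.
move=> x0; have x1 : 0 < 1 + x by rewrite addr_gt0.
have d1 : is_derive x (1 : R) (fun t : R => 1 + t) 1.
  by have := is_deriveD (is_derive_cst (1 : R) x 1) (is_derive_id x (1 : R)); rewrite add0r.
have d2 := is_derive1_powR p x1.
have := is_derive1_comp d2 d1.
by rewrite /GRing.scale/= mulr1.
Qed.

(** The integrand is the derivative of (t / (1 + t))^s / s, which stays between 0 and 1/s. It serves
    as an explicit majorant of the Gamma integrand. *)
Lemma integrable_beta (s : R) : 0 < s -> mu.-integrable Rpos
  (EFin \o (fun t => t `^ (s - 1) * (1 + t) `^ (- (s + 1)))).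
Proof.
move=> s0.
have p1 (t : R) : 0 < t -> 0 < 1 + t by move=> t0; rewrite addr_gt0.
apply: (@integrable_bounded_primitive
    (fun t => s^-1 * (t `^ s * (1 + t) `^ (- s))) _ s^-1).
- move=> t t0; have d1 := is_derive1_powR s t0.
  have d2 := is_derive_powR1D (- s) t0.
  apply: is_derive_eq; rewrite /GRing.scale/=.
  have -> : (1 + t) `^ (- s) = (1 + t) * (1 + t) `^ (- (s + 1)).
    rewrite -[X in X * _]powRr1 ?(ltW (p1 _ t0))// -powRD; last first.
      by rewrite (gt_eqF (p1 _ t0)) implybT.
    by congr (_ `^ _); ring.
  have -> : t `^ s = t * t `^ (s - 1) by rewrite mulr_powRB1// ltW.
  rewrite (_ : - s - 1 = - (s + 1)); last by ring.
  have sn0 : s != 0 by rewrite gt_eqF.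
  by field.
- move=> t t0; apply: cvgM; first exact: continuous_powR.
  exact: (is_derive_continuous (is_derive_powR1D _ t0)).
- by move=> t t0; rewrite mulr_ge0// powR_ge0.
- move=> t t0; have t1 := p1 _ t0.
  apply/andP; split; first by rewrite !mulr_ge0 ?powR_ge0 ?invr_ge0 ?ltW.
  rewrite -[leRHS]mulr1 ler_wpM2l ?invr_ge0 ?(ltW s0)//.
  rewrite powRN ler_pdivrMr ?powR_gt0// mul1r.
  by rewrite ge0_ler_powR ?nnegrE ?(ltW s0) ?(ltW t0) ?(ltW t1)// lerDr.
Qed.

(** With c = lam / p, the constant comes from 1 + t <= (1 + 1/c)(1 + c t) <= (1 + 1/c) exp(c t),
    raised to the power p. *)
Lemma powR1D_le_expR (p lam : R) : 0 < p -> 0 < lam ->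
  exists2 C : R, 0 < C & forall t : R, 0 < t -> (1 + t) `^ p <= C * expR (lam * t).
Proof.
move=> p0 l0; pose c := lam / p; have c0 : 0 < c by rewrite divr_gt0.
have K0 : 0 < 1 + c^-1 by rewrite addr_gt0 ?invr_gt0.
exists ((1 + c^-1) `^ p); first by rewrite powR_gt0.
move=> t t0; have -> : expR (lam * t) = expR (c * t) `^ p.
  by rewrite -expRM; congr expR; rewrite /c mulrAC divfK ?gt_eqF.
rewrite -powRM ?expR_ge0 ?(ltW K0)//.
rewrite ge0_ler_powR ?nnegrE ?(ltW p0) ?addr_ge0 ?mulr_ge0 ?expR_ge0 ?(ltW K0) ?(ltW t0)//.
apply: (@le_trans _ _ ((1 + c^-1) * (1 + c * t))); last first.
  by rewrite ler_wpM2l ?expR_ge1Dx// ltW.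
have -> : (1 + c^-1) * (1 + c * t) = 1 + t + (c * t + c^-1).
  by clearbody c; field; rewrite gt_eqF.
by rewrite lerDl addr_ge0 ?mulr_ge0 ?invr_ge0 ?ltW.
Qed.

Lemma integrable_gamma (s lam : R) : 0 < s -> 0 < lam -> mu.-integrable Rpos
  (EFin \o (fun t => t `^ (s - 1) * expR (- (lam * t)))).
Proof.
move=> s0 l0; have s10 : 0 < s + 1 by rewrite addr_gt0.
have [C C0 HC] := powR1D_le_expR s10 l0.
have ib := integrable_beta s0.
have ibC : mu.-integrable Rpos
    (fun t => C%:E * (EFin \o (fun t => t `^ (s - 1) * (1 + t) `^ (- (s + 1)))%R) t)%E.
  exact: integrableZl.
apply: (@le_integrable _ (measurableTypeR R) _ _ Rpos _ _ _ _ _ ibC) => //.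
  apply: measurable_EFinR; apply: measurable_fun_pos => t t0.
  apply: cvgM; first exact: continuous_powR.
  apply: (@continuous_comp _ _ _ (fun t => - (lam * t)) expR); last exact: continuous_expR.
  by apply: cvgN; apply: cvgM; [exact: cvg_cst|exact: cvg_id].
move=> t /=; rewrite in_itv/= andbT => t0.
rewrite lee_fin ger0_norm ?mulr_ge0 ?powR_ge0 ?expR_ge0//.
rewrite (le_trans _ (ler_norm _))// mulrCA ler_wpM2l ?powR_ge0//.
have t10 : 0 < (1 + t) `^ (s + 1) by rewrite powR_gt0// addr_gt0.
by rewrite expRN powRN -[leLHS]mul1r ler_pdivrMr ?expR_gt0// mulrAC ler_pdivlMr// mul1r HC.
Qed.

(** [f] may blow up at 0, so the fundamental theorem is applied on [x, N]: the integral up to x plus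
    F N - F x is constant in x, and tends to F N as x tends to 0. *)
Lemma Rintegral_primitive F f (N : R) : 0 < N ->
  (forall t : R, 0 < t -> is_derive t (1 : R) F (f t)) ->
  (forall t : R, 0 < t -> {for t, continuous f}) ->
  F x @[x --> 0^'+] --> 0 ->
  mu.-integrable `]0, N] (EFin \o f) ->
  Rintegral mu `]0, N] f = F N.
Proof.
move=> N0 dF cf F0 fi.
have mf : measurable_fun `]0, N] f by move/measurable_int/measurable_EFinP : fi.
have fi' : mu.-integrable `[0, N] (EFin \o f).
  have e : `[0, N]%classic = [set 0] `|` `]0, N]%classic :> set R.
    by rewrite setU1itv// bnd_simp ltW.
  apply/integrableP; split.
    apply: measurable_EFinR; rewrite e; apply/measurable_funU => //; split => //.
    exact: measurable_fun_set1.
  rewrite -integral_itv_obnd_cbnd; first by move/integrableP : fi => [].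
  by apply: measurableT_comp => //; exact: measurable_EFinR.
have c0 := @parameterized_integral_cvg_left _ 0 N f N0 fi'.
have c1 := cvg_at_right_filter c0.
have {c0 c1} c2 : (parameterized_integral mu 0 x f + (F N - F x)) @[x --> 0^'+] --> 0 + (F N - 0).
  by apply: cvgD => //; apply: cvgB => //; exact: cvg_cst.
rewrite add0r subr0 in c2.
suff : Rintegral mu `]0, N] f @[x --> (0 : R)^'+] --> F N.
  move=> c3; have c4 : Rintegral mu `]0, N] f @[x --> (0 : R)^'+] --> Rintegral mu `]0, N] f.
    exact: cvg_cst.
  by rewrite -(cvg_lim (@norm_hausdorff _ R) c3) (cvg_lim (@norm_hausdorff _ R) c4).
apply: cvg_trans c2; apply: near_eq_cvg; near=> x.
have x0 : 0 < x by [].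
have xN : x < N by near: x; exact: nbhs_right_lt.
rewrite /parameterized_integral.
have -> : F N - F x = \int[mu]_(t in `]x, N]) f t.
  rewrite /Rintegral integral_itv_obnd_cbnd ?(FTC_segment x0 xN dF cf)//.
  apply: measurable_EFinR; apply: measurable_funS mf => // t /=.
  by rewrite !in_itv/= => /andP[/(lt_trans x0) -> ->].
rewrite -(@Rintegral_itvB _ f (BLeft 0) (BRight N) x) ?bnd_simp ?(ltW xN) ?(ltW x0)//.
rewrite addrCA subrr addr0 -Rintegral_itv_obnd_cbnd//.
Unshelve. all: end_near. Qed.

End RealIntegrals.

(* [rGamma z] is the limit of [gaussp ^~ z]. *)
Definition gaussp (R : realType) (n : nat) (z : R[i]) : R[i] :=
  (\prod_(j < n.+1) (z + j%:R)) / (n`!%:R * cpowR n%:R z).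

Definition GammaC (R : realType) (s : R[i]) : R[i] :=
  cintegral `]0, +oo[ (fun t => cpowR t (s - 1) * (expR (- t))%:C).

(** * Derivative and integral of complex powers of a positive variable *)

Section Gauss.
Variable R : realType.
Local Notation mu := (@lebesgue_measure R).
Local Notation Rpos := (`]0%R, +oo[%classic : set R).
Implicit Types (s z : R[i]) (t x N lam : R).

Lemma cpowRB1 t s : 0 < t -> cpowR t (s - 1) = cpowR t s * (t^-1)%:C.
Proof. by move=> t0; rewrite cpowRD cpowRN cpowR_r1// fmorphV. Qed.

Lemma Re_cpowRE s t : Re (cpowR t s) = expR (Re s * ln t) * cos (Im s * ln t).
Proof. by rewrite /cpowR Re_cexp ReZr ImZr. Qed.
Lemma Im_cpowRE s t : Im (cpowR t s) = expR (Re s * ln t) * sin (Im s * ln t).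
Proof. by rewrite /cpowR Im_cexp ReZr ImZr. Qed.

Lemma is_derive_cln (c t : R) : 0 < t ->
  is_derive t (1 : R) (fun t => c * ln t) (c * t^-1).
Proof.
move=> t0; have d0 := is_derive1_ln t0.
by apply: is_derive_eq; rewrite /GRing.scale/= ?mulr0 ?addr0.
Qed.

Lemma is_derive_Re_cpowR s t : 0 < t ->
  is_derive t (1 : R) (fun t => Re (cpowR t s)) (Re (s * cpowR t (s - 1))).
Proof.
move=> t0; rewrite (_ : (fun t => _) =
    fun t => expR (Re s * ln t) * cos (Im s * ln t)); last first.
  by apply/funext => x; rewrite Re_cpowRE.
have d1 := is_derive1_comp (g := fun t => Re s * ln t) (is_derive_expR (Re s * ln t)) (is_derive_cln (Re s) t0).
have d2 := is_derive1_comp (g := fun t => Im s * ln t) (is_derive_cos (Im s * ln t)) (is_derive_cln (Im s) t0).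
have h := is_deriveM d1 d2.
apply: (is_derive_eq h).
by rewrite cpowRB1// (mulrA s) ReZr ReM Re_cpowRE Im_cpowRE /GRing.scale/=; ring.
Qed.

Lemma is_derive_Im_cpowR s t : 0 < t ->
  is_derive t (1 : R) (fun t => Im (cpowR t s)) (Im (s * cpowR t (s - 1))).
Proof.
move=> t0; rewrite (_ : (fun t => _) =
    fun t => expR (Re s * ln t) * sin (Im s * ln t)); last first.
  by apply/funext => x; rewrite Im_cpowRE.
have d1 := is_derive1_comp (g := fun t => Re s * ln t) (is_derive_expR (Re s * ln t)) (is_derive_cln (Re s) t0).
have d2 := is_derive1_comp (g := fun t => Im s * ln t) (is_derive_sin (Im s * ln t)) (is_derive_cln (Im s) t0).
have h := is_deriveM d1 d2.
apply: (is_derive_eq h).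
by rewrite cpowRB1// (mulrA s) ImZr ImM Re_cpowRE Im_cpowRE /GRing.scale/=; ring.
Qed.

Lemma continuous_Re_cpowR s t : 0 < t ->
  {for t, continuous (fun t => Re (cpowR t s))}.
Proof. by move=> t0; exact: (is_derive_continuous (is_derive_Re_cpowR s t0)). Qed.

Lemma continuous_Im_cpowR s t : 0 < t ->
  {for t, continuous (fun t => Im (cpowR t s))}.
Proof. by move=> t0; exact: (is_derive_continuous (is_derive_Im_cpowR s t0)). Qed.

Lemma cpowR_cvg0 s : 0 < Re s ->
  Re (cpowR t s) @[t --> 0^'+] --> 0 /\ Im (cpowR t s) @[t --> 0^'+] --> 0.
Proof.
move=> s0; have H (f : R -> R) : (forall t, 0 < t -> `|f t| <= t `^ Re s) ->
    f t @[t --> 0^'+] --> 0.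
  move=> fle; apply/cvgr0Pnorm_le => e e0.
  have /cvgr0Pnorm_le /(_ e e0) := powR_cvg0 s0.
  apply: filter_app; near=> t; move=> h.
  have t0 : 0 < t by [].
  by rewrite (le_trans (fle _ t0))// (le_trans (ler_norm _)).
split; apply: H => t t0; rewrite -(normc_cpowR s t0).
  exact: Re_le_normc.
exact: Im_le_normc.
Unshelve. all: end_near. Qed.

Lemma cinteg_cpowR N s : 0 < N -> 0 < Re s ->
  cinteg `]0, N] (fun t => cpowR t (s - 1)).
Proof.
(* On ]0, N] one has 1 <= exp(N) exp(-t), so [expR N] times the Gamma integrand dominates t^(Re s -
   1). *)
move=> N0 s0; have ig := integrable_gamma s0 ltr01.
have ig' : mu.-integrable `]0, N] (fun t => (expR N)%:E *
    (EFin \o (fun t => t `^ (Re s - 1) * expR (- (1 * t)))%R) t)%E.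
  apply: integrableZl => //; apply: integrableS ig => // t /=.
  by rewrite !in_itv/= andbT => /andP[].
apply: (@cintegrable_le _ _ _
   (fun t => expR N * (t `^ (Re s - 1) * expR (- (1 * t))))%R) => //.
  exact: cmeasurable_cpowR.
move=> t /=; rewrite in_itv/= => /andP[t0 tN].
rewrite normc_cpowR// ReD ReN /= mulrCA -[leLHS]mulr1 ler_wpM2l ?powR_ge0//.
by rewrite -expRD mul1r -expR0 ler_expR subr_ge0.
Qed.

Lemma cintegral_cpowR N s : 0 < N -> 0 < Re s ->
  cintegral `]0, N] (fun t => cpowR t (s - 1)) = cpowR N s / s.
Proof.
move=> N0 s0; have s_neq0 : s != 0.
  by apply: contraTneq s0 => ->; rewrite ltxx.
have iN := cinteg_cpowR N0 s0.
have iZ : cinteg `]0, N] (fun t => s * cpowR t (s - 1)) by exact: cintegrableZ.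
apply: (mulfI s_neq0); rewrite -cintegralZ// mulrCA divff// mulr1.
have [cr ci] := cpowR_cvg0 s0; case: iZ => ir ii.
have ct t : 0 < t -> {for t, continuous (fun t => Re (s * cpowR t (s - 1)))}.
  move=> t0; rewrite (_ : (fun t => _) = fun t =>
      Re s * Re (cpowR t (s - 1)) - Im s * Im (cpowR t (s - 1))).
    apply: cvgB; apply: cvgM; try exact: cvg_cst.
      exact: continuous_Re_cpowR.
    exact: continuous_Im_cpowR.
  by apply/funext => x; rewrite ReM.
have cti t : 0 < t -> {for t, continuous (fun t => Im (s * cpowR t (s - 1)))}.
  move=> t0; rewrite (_ : (fun t => _) = fun t =>
      Re s * Im (cpowR t (s - 1)) + Im s * Re (cpowR t (s - 1))).
    apply: cvgD; apply: cvgM; try exact: cvg_cst.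
      exact: continuous_Im_cpowR.
    exact: continuous_Re_cpowR.
  by apply/funext => x; rewrite ImM.
apply: complex_ext.
  apply: (@Rintegral_primitive _ (fun t => Re (cpowR t s))) => // t t0.
  exact: is_derive_Re_cpowR.
apply: (@Rintegral_primitive _ (fun t => Im (cpowR t s))) => // t t0.
exact: is_derive_Im_cpowR.
Qed.

End Gauss.

(** * Gauss's limit for Gamma, in a form that includes the Laplace transform of a power *)

Section GaussLimit.
Variable R : realType.
Local Notation mu := (@lebesgue_measure R).
Local Notation Rpos := (`]0%R, +oo[%classic : set R).
Implicit Types (s z : R[i]) (t x N lam : R).

Lemma Re_shift s (j : nat) : Re (s + j%:R) = Re s + j%:R.
Proof. by rewrite ReD Re_nat. Qed.

Lemma shift_neq0 s (j : nat) : 0 < Re s -> s + j%:R != 0.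
Proof.
move=> s0; apply/eqP => /(congr1 Re); rewrite Re_shift /= => h.
by have := ltr_wpDr (ler0n R j) s0; rewrite h ltxx.
Qed.

Lemma prod_shift_neq0 s m : 0 < Re s -> \prod_(j < m) (s + j%:R) != 0.
Proof. by move=> s0; apply/prodf_neq0 => j _; exact: shift_neq0. Qed.

Lemma prod_shiftS s m :
  \prod_(j < m.+1) (s + j%:R) = s * \prod_(j < m) (s + 1 + j%:R).
Proof.
rewrite big_ord_recl addr0; congr (_ * _); apply: eq_bigr => j _.
by rewrite lift0 -addrA -natr1 [1 + _]addrC.
Qed.

Lemma natC_neq0 n : (0 < n)%N -> n%:R != 0 :> R[i].
Proof. by rewrite pnatr_eq0 -lt0n. Qed.

(** Since (1 - t/N)^(m+1) = (1 - t/N)^m - (t/N)(1 - t/N)^m, the case (m+1, s) follows from (m, s)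
    and (m, s+1); hence the induction on m with s free. At N = m the value is the inverse of
    [gaussp m s]. *)
Lemma gauss_integral_finite m N s : 0 < N -> 0 < Re s ->
  let f := fun t => cpowR t (s - 1) * ((1 - t / N) ^+ m)%:C in
  cinteg `]0, N] f /\
  cintegral `]0, N] f = cpowR N s * m`!%:R / \prod_(j < m.+1) (s + j%:R).
Proof.
move=> N0; elim: m s => [|m IH] s s0 /=.
  have -> : (fun t => cpowR t (s - 1) * ((1 - t / N) ^+ 0)%:C) =
      fun t => cpowR t (s - 1) by apply/funext => t; rewrite expr0 mulr1.
  split; first exact: cinteg_cpowR.
  by rewrite cintegral_cpowR// big_ord1 addr0 fact0 mulr1.
have s10 : 0 < Re (s + 1) by rewrite ReD/= addr_gt0.
have [i0 e0] := IH s s0; have [i1 e1] := IH (s + 1) s10.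
have fE t : `]0, N]%classic t -> cpowR t (s - 1) * ((1 - t / N) ^+ m)%:C +
    - N^-1%:C * (cpowR t (s + 1 - 1) * ((1 - t / N) ^+ m)%:C) =
    cpowR t (s - 1) * ((1 - t / N) ^+ m.+1)%:C.
  rewrite /= in_itv/= => /andP[t0 _].
  have -> : cpowR t (s + 1 - 1) = cpowR t (s - 1) * t%:C.
    by rewrite addrAC [LHS]cpowRD cpowR_r1.
  rewrite exprS rmorphM rmorphB rmorphM/=; ring.
have i1Z : cinteg `]0, N] (fun t => - N^-1%:C *
   (cpowR t (s + 1 - 1) * ((1 - t / N) ^+ m)%:C)) by exact: cintegrableZ.
split.
  by apply: eq_cintegrable fE _ => //; exact: cintegrableD.
rewrite -(eq_cintegral fE) cintegralD// cintegralZ// e0 e1.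
have P1 : \prod_(j < m.+1) (s + 1 + j%:R) != 0 by exact: prod_shift_neq0.
have P0 : \prod_(j < m.+1) (s + j%:R) != 0 by exact: prod_shift_neq0.
have sm : s + m.+1%:R != 0 by exact: shift_neq0.
have s_neq0 : s != 0 by have := @shift_neq0 s 0 s0; rewrite addr0.
have E : s * \prod_(j < m.+1) (s + 1 + j%:R) =
         \prod_(j < m.+1) (s + j%:R) * (s + m.+1%:R).
  by rewrite -prod_shiftS big_ord_recr.
have -> : \prod_(j < m.+2) (s + j%:R) = \prod_(j < m.+1) (s + j%:R) * (s + m.+1%:R).
  by rewrite big_ord_recr.
have -> : \prod_(j < m.+1) (s + 1 + j%:R) =
    \prod_(j < m.+1) (s + j%:R) * (s + m.+1%:R) / s.
  by rewrite -E mulrAC divff// mul1r.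
rewrite (cpowRD N s 1) cpowR_r1// factS natrM fmorphV.
have Nn0 : N%:C != 0 by rewrite fmorph_eq0 gt_eqF.
move: P0 sm; set M := m.+1%:R; set P := \prod_(j < m.+1) _ => P0 sm.
clearbody P M; set k := m`!%:R; clearbody k.
by field; rewrite P0 s_neq0 Nn0 sm.
Qed.

(** The indicator moves the dependence on N from the domain to the integrand, as dominated
    convergence on a fixed domain requires. *)
Lemma gauss_integral_pos m N s : 0 < N -> 0 < Re s ->
  cintegral Rpos (fun t => cpowR t (s - 1) *
     (\1_(`]-oo, N]%classic : set R) t * (1 - t / N) ^+ m)%:C) =
  cpowR N s * m`!%:R / \prod_(j < m.+1) (s + j%:R).
Proof.
move=> N0 s0; have [_ <-] := @gauss_integral_finite m N s N0 s0.
have H (P : R[i] -> R) : P 0 = 0 ->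
   Rintegral mu Rpos (fun t => P (cpowR t (s - 1) *
     (\1_(`]-oo, N]%classic : set R) t * (1 - t / N) ^+ m)%:C)) =
   Rintegral mu `]0, N] (fun t => P (cpowR t (s - 1) * ((1 - t / N) ^+ m)%:C)).
  move=> P0; rewrite Rintegral_mkcond [RHS]Rintegral_mkcond.
  congr (Rintegral _ _ _); apply/funext => t; rewrite /patch indicE.
  have -> : (t \in Rpos) = (0 < t).
    by apply/idP/idP; rewrite inE/= in_itv/= andbT.
  have -> : (t \in `]0, N]%classic) = (0 < t <= N).
    by apply/idP/idP; rewrite inE/= in_itv.
  have -> : (t \in `]-oo, N]%classic) = (t <= N).
    by apply/idP/idP; rewrite inE/= in_itv.
  by case: (0 < t) => //=; case: (t <= N); rewrite ?mul1r// mul0r mulr0.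
by apply: complex_ext; apply: H.
Qed.

Lemma bernoulli_le (y : R) n : 0 <= y <= 1 -> 1 - n%:R * y <= (1 - y) ^+ n.
Proof.
move=> /andP[y0 y1]; elim: n => [|n IH]; first by rewrite mul0r subr0 expr0.
rewrite exprS (le_trans _ (ler_wpM2l _ IH)) ?subr_ge0//.
have : 0 <= n%:R * y * y by rewrite !mulr_ge0.
rewrite -natr1; set m := n%:R; nra.
Qed.

Lemma pow_le_expR x n : x <= n.+1%:R ->
  (1 - x / n.+1%:R) ^+ n.+1 <= expR (- x).
Proof.
move=> xn; have n0 : 0 < n.+1%:R :> R by [].
have -> : expR (- x) = expR (- (x / n.+1%:R)) ^+ n.+1.
  by rewrite -expRM_natl mulrN mulrC divfK// gt_eqF.
rewrite ler_pXn2r ?nnegrE ?expR_ge0 ?expR_ge1Dx//.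
by rewrite subr_ge0 ler_pdivrMr// mul1r.
Qed.

(** With y = x/(n+1), exp(y)(1 - y) >= (1 + y)(1 - y) = 1 - y^2, and Bernoulli's inequality bounds
    the (n+1)-st power below by 1 - (n+1) y^2 = 1 - x^2/(n+1). *)
Lemma expR_le_pow x n : 0 <= x <= n.+1%:R ->
  expR (- x) * (1 - x ^+ 2 / n.+1%:R) <= (1 - x / n.+1%:R) ^+ n.+1.
Proof.
move=> /andP[x0 xn]; have n0 : 0 < n.+1%:R :> R by [].
set y := x / n.+1%:R.
have y0 : 0 <= y by rewrite divr_ge0.
have y1 : y <= 1 by rewrite ler_pdivrMr// mul1r.
have -> : expR (- x) = (expR y ^+ n.+1)^-1.
  by rewrite -expRM_natl mulrC divfK ?gt_eqF// expRN.
rewrite mulrC ler_pdivrMr ?exprn_gt0 ?expR_gt0// -exprMn.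
have -> : x ^+ 2 / n.+1%:R = n.+1%:R * y ^+ 2.
  by rewrite /y; field; rewrite gt_eqF.
apply: (@le_trans _ _ ((1 - y ^+ 2) ^+ n.+1)).
  by apply: bernoulli_le; rewrite sqr_ge0 expr_le1.
rewrite ler_pXn2r ?nnegrE ?mulr_ge0 ?subr_ge0 ?expR_ge0 ?expr_le1//.
have -> : 1 - y ^+ 2 = (1 - y) * (1 + y) by ring.
by rewrite ler_wpM2l ?subr_ge0 ?expR_ge1Dx.
Qed.

Lemma cvg_pow_expR x : 0 <= x ->
  (1 - x / n.+1%:R) ^+ n.+1 @[n --> \oo] --> expR (- x).
Proof.
move=> x0; apply: (@squeeze_cvgr _ _ _ _
   (fun n => expR (- x) * (1 - x ^+ 2 / n.+1%:R)) (fun=> expR (- x))).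
- near=> n; have xn : x <= n.+1%:R.
    rewrite ltW// (le_lt_trans (ler_norm x))//.
    apply: (@le_lt_trans _ _ n%:R); last by rewrite ltr_nat.
    by near: n; exact: nbhs_infty_ger.
  by rewrite expR_le_pow ?x0//= pow_le_expR.
- rewrite -[X in _ --> X]mulr1; apply: cvgMr.
  rewrite -[X in _ --> X]subr0; apply: cvgB; first exact: cvg_cst.
  rewrite -(mulr0 (x ^+ 2)); apply: cvgMr; exact: cvg_harmonic.
- exact: cvg_cst.
Unshelve. all: end_near. Qed.

Lemma cvg_real_complex (u : nat -> R) (l : R) : u @ \oo --> l ->
  ((fun n => (u n)%:C) : nat -> R[i]^o) @ \oo --> (l%:C : R[i]^o).
Proof. by move=> ul; apply/cvg_complexP; split => //; exact: cvg_cst. Qed.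

(** Cutting at N = (n+1)/lam makes (1 - t/N)^(n+1) tend to exp(-lam t) while staying below it, and
    the n-th integral equals lam^(-s) / [gaussp n.+1 s]. Keeping [lam] general is what yields the
    scaling law [laplaceE]. *)
Lemma laplace_cpowR lam s : 0 < lam -> 0 < Re s ->
  let f := fun t => cpowR t (s - 1) * (expR (- (lam * t)))%:C in
  cinteg Rpos f /\
  ((fun n => (gaussp n.+1 s)^-1) : nat -> R[i]^o) @ \oo -->
     (cpowR lam s * cintegral Rpos f : R[i]^o).
Proof.
move=> l0 s0 f; pose N n := n.+1%:R / lam.
have N0 n : 0 < N n by rewrite divr_gt0.
pose F n t := cpowR t (s - 1) *
   (\1_(`]-oo, N n]%classic : set R) t * (1 - t / N n) ^+ n.+1)%:C.
have FE n : cintegral Rpos (F n) = (cpowR lam s)^-1 * (gaussp n.+1 s)^-1.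
  rewrite /F gauss_integral_pos// /N cpowRM ?invr_gt0// cpowRV//.
  rewrite /gaussp invf_div; have := cpowR_neq0 lam s.
  have := prod_shift_neq0 n.+2 s0; set P := \prod_(j < _) _.
  by move=> P0 c0; field; rewrite P0 c0.
have [] := @cintegral_cvg R Rpos F f (fun t => t `^ (Re s - 1) * expR (- (lam * t))).
- by [].
- move=> n; apply: cmeasurableM; first exact: cmeasurable_cpowR.
  apply: cmeasurable_real; apply: measurable_funM.
    exact: measurable_indic.
  apply: measurable_funX; apply: measurable_funB => //.
  by apply: measurable_funM.
- apply: cmeasurableM; first exact: cmeasurable_cpowR.
  apply: cmeasurable_real; apply: measurableT_comp => //.
  by apply: measurable_oppr || apply: measurableT_comp => //; apply: measurable_funM.
- move=> t /=; rewrite in_itv/= andbT => t0.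
  apply: (@cvgM R[i]); first exact: cvg_cst.
  apply: cvg_real_complex.
  have lt0 : 0 <= lam * t by rewrite mulr_ge0 ?ltW.
  apply: cvg_trans (cvg_pow_expR lt0); apply: near_eq_cvg; near=> n.
  have tN : lam * t <= n.+1%:R.
    rewrite ltW// (le_lt_trans (ler_norm _))//.
    apply: (@le_lt_trans _ _ n%:R); last by rewrite ltr_nat.
    by near: n; exact: nbhs_infty_ger.
  rewrite indicE mem_set ?mul1r /=; last first.
    by rewrite in_itv/= ler_pdivlMr// mulrC.
  by congr ((1 - _) ^+ _); rewrite /N; field; rewrite gt_eqF//= gt_eqF.
- exact: integrable_gamma.
- move=> n t /=; rewrite in_itv/= andbT => t0.
  rewrite /F Normc.normcM normc_cpowR// ReD ReN /= ler_wpM2l ?powR_ge0//.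
  rewrite normc_real indicE.
  have [tN|tN] := boolP (t \in _); last by rewrite mul0r normr0 expR_ge0.
  move: tN; rewrite inE/= in_itv/= => tN.
  have tE : t / N n = lam * t / n.+1%:R by rewrite /N; field; rewrite gt_eqF//= gt_eqF.
  have tle : lam * t <= n.+1%:R by move: tN; rewrite ler_pdivlMr// mulrC.
  rewrite mul1r tE ger0_norm ?pow_le_expR//.
  by rewrite exprn_ge0// subr_ge0 ler_pdivrMr// mul1r.
move=> i c; split; first exact: i.
have {c} : ((fun n => cpowR lam s * cintegral Rpos (F n)) : nat -> R[i]^o) @ \oo -->
    (cpowR lam s * cintegral Rpos f : R[i]^o).
  by apply: (@cvgM R[i]); first exact: cvg_cst.
apply: cvg_trans; apply: near_eq_cvg; apply: nearW => n.
by rewrite FE mulrA divff ?mul1r// cpowR_neq0.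
Unshelve. all: end_near. Qed.

End GaussLimit.

(** * Euler's integral against the Gauss product: lower bounds, nonvanishing, convergence in the
    whole plane *)

Definition gam (R : realType) (s : R) : R :=
  Rintegral (@lebesgue_measure R) `]0, +oo[ (fun t => t `^ (s - 1) * expR (- t)).

Section ReciprocalGamma.
Variable R : realType.
Local Notation mu := (@lebesgue_measure R).
Local Notation Rpos := (`]0%R, +oo[%classic : set R).
Implicit Types (s z w : R[i]) (t x y N lam : R).

Lemma cvgC_uniq (u : nat -> R[i]^o) (a b : R[i]^o) :
  u @ \oo --> a -> u @ \oo --> b -> a = b.
Proof. by move=> /cvgC_lim <- /cvgC_lim <-. Qed.

Lemma eq_cvgC (u v : nat -> R[i]^o) (l : R[i]^o) :
  u =1 v -> u @ \oo --> l -> v @ \oo --> l.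
Proof. by move=> /funext ->. Qed.

Lemma cvg_gaussV s : 0 < Re s ->
  ((fun n => (gaussp n.+1 s)^-1) : nat -> R[i]^o) @ \oo --> (GammaC s : R[i]^o).
Proof.
move=> s0; have [_] := laplace_cpowR ltr01 s0.
rewrite cpowR1 mul1r /GammaC.
by congr (_ --> _); apply: eq_cintegral => t _; rewrite mul1r.
Qed.

Lemma cinteg_GammaC s : 0 < Re s ->
  cinteg Rpos (fun t => cpowR t (s - 1) * (expR (- t))%:C).
Proof.
move=> s0; have [+ _] := laplace_cpowR ltr01 s0.
by apply: eq_cintegrable => // t _; rewrite mul1r.
Qed.

(** The inverse Gauss products have a single limit, which [laplace_cpowR] computes once with [lam]
    and once with 1; equating the two gives the scaling. *)
Lemma laplaceE lam s : 0 < lam -> 0 < Re s ->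
  cintegral Rpos (fun t => cpowR t (s - 1) * (expR (- (lam * t)))%:C) =
  cpowR lam (- s) * GammaC s.
Proof.
move=> l0 s0; have [_ c] := laplace_cpowR l0 s0.
rewrite (cvgC_uniq (cvg_gaussV s0) c) mulrA cpowRN mulVf ?mul1r//.
exact: cpowR_neq0.
Qed.

Lemma integrable_gam x : 0 < x ->
  mu.-integrable Rpos (EFin \o (fun t => t `^ (x - 1) * expR (- t))).
Proof.
move=> x0; rewrite (_ : (fun t => _) = fun t => t `^ (x - 1) * expR (- (1 * t))).
  exact: integrable_gamma.
by apply/funext => t; rewrite mul1r.
Qed.

Lemma GammaC_real x : 0 < x -> GammaC x%:C = (gam x)%:C.
Proof.
move=> x0; rewrite /gam -cintegral_real; apply: eq_cintegral => t.
rewrite /= in_itv/= andbT => t0.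
by rewrite -(rmorph1 (real_complex R)) -rmorphB cpowR_real// -rmorphM.
Qed.

(** The part of the integral over [T, T + 1], a segment of length 1, is already at least [c]. *)
Lemma gam_ge (c T x : R) : 0 < x -> 0 < T -> 0 <= c ->
  (forall t, T <= t <= T + 1 -> c <= t `^ (x - 1) * expR (- t)) -> c <= gam x.
Proof.
move=> x0 T0 c0 H; have ig := integrable_gam x0.
have sub : `[T, (T + 1)%R]%classic `<=` Rpos.
  by move=> t /=; rewrite !in_itv/= andbT => /andP[+ _]; exact: lt_le_trans.
have ie : (c%:E <= \int[mu]_(t in Rpos) (t `^ (x - 1) * expR (- t))%:E)%E.
  apply: (@le_trans _ _ (\int[mu]_(t in `[T, (T + 1)%R]) (t `^ (x - 1) * expR (- t))%:E)%E); last first.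
    apply: ge0_subset_integral => //.
      by case/integrableP : ig.
    by move=> t _; rewrite lee_fin mulr_ge0 ?powR_ge0 ?expR_ge0.
  have -> : c%:E = (\int[mu]_(t in `[T, (T + 1)%R]) c%:E)%E.
    rewrite integral_cst//= lebesgue_measure_itv/= lte_fin ltrDl ltr01.
    by rewrite -EFinB addrAC subrr add0r mule1.
  apply: ge0_le_integral => //.
  by case/integrableP : ig => + _; exact: measurable_funS.
have fin : (\int[mu]_(t in Rpos) (t `^ (x - 1) * expR (- t))%:E)%E \is a fin_num.
  exact: integrable_fin_num.
by move: ie; rewrite -(fineK fin) lee_fin.
Qed.

Lemma gam_gt0 x : 0 < x -> 0 < gam x.
Proof.
(* On [1, 2], t^(x-1) >= 1/t >= 1/2 and exp(-t) >= exp(-2). *)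
move=> x0; apply: (@lt_le_trans _ _ (2^-1 * expR (- 2))).
  by rewrite mulr_gt0 ?invr_gt0 ?expR_gt0.
apply: (@gam_ge _ 1) => //.
move=> t /andP[t1 t2]; have t0 : 0 < t by exact: lt_le_trans t1.
apply: ler_pM => //; rewrite ?expR_ge0//; last by rewrite ler_expR lerN2.
apply: (@le_trans _ _ (t `^ (- 1))).
  by rewrite powR_inv1 ?(ltW t0)// lef_pV2 ?posrE.
by rewrite ler_powR// lerBrDr addNr ltW.
Qed.

(** The parameter [T] is free, so Gamma outgrows every exponential; [rg_series_cvg] chooses [T]
    according to the ratio to be beaten. *)
Lemma gam_ge_powR (T x : R) : 1 <= x -> 0 < T ->
  T `^ (x - 1) * expR (- (T + 1)) <= gam x.
Proof.
move=> x1 T0; apply: (@gam_ge _ T) => //; first exact: lt_le_trans x1.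
  by rewrite mulr_ge0 ?powR_ge0 ?expR_ge0.
move=> t /andP[t1 t2]; have t0 : 0 < t by exact: lt_le_trans t1.
apply: ler_pM; rewrite ?expR_ge0 ?powR_ge0//; last by rewrite ler_expR lerN2.
by rewrite ge0_ler_powR ?nnegrE ?subr_ge0 ?(ltW T0) ?(ltW t0).
Qed.

(** A bound for Gamma(x) / |Gamma(x + iy)|, that is for the product over j of sqrt(1 + y^2/(x+j)^2),
    obtained through 1 + v <= exp(v). *)
Definition phase_bound x y : R := expR (y ^+ 2 / 2 * (x^-1 ^+ 2 + x^-1)).

Lemma sum_sqr_inv_le x n : 0 < x ->
  \sum_(j < n.+1) ((x + j%:R)^-1 ^+ 2) <= x^-1 ^+ 2 + x^-1 - (x + n%:R)^-1.
Proof.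
move=> x0; elim: n => [|n IH].
  by rewrite big_ord1 !addr0 addrK.
rewrite big_ord_recr/= (le_trans (lerD IH (lexx _)))//.
rewrite -natr1 addrA.
have a0 : 0 < x + n%:R by exact: ltr_wpDr.
set a := x + n%:R in a0 *; have a1 : 0 < a + 1 by rewrite addr_gt0.
(* The telescoping inequality 1/(a+1)^2 <= 1/a - 1/(a+1). *)
have h : (a + 1)^-1 ^+ 2 + (a + 1)^-1 <= a^-1.
  have -> : (a + 1)^-1 ^+ 2 + (a + 1)^-1 = (a + 2) / (a + 1) ^+ 2.
    by field; rewrite gt_eqF.
  rewrite ler_pdivrMr ?exprn_gt0// mulrC ler_pdivlMr//.
  rewrite -subr_ge0; have -> : (a + 1) ^+ 2 - (a + 2) * a = 1 by ring.
  exact: ler01.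
by move: h; set u := _ ^+ 2; set v := (a + 1)^-1; lra.
Qed.

Lemma normc_shift_le x y : 0 < x ->
  normc (x +i* y) <= x * expR (y ^+ 2 / 2 * x^-1 ^+ 2).
Proof.
move=> x0; rewrite /Normc.normc.
rewrite -[leRHS]ger0_norm ?mulr_ge0 ?expR_ge0 ?(ltW x0)// -sqrtr_sqr.
rewrite ler_wsqrtr// exprMn -expRM_natl.
have -> : 2%:R * (y ^+ 2 / 2 * x^-1 ^+ 2) = (y / x) ^+ 2 by field; rewrite gt_eqF.
apply: le_trans (ler_wpM2l _ (expR_ge1Dx _)); last exact: sqr_ge0.
by rewrite mulrDr mulr1 exprMn mulrCA exprVn divff ?mulr1// expf_neq0// gt_eqF.
Qed.

(* |s + j| <= (Re s + j) exp (Im s ^ 2 / (2 (Re s + j) ^ 2)) and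
   sum_j 1 / (x + j) ^ 2 <= 1 / x ^ 2 + 1 / x. *)
Lemma normc_gaussp_le n s : 0 < Re s ->
  normc (gaussp n.+1 s) <= phase_bound (Re s) (Im s) * normc (gaussp n.+1 (Re s)%:C).
Proof.
move=> s0; have E (w : R[i]) : normc (gaussp n.+1 w) =
    normc (\prod_(j < n.+2) (w + j%:R)) / (normc n.+1`!%:R * n.+1%:R `^ Re w).
  by rewrite /gaussp Normc.normcM Normc.normcV (Normc.normcM n.+1`!%:R) normc_cpowR.
rewrite !E /= mulrA; apply: ler_wpM2r.
  by rewrite invr_ge0 mulr_ge0 ?normc_ge0 ?powR_ge0.
rewrite !normc_prod /phase_bound.
apply: (@le_trans _ _ (\prod_(j < n.+2)
    ((Re s + j%:R) * expR (Im s ^+ 2 / 2 * (Re s + j%:R)^-1 ^+ 2)))).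
  apply: ler_prod => j _; rewrite normc_ge0/=.
  have -> : s + j%:R = (Re s + j%:R) +i* Im s.
    by apply: complex_ext; rewrite ?Re_shift// ImD Im_nat addr0.
  by apply: normc_shift_le; rewrite ltr_wpDr.
rewrite big_split/= mulrC ler_pM ?prodr_ge0//.
- by move=> j _; rewrite addr_ge0// ltW.
- rewrite -expR_sum ler_expR -mulr_sumr ler_wpM2l ?divr_ge0 ?sqr_ge0//.
  rewrite (le_trans (sum_sqr_inv_le _ s0))// lerBlDr lerDl invr_ge0.
  by rewrite addr_ge0// ltW.
- apply: ler_prod => j _; rewrite addr_ge0 ?(ltW s0)//= natC -rmorphD.
  by rewrite normc_real ler_norm.
Qed.

Lemma gaussp_neq0 n s : 0 < Re s -> gaussp n.+1 s != 0.
Proof.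
by move=> s0; rewrite mulf_neq0 ?prod_shift_neq0// invr_neq0// mulf_neq0 ?cpowR_neq0//.
Qed.

Lemma phase_bound_gt0 x y : 0 < phase_bound x y.
Proof. exact: expR_gt0. Qed.

(** This is [normc_gaussp_le], inverted and passed to the limit. With [gam_gt0] it excludes zeros of
    [GammaC] in the right half-plane, so the Gauss products converge there and not only their
    inverses. *)
Lemma normc_GammaC_ge s : 0 < Re s ->
  gam (Re s) <= phase_bound (Re s) (Im s) * normc (GammaC s).
Proof.
move=> s0; have c1 := cvg_normc (cvg_gaussV s0).
have c2 : (normc \o (fun n => (gaussp n.+1 (Re s)%:C)^-1)) @ \oo --> gam (Re s).
  have := @cvg_gaussV (Re s)%:C s0; move/cvg_normc.
  by rewrite GammaC_real// normc_real ger0_norm// ltW// gam_gt0.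
have c3 : (fun n => phase_bound (Re s) (Im s) * normc ((gaussp n.+1 s)^-1)) @ \oo -->
    phase_bound (Re s) (Im s) * normc (GammaC s) by exact: cvgMr.
apply: ler_cvg_to c2 c3 _; apply: nearW => n /=.
rewrite !Normc.normcV -ler_pdivrMl ?phase_bound_gt0// -invfM.
have p1 : 0 < normc (gaussp n.+1 (Re s)%:C).
  by rewrite lt_neqAle eq_sym normc_eq0 gaussp_neq0//= normc_ge0.
have p2 : 0 < normc (gaussp n.+1 s).
  by rewrite lt_neqAle eq_sym normc_eq0 gaussp_neq0//= normc_ge0.
rewrite lef_pV2 ?posrE ?mulr_gt0 ?phase_bound_gt0//.
exact: normc_gaussp_le.
Qed.

Lemma GammaC_neq0 s : 0 < Re s -> GammaC s != 0.
Proof.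
move=> s0; apply/eqP => G0; have := normc_GammaC_ge s0.
by rewrite G0 Normc.normc0 mulr0 leNgt gam_gt0.
Qed.

Lemma cvg_gaussp_pos s : 0 < Re s ->
  ((fun n => gaussp n s) : nat -> R[i]^o) @ \oo --> ((GammaC s)^-1 : R[i]^o).
Proof.
move=> s0; have c := @cvgV R[i] nat \oo _ _ _ (GammaC_neq0 s0) (cvg_gaussV s0).
rewrite -cvg_shiftS.
apply: (@eq_cvgC (fun n => ((gaussp n.+1 s)^-1)^-1)); last exact: c.
by move=> n; rewrite invrK.
Qed.

Lemma rGamma_GammaC s : 0 < Re s -> rGamma s = (GammaC s)^-1.
Proof. by move=> s0; apply: cvgC_lim; exact: cvg_gaussp_pos. Qed.

Lemma gaussp_shift n s : s + 1 + n.+1%:R != 0 ->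
  gaussp n.+1 s = s * gaussp n.+1 (s + 1) * (n.+1%:R / (s + 1 + n.+1%:R)).
Proof.
move=> sn; rewrite /gaussp prod_shiftS [in RHS]big_ord_recr/= cpowRD cpowR_r1//.
rewrite -natC; set P := \prod_(j < n.+1) _.
have f0 : n.+1`!%:R != 0 :> R[i] by rewrite natC_neq0// fact_gt0.
have c0 := cpowR_neq0 n.+1%:R s.
have n0 : n.+1%:R != 0 :> R[i] by rewrite natC_neq0.
move: sn n0 f0 c0; set N := n.+1%:R; set C := cpowR _ _; set f := _`!%:R.
clearbody N C f P => sn n0 f0 c0.
by field; rewrite sn n0 f0 c0.
Qed.

Lemma cvg_shift_ratio s :
  ((fun n => n.+1%:R / (s + n.+1%:R)) : nat -> R[i]^o) @ \oo --> (1 : R[i]^o).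
Proof.
have c1 : ((fun n => s * (n.+1%:R^-1 : R)%:C + 1) : nat -> R[i]^o) @ \oo --> (1 : R[i]^o).
  rewrite -[X in _ --> X](add0r (1 : R[i]^o)).
  apply: (@cvgD R[i] R[i]^o); last exact: cvg_cst.
  rewrite -(mulr0 s); apply: (@cvgM R[i]); first exact: cvg_cst.
  exact: (cvg_real_complex (@cvg_harmonic R)).
have c2 := @cvgV R[i] nat \oo _ _ _ (oner_neq0 _) c1; rewrite invr1 in c2.
apply: (@eq_cvgC (fun n => (s * (n.+1%:R^-1 : R)%:C + 1)^-1)); last exact: c2.
move=> n; rewrite fmorphV /= -natC.
have n0 : n.+1%:R != 0 :> R[i] by rewrite natC_neq0.
have -> : s / n.+1%:R + 1 = (s + n.+1%:R) / n.+1%:R by rewrite mulrDl divff.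
by rewrite invf_div.
Qed.

Lemma cvg_gaussp_shift s l : ((fun n => gaussp n (s + 1)) : nat -> R[i]^o) @ \oo --> (l : R[i]^o) ->
  ((fun n => gaussp n s) : nat -> R[i]^o) @ \oo --> (s * l : R[i]^o).
Proof.
rewrite -cvg_shiftS => c; rewrite -cvg_shiftS.
have : ((fun n => s * gaussp n.+1 (s + 1) * (n.+1%:R / (s + 1 + n.+1%:R)))
     : nat -> R[i]^o) @ \oo --> (s * l * 1 : R[i]^o).
  apply: (@cvgM R[i]); last exact: cvg_shift_ratio.
  by apply: (@cvgM R[i]); first exact: cvg_cst.
(* The shift identity divides by s + 1 + (n+1), which can vanish for small n when s is a negative
   integer; it is used for large n. *)
rewrite mulr1; apply: cvg_trans; apply: near_eq_cvg; near=> n.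
apply/esym/gaussp_shift; apply/eqP => /(congr1 Re); rewrite Re_shift /= => h.
have : - Re (s + 1) < n.+1%:R.
  apply: (@le_lt_trans _ _ n%:R); last by rewrite ltr_nat.
  by near: n; exact: nbhs_infty_ger.
by rewrite -subr_gt0 opprK addrC h ltxx.
Unshelve. all: end_near. Qed.

(** Convergence spreads to the left one unit at a time through [cvg_gaussp_shift], starting from the
    right half-plane; only then is [rGamma] a genuine limit everywhere. *)
Lemma cvg_gaussp s : ((fun n => gaussp n s) : nat -> R[i]^o) @ \oo --> (rGamma s : R[i]^o).
Proof.
have H n z : - n%:R < Re z -> cvgn ((fun n => gaussp n z) : nat -> R[i]^o).
  elim: n z => [|n IH] z.
    rewrite oppr0 => z0; apply/cvg_ex; exists ((GammaC z)^-1).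
    exact: cvg_gaussp_pos.
  move=> zn; have /IH/cvg_ex[l cl] : - n%:R < Re (z + 1).
    by rewrite ReD/= -ltrBlDr -opprD natr1.
  by apply/cvg_ex; exists (z * l); exact: cvg_gaussp_shift.
apply: (H (Num.truncn (- Re s)).+1).
by rewrite ltrNl truncnS_gt.
Qed.

Lemma rGammaS s : rGamma s = s * rGamma (s + 1).
Proof.
have := cvg_gaussp_shift (@cvg_gaussp (s + 1)).
exact: (cvgC_uniq (@cvg_gaussp s)).
Qed.

End ReciprocalGamma.

Definition rg (R : realType) (x : R) : R := complex.Re (rGamma x%:C).

(** * The triplication formula, and 1/Gamma on the real line *)

Section Triplication.
Variable R : realType.
Implicit Types (s z w : R[i]) (t x y : R).

Lemma cvg_cexp (u : nat -> R[i]^o) (l : R[i]^o) : u @ \oo --> l ->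
  ((fun n => cexp (u n)) : nat -> R[i]^o) @ \oo --> (cexp l : R[i]^o).
Proof.
move=> /cvg_complexP[ur ui]; apply/cvg_complexP; split.
  rewrite Re_cexp (_ : _ \o _ = fun n => expR ((Re \o u) n) * cos ((Im \o u) n)).
    apply: cvgM; first by apply: continuous_cvg ur; exact: continuous_expR.
    by apply: continuous_cvg ui; exact: continuous_cos.
  by apply/funext => n; exact: Re_cexp.
rewrite Im_cexp (_ : _ \o _ = fun n => expR ((Re \o u) n) * sin ((Im \o u) n)).
  apply: cvgM; first by apply: continuous_cvg ur; exact: continuous_expR.
  by apply: continuous_cvg ui; exact: continuous_sin.
by apply/funext => n; exact: Im_cexp.
Qed.

(** The product in [gaussp (3m+2) (3w)] has 3(m+1) factors, which split into three products of m+1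
    factors. Its power is (3m+2)^(3w) instead of (3m)^(3w); this quotient, which tends to 1, makes
    up the difference. *)
Let ratio m : R := (3 * m + 2)%N%:R / (3 * m)%N%:R.

Let cvg_ratio s : ((fun n => cpowR (ratio n.+1) s) : nat -> R[i]^o) @ \oo --> (1 : R[i]^o).
Proof.
rewrite -(cexp0 R) -(mulr0 s); apply: cvg_cexp.
apply: (@cvgM R[i]); first exact: cvg_cst.
rewrite (_ : 0 = (ln (1 : R))%:C); last by rewrite ln1.
apply: cvg_real_complex; apply: continuous_cvg; first exact: continuous_ln.
have -> : (fun n => ratio n.+1) = fun n => 1 + 2 / 3 * (n.+1%:R^-1 : R).
  apply/funext => n; rewrite /ratio natrD natrM.
  have n0 : n.+1%:R != 0 :> R by [].
  by move: n0; set k := n.+1%:R => k0; field.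
rewrite -[X in _ --> X]addr0; apply: cvgD; first exact: cvg_cst.
rewrite -(mulr0 (2 / 3)); apply: cvgMr; exact: cvg_harmonic.
Qed.

Lemma prod_triple w k :
  \prod_(j < (3 * k)%N) (3 * w + j%:R) = 27 ^+ k *
  (\prod_(j < k) (w + j%:R) * \prod_(j < k) (w + 3^-1 + j%:R) *
   \prod_(j < k) (w + 2 / 3 + j%:R)).
Proof.
elim: k => [|k IH]; first by rewrite !big_ord0 !mulr1.
rewrite (_ : (3 * k.+1 = (3 * k).+3)%N); last by rewrite mulnS addnC !addnS addn0.
rewrite !big_ord_recr/= IH exprS.
set P := \prod_(j < k) _; set Q := \prod_(j < k) _; set S := \prod_(j < k) _.
by rewrite -!natr1 natrM; field.
Qed.

(** The part of the finite triplication identity that is independent of w; its limit is the constant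
    of the formula. *)
Let gaussD m : R[i] := (3 * m + 2)`!%:R / (27 ^+ m.+1 * m`!%:R ^+ 3 * m%:R).

Lemma gaussp_triple m w :
  gaussp m.+1 w * gaussp m.+1 (w + 3^-1) * gaussp m.+1 (w + 2 / 3) =
  gaussD m.+1 * cpowR 3 (3 * w) * cpowR (ratio m.+1) (3 * w) *
  gaussp (3 * m.+1 + 2) (3 * w).
Proof.
have E3 : cpowR 3 (3 * w) * cpowR (ratio m.+1) (3 * w) =
    cpowR (3 * m.+1 + 2)%N%:R (3 * w) / cpowR m.+1%:R (3 * w).
  have m0 : 0 < m.+1%:R :> R by [].
  have h : 3 * ratio m.+1 = (3 * m.+1 + 2)%N%:R / m.+1%:R.
    rewrite /ratio natrM; set a := (3 * m.+1 + 2)%N%:R.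
    by field; rewrite gt_eqF.
  rewrite -cpowRM ?divr_gt0 ?ltr0n ?addnS// h cpowRM ?invr_gt0 ?ltr0n ?addnS//.
  by rewrite cpowRV.
have Em : cpowR m.+1%:R w * cpowR m.+1%:R (w + 3^-1) * cpowR m.+1%:R (w + 2 / 3) =
    cpowR m.+1%:R (3 * w) * m.+1%:R.
  have -> : m.+1%:R = cpowR (m.+1%:R : R) 1 by rewrite natC cpowR_r1.
  by rewrite -!cpowRD; congr (cpowR _ _); field.
rewrite -(mulrA (gaussD _)) E3 /gaussD /gaussp.
rewrite (_ : (3 * m.+1 + 2).+1 = (3 * m.+2)%N); last by rewrite [in RHS]mulnS addnC addnS.
rewrite prod_triple.
have f0 k : k`!%:R != 0 :> R[i] by rewrite natC_neq0// fact_gt0.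
have p0 : 27 ^+ m.+2 != 0 :> R[i] by rewrite expf_neq0// natC_neq0.
have m0 : m.+1%:R != 0 :> R[i] by rewrite natC_neq0.
have c0 := cpowR_neq0 m.+1%:R w; have c1 := cpowR_neq0 m.+1%:R (w + 3^-1).
have c2 := cpowR_neq0 m.+1%:R (w + 2 / 3).
have c3 := cpowR_neq0 m.+1%:R (3 * w).
have c4 := cpowR_neq0 (3 * m.+1 + 2)%N%:R (3 * w).
move: (f0 m.+1) (f0 (3 * m.+1 + 2)%N) p0 m0 c0 c1 c2 c3 c4 Em.
set C0 := cpowR _ w; set C1 := cpowR _ (w + 3^-1); set C2 := cpowR _ (w + 2 / 3).
set C3 := cpowR m.+1%:R (3 * w); set C4 := cpowR _ (3 * w).
set P := \prod_(j < _) _; set Q := \prod_(j < _) _; set S := \prod_(j < _) _.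
set F := m.+1`!%:R; set G := (_)`!%:R; set X := 27 ^+ _; set M := m.+1%:R.
clearbody C0 C1 C2 C3 C4 P Q S F G X M.
move=> F0 G0 X0 M0 c0 c1 c2 c3 c4 Em.
transitivity (P * Q * S / (F ^+ 3 * (C0 * C1 * C2))).
  by field; rewrite F0 c0 c1 c2.
by rewrite Em; field; rewrite F0 G0 X0 M0 c3 c4.
Qed.

Let cvg_gaussp_sub w : ((fun n => gaussp (3 * n.+1 + 2) w) : nat -> R[i]^o) @ \oo -->
  (rGamma w : R[i]^o).
Proof.
apply: (@cvg_comp _ _ _ (fun n => (3 * n.+1 + 2)%N) (fun n => gaussp n w)); last exact: cvg_gaussp.
move=> A [N _ NA]; exists N => // n /= Nn; apply: NA => /=.
by rewrite (leq_trans Nn)// mulnS mulSn -addnA -addnA addnCA leq_addr.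
Qed.

Let cvg_gaussp3 w : ((fun m => gaussp m.+1 w * gaussp m.+1 (w + 3^-1) * gaussp m.+1 (w + 2 / 3))
     : nat -> R[i]^o) @ \oo -->
   (rGamma w * rGamma (w + 3^-1) * rGamma (w + 2 / 3) : R[i]^o).
Proof.
have h v : ((fun m => gaussp m.+1 v) : nat -> R[i]^o) @ \oo --> (rGamma v : R[i]^o).
  by have := @cvg_gaussp R v; rewrite -cvg_shiftS.
by apply: (@cvgM R[i]) (h _); apply: (@cvgM R[i]) (h _) (h _).
Qed.

Lemma rGamma_neq0 s : 0 < Re s -> rGamma s != 0.
Proof. by move=> s0; rewrite rGamma_GammaC// invr_neq0// GammaC_neq0. Qed.

(** As [gaussD] is independent of w, its limit is computed at w = 1/3. There 3w = w + 2/3 = 1, so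
    the two values of 1/Gamma(1) cancel, and 3^(3w) supplies the denominator 3. *)
Let cvg_gaussD : ((fun n => gaussD n.+1) : nat -> R[i]^o) @ \oo -->
  (rGamma 3^-1 * rGamma (2 / 3) / 3 : R[i]^o).
Proof.
have third : 3^-1 + 3^-1 = 2 / 3 :> R[i] by field.
have one3 : 3 * 3^-1 = 1 :> R[i] by field.
have one : 3^-1 + 2 / 3 = 1 :> R[i] by field.
have r1 : rGamma 1 != 0 :> R[i] by rewrite rGamma_neq0//= ltr01.
have cden : ((fun m => cpowR 3 1 * cpowR (ratio m.+1) 1 * gaussp (3 * m.+1 + 2) 1)
    : nat -> R[i]^o) @ \oo --> (cpowR 3 1 * 1 * rGamma 1 : R[i]^o).
  apply: (@cvgM R[i]); last exact: cvg_gaussp_sub.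
  by apply: (@cvgM R[i]); [exact: cvg_cst|exact: cvg_ratio].
have d0 : cpowR 3 1 * 1 * rGamma 1 != 0 :> R[i].
  by rewrite mulr1 mulf_neq0// cpowR_neq0.
have c := @cvgM R[i] nat \oo _ _ _ _ _ (@cvg_gaussp3 3^-1) (@cvgV R[i] nat \oo _ _ _ d0 cden).
have -> : rGamma 3^-1 * rGamma (2 / 3) / 3 =
   rGamma 3^-1 * rGamma (3^-1 + 3^-1) * rGamma (3^-1 + 2 / 3) / (cpowR 3 1 * 1 * rGamma 1) :> R[i].
  rewrite third one cpowR_r1// mulr1 -natC; move: r1; set r := rGamma 1.
  by move=> r1; field.
apply: (@eq_cvgC R (fun m => gaussp m.+1 3^-1 * gaussp m.+1 (3^-1 + 3^-1) *
   gaussp m.+1 (3^-1 + 2 / 3) / (cpowR 3 1 * cpowR (ratio m.+1) 1 * gaussp (3 * m.+1 + 2) 1)));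
  last exact: c.
move=> m; rewrite gaussp_triple one3.
have x0 : gaussp (3 * m.+1 + 2) 1 != 0 :> R[i] by rewrite addn2 gaussp_neq0//= ltr01.
have c1 := cpowR_neq0 3 (1 : R[i]); have c2 := cpowR_neq0 (ratio m.+1) (1 : R[i]).
by field; rewrite x0 c1 c2.
Qed.

Lemma rGamma_triplication w :
  rGamma w * rGamma (w + 3^-1) * rGamma (w + 2 / 3) =
  rGamma 3^-1 * rGamma (2 / 3) / 3 * cpowR 3 (3 * w) * rGamma (3 * w).
Proof.
have c : ((fun m => gaussD m.+1 * cpowR 3 (3 * w) * cpowR (ratio m.+1) (3 * w) *
    gaussp (3 * m.+1 + 2) (3 * w)) : nat -> R[i]^o) @ \oo -->
    (rGamma 3^-1 * rGamma (2 / 3) / 3 * cpowR 3 (3 * w) * 1 * rGamma (3 * w) : R[i]^o).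
  apply: (@cvgM R[i]); last exact: cvg_gaussp_sub.
  apply: (@cvgM R[i]); last exact: cvg_ratio.
  by apply: (@cvgM R[i]); [exact: cvg_gaussD|exact: cvg_cst].
rewrite mulr1 in c; apply: (cvgC_uniq (@cvg_gaussp3 w)).
by apply: eq_cvgC c => m; rewrite gaussp_triple.
Qed.

Lemma gaussp_real n x : Im (gaussp n.+1 x%:C) = 0.
Proof.
rewrite /gaussp cpowR_real// natC.
under eq_bigr do rewrite natC -rmorphD.
by rewrite -rmorph_prod -rmorphM -fmorphV -rmorphM.
Qed.

Lemma rGamma_real x : rGamma x%:C = (rg x)%:C.
Proof.
apply: complex_ext => //=.
have /cvg_complexP[_ ci] := @cvg_gaussp R x%:C.
move: ci; rewrite -cvg_shiftS => ci.
rewrite -(cvg_lim (@norm_hausdorff _ R) ci).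
rewrite (_ : (fun n => _) = fun=> 0) ?lim_cst//.
by apply/funext => n; exact: gaussp_real.
Qed.

Lemma rgS x : rg x = x * rg (x + 1).
Proof.
apply: (@complexI R); rewrite rmorphM/= -!rGamma_real rGammaS.
by rewrite -(rmorph1 (real_complex R)) -rmorphD.
Qed.

Lemma rg_gam x : 0 < x -> rg x = (gam x)^-1.
Proof.
move=> x0; apply: (@complexI R).
by rewrite -rGamma_real rGamma_GammaC// GammaC_real// fmorphV.
Qed.

Lemma rg_gt0 x : 0 < x -> 0 < rg x.
Proof. by move=> x0; rewrite rg_gam// invr_gt0 gam_gt0. Qed.

Lemma normc_rGamma_le s : 0 < Re s ->
  normc (rGamma s) <= phase_bound (Re s) (Im s) * rg (Re s).
Proof.
move=> s0; rewrite rGamma_GammaC// rg_gam// Normc.normcV.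
rewrite ler_pdivlMr ?gam_gt0// mulrC ler_pdivrMr ?normc_GammaC_ge//.
by rewrite lt_neqAle eq_sym normc_eq0 GammaC_neq0//= normc_ge0.
Qed.

Lemma rg_le_powR (T x : R) : 1 <= x -> 0 < T ->
  rg x <= expR (T + 1) * T `^ (1 - x).
Proof.
move=> x1 T0; have x0 : 0 < x by exact: lt_le_trans x1.
rewrite rg_gam// -[expR _]invrK -expRN -opprB powRN -invfM.
rewrite lef_pV2 ?posrE ?gam_gt0 ?mulr_gt0 ?expR_gt0 ?powR_gt0//.
by rewrite mulrC gam_ge_powR.
Qed.

End Triplication.

(* The regularized confluent series 0F1(c; u) / Gamma(c); the modified Bessel
   function is I_nu(2 sqrt u) = u ^ (nu / 2) hyp0 (1 + nu) u. *)
Definition hyp0_coeff (R : realType) (c : R) : R^nat :=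
  fun k => rg (c + k%:R) / k`!%:R.
Definition hyp0 (R : realType) (c u : R) : R := limn (pseries (hyp0_coeff c) u).

(** * The regularized series 0F1 and its relation to I_nu *)

Section Hyp0.
Variable R : realType.
Implicit Types (c u x : R).

(** Once c + k >= 1, [rg_le_powR] at T = 1 gives the bound exp(2); the finitely many earlier values
    are covered by their sum. *)
Lemma rg_shift_bounded c : exists M : R, forall k : nat, `|rg (c + k%:R)| <= M.
Proof.
pose N := (Num.truncn (1 - c)).+1.
exists (expR 2 + \sum_(0 <= k < N) `|rg (c + k%:R)|) => k.
have [kN|kN] := ltnP k N.
  rewrite big_mkord (bigD1 (Ordinal kN))//= addrCA lerDl addr_ge0 ?expR_ge0//.
  by rewrite sumr_ge0.
have c1 : 1 <= c + k%:R.
  rewrite -lerBlDl ltW// (lt_le_trans (truncnS_gt _))//.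
  by rewrite ler_nat.
rewrite ger0_norm; last by rewrite ltW// rg_gt0// (lt_le_trans _ c1).
rewrite (le_trans (rg_le_powR c1 ltr01))// powR1 mulr1.
by rewrite lerDl sumr_ge0.
Qed.

Lemma is_cvg_hyp0 c u : cvgn (pseries (hyp0_coeff c) u).
Proof.
have [M HM] := rg_shift_bounded c.
have M0 : 0 <= M by rewrite (le_trans _ (HM 0%N)).
apply: normed_cvg.
apply: (@series_le_cvg _ _ (fun k => M * exp_coeff `|u| k)).
- by move=> k /=.
- by move=> k; rewrite mulr_ge0// exp_coeff_ge0.
- move=> k; rewrite /= /hyp0_coeff !normrM normfV normrX mulrAC /exp_coeff/= mulrA.
  rewrite (ger0_norm (ler0n _ _)) ler_wpM2r ?invr_ge0// ler_wpM2r// exprn_ge0//.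
exact: (is_cvg_seriesZ (k := M) (is_cvg_series_exp_coeff `|u|)).
Qed.

Lemma pseries_diffs_hyp0 c : pseries_diffs (hyp0_coeff c) = hyp0_coeff (c + 1).
Proof.
apply/funext => k; rewrite /pseries_diffs /hyp0_coeff factS natrM.
have -> : c + 1 + k%:R = c + k.+1%:R by rewrite -natr1; ring.
have f0 : k`!%:R != 0 :> R by rewrite pnatr_eq0 -lt0n fact_gt0.
have k0 : k.+1%:R != 0 :> R by rewrite pnatr_eq0.
move: f0 k0; set f := k`!%:R; set m := k.+1%:R => f0 k0; clearbody f m.
by field; rewrite f0 k0.
Qed.

Lemma is_derive_hyp0 c u : is_derive u (1 : R) (hyp0 c) (hyp0 (c + 1) u).
Proof.
have := @pseries_snd_diffs R (hyp0_coeff c) (`|u| + 1) u.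
rewrite !pseries_diffs_hyp0; apply; try exact: is_cvg_hyp0.
by rewrite [ltRHS]ger0_norm ?addr_ge0// ltrDl.
Qed.

Lemma continuous_hyp0 c u : {for u, continuous (hyp0 c)}.
Proof. exact: (is_derive_continuous (is_derive_hyp0 c u)). Qed.

Lemma hyp00 c : hyp0 c 0 = rg c.
Proof.
apply: cvg_lim => //; rewrite -cvg_shiftS.
rewrite (_ : (fun n => _) = fun=> rg c); first exact: cvg_cst.
apply/funext => n; rewrite /pseries /series/= big_nat_recl//=.
rewrite big1 ?addr0; first by rewrite /hyp0_coeff addr0 divr1 expr0 mulr1.
by move=> k _; rewrite exprS mul0r mulr0.
Qed.

(** Write 1/Gamma(c+k) = (c+k)/Gamma(c+k+1). The part with c is c times the series at c+1; the part
    with k is u times the derivative of that series, which is the series at c+2. *)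
Lemma hyp0_rec c u : hyp0 c u = c * hyp0 (c + 1) u + u * hyp0 (c + 1 + 1) u.
Proof.
have c1 : (fun n => c * pseries (hyp0_coeff (c + 1)) u n) @ \oo --> c * hyp0 (c + 1) u.
  by apply: cvgMr; exact: is_cvg_hyp0.
have cD : cvgn (pseries (pseries_diffs (hyp0_coeff (c + 1))) u).
  by rewrite pseries_diffs_hyp0; exact: is_cvg_hyp0.
have := pseries_diffs_equiv cD; rewrite pseries_diffs_hyp0 -/(hyp0 (c + 1 + 1) u).
set s := fun i => _ => cs.
have c2 : (fun n => u * series s n) @ \oo --> u * hyp0 (c + 1 + 1) u by exact: cvgMr.
have c3 := cvgD c1 c2; apply: cvg_lim => //.
suff -> : pseries (hyp0_coeff c) u = (fun n => c * pseries (hyp0_coeff (c + 1)) u n) \+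
   (fun n => u * series s n) by exact: c3.
apply/funext => n; rewrite /pseries /series /s/= !mulr_sumr -big_split/=.
apply: eq_bigr => k _; rewrite /hyp0_coeff rgS.
rewrite (_ : c + 1 + k%:R = c + k%:R + 1); last by ring.
case: k => [|k] /=; first by rewrite !mul0r !mulr0 addr0; ring.
by rewrite exprS; ring.
Qed.

Lemma besselI_hyp0 (nu u : R) : 0 < u ->
  besselI nu%:C (2 * Num.sqrt u) = (u `^ (nu / 2) * hyp0 (1 + nu) u)%:C.
Proof.
move=> u0; have r0 : 0 < Num.sqrt u by rewrite sqrtr_gt0.
have c : ((fun n => (u `^ (nu / 2))%:C * (pseries (hyp0_coeff (1 + nu)) u n)%:C)
    : nat -> R[i]^o) @ \oo --> ((u `^ (nu / 2))%:C * (hyp0 (1 + nu) u)%:C : R[i]^o).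
  apply: (@cvgM R[i]); first exact: cvg_cst.
  by apply: cvg_real_complex; exact: is_cvg_hyp0.
rewrite rmorphM; apply: cvgC_lim; apply: eq_cvgC c => n.
rewrite /pseries /series/= rmorph_sum mulr_sumr; apply: eq_bigr => k _.
have -> : 2 * Num.sqrt u / 2 = Num.sqrt u by field.
rewrite cpowRD cpowR_real// -natrM cpowR_nat// exprM -rmorphXn/= sqr_sqrtr ?(ltW u0)//.
have -> : Num.sqrt u `^ nu = u `^ (nu / 2).
  by rewrite -powR12_sqrt ?(ltW u0)// -powRrM mulrC.
have -> : nu%:C + k%:R + 1 = (1 + nu + k%:R)%:C.
  by rewrite !rmorphD/= -natC rmorph1; ring.
rewrite rGamma_real /hyp0_coeff (natC R k`!) -!rmorphXn -fmorphV -!rmorphM.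
by congr (_%:C) => /=; ring.
Qed.

End Hyp0.

Definition macdonald_kernel (R : realType) (a u t : R) : R :=
  expR (- t - u / t) * t `^ (a - 1).

(* Macdonald's integral: K_nu (2 sqrt u) = u ^ (nu / 2) / 2 * macdonald (- nu) u. *)
Definition macdonald (R : realType) (a u : R) : R :=
  Rintegral (@lebesgue_measure R) `]0, +oo[ (macdonald_kernel a u).

(** * Macdonald's integral: convergence, derivative, symmetry, behaviour at 0 *)

Section Macdonald.
Variable R : realType.
Local Notation mu := (@lebesgue_measure R).
Local Notation Rpos := (`]0%R, +oo[%classic : set R).
Implicit Types (a u t : R).

Local Notation k := (@macdonald_kernel R).
Local Notation M := (@macdonald R).

Lemma kernel_ge0 a u t : 0 <= k a u t.
Proof. by rewrite mulr_ge0 ?expR_ge0 ?powR_ge0. Qed.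

Lemma continuous_kernel a u t : 0 < t -> {for t, continuous (k a u)}.
Proof.
move=> t0; apply: cvgM; last exact: continuous_powR.
apply: (@continuous_comp _ _ _ (fun t => - t - u / t) expR); last exact: continuous_expR.
apply: cvgB; first by apply: cvgN; exact: cvg_id.
apply: cvgM; first exact: cvg_cst.
by apply: cvgV; [rewrite gt_eqF|exact: cvg_id].
Qed.

(** From y/p <= exp(y/p). At y = u/t it gives exp(-u/t) <= (p t/u)^p, which pays for any negative
    power of t near 0. *)
Lemma expRN_le_powR (p y : R) : 0 < p -> 0 < y -> expR (- y) <= (p / y) `^ p.
Proof.
move=> p0 y0; rewrite expRN -[p / y]invf_div.
have -> : (y / p)^-1 `^ p = ((y / p) `^ p)^-1.
  by rewrite -powR_inv1 ?divr_ge0 ?ltW// -powRrM mulN1r powRN.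
rewrite lef_pV2 ?posrE ?expR_gt0 ?powR_gt0 ?divr_gt0//.
have -> : expR y = expR (y / p) `^ p by rewrite -expRM divfK ?gt_eqF.
rewrite ge0_ler_powR ?nnegrE ?expR_ge0 ?divr_ge0 ?(ltW p0) ?(ltW y0)//.
by rewrite (le_trans _ (expR_ge1Dx _))// lerDr.
Qed.

Lemma integrable_kernel a u : 0 < u -> mu.-integrable Rpos (EFin \o k a u).
Proof.
(* This [p] makes a + p positive, so that t^(a+p-1) exp(-t) is an integrable majorant up to a
   constant. *)
move=> u0; pose p : R := `|a| + 1; have p0 : 0 < p by rewrite ltr_wpDl.
have ap0 : 0 < a + p.
  by rewrite /p addrA ltr_wpDl// -lerBlDl sub0r -normrN ler_norm.
have ig := integrable_gam ap0.
have igC : mu.-integrable Rpos (fun t => ((p / u) `^ p)%:E *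
    (EFin \o (fun t => t `^ (a + p - 1) * expR (- t))%R) t)%E by exact: integrableZl.
apply: (@le_integrable _ (measurableTypeR R) _ _ Rpos _ _ _ _ _ igC) => //.
  apply: measurable_EFinR; apply: measurable_fun_pos => t; exact: continuous_kernel.
move=> t /=; rewrite in_itv/= andbT => t0.
rewrite lee_fin ger0_norm ?kernel_ge0// (le_trans _ (ler_norm _))//.
rewrite /macdonald_kernel expRD.
have -> : a + p - 1 = p + (a - 1) by ring.
rewrite [t `^ (p + _)]powRD ?(gt_eqF t0) ?implybT//.
have -> : (p / u) `^ p * (t `^ p * t `^ (a - 1) * expR (- t)) =
   expR (- t) * ((p / u) `^ p * t `^ p) * t `^ (a - 1) by ring.
rewrite ler_wpM2r ?powR_ge0// ler_wpM2l ?expR_ge0//.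
rewrite -powRM ?divr_ge0 ?(ltW p0) ?(ltW u0) ?(ltW t0)//.
have -> : p / u * t = p / (u / t) by field; rewrite !gt_eqF.
by apply: expRN_le_powR; rewrite ?divr_gt0.
Qed.

Lemma is_derive_kernel a u t : 0 < t ->
  is_derive u (1 : R) (fun u => k a u t) (- k (a - 1) u t).
Proof.
move=> t0; have d1 : is_derive u (1 : R) (fun u => - t - u / t) (- t^-1).
  have h := is_deriveB (is_derive_cst (- t) u (1 : R))
    (is_deriveZ t^-1 (is_derive_id u (1 : R))).
  have E : (fun u => - t - u / t) = cst (- t) - t^-1 \*: id.
    by apply/funext => x /=; rewrite !fctE mulrC.
  by rewrite E; apply: (is_derive_eq h); rewrite /GRing.scale/= mulr1 sub0r.
have d2 := is_derive1_comp (g := fun u => - t - u / t) (is_derive_expR (- t - u / t)) d1.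
have h := is_deriveM d2 (is_derive_cst (t `^ (a - 1)) u (1 : R)).
apply: (is_derive_eq h).
rewrite /GRing.scale/= mulr0 add0r /macdonald_kernel.
have -> : t `^ (a - 1) = t * t `^ (a - 1 - 1).
  rewrite -[X in X * _]powRr1 ?(ltW t0)// -powRD ?(gt_eqF t0) ?implybT//.
  by congr (_ `^ _); ring.
by field; rewrite gt_eqF.
Qed.

Lemma is_derive_macdonald a u : 0 < u ->
  is_derive u (1 : R) (M a) (- M (a - 1) u).
Proof.
(* Differentiation under the integral is local: for x in ]u/2, 2u[ the derivative in x is dominated
   by the kernel with exponent parameter a - 1 at u/2. *)
move=> u0; pose u1 := u / 2; pose u2 := 2 * u.
have u10 : 0 < u1 by rewrite divr_gt0.
have Iu : `]u1, u2[%classic u.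
  by rewrite /= in_itv/= /u1 /u2; apply/andP; split; lra.
have I0 x : `]u1, u2[%classic x -> 0 < x.
  by rewrite /= in_itv/= => /andP[+ _]; exact: lt_trans.
have B0 t : Rpos t -> 0 < t by rewrite /= in_itv/= andbT.
have dE x t : Rpos t -> derive1 ((k a)^~ t) x = - k (a - 1) x t.
  by move=> /B0 t0; rewrite derive1E; have h := is_derive_kernel a x t0; rewrite derive_val.
have ik x : `]u1, u2[%classic x -> mu.-integrable Rpos (EFin \o k a x).
  by move=> /I0; exact: integrable_kernel.
have dk x t : `]u1, u2[%classic x -> Rpos t -> derivable ((k a)^~ t) x 1.
  by move=> _ /B0 t0; have [] := is_derive_kernel a x t0.
have ub x t : `]u1, u2[%classic x -> Rpos t ->
    `| derive1 ((k a)^~ t) x | <= k (a - 1) u1 t.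
  move=> /[dup] /I0 x0 xI Bt; have t0 := B0 _ Bt; rewrite dE// normrN ger0_norm ?kernel_ge0//.
  rewrite ler_wpM2r ?powR_ge0// ler_expR lerD2l lerN2 ler_pM2r ?invr_gt0//.
  by move: xI; rewrite /= in_itv/= => /andP[/ltW].
have iG := integrable_kernel (a - 1) u10.
have G0 t : 0 <= k (a - 1) u1 t by exact: kernel_ge0.
have mB : measurable Rpos by [].
apply: DeriveDef.
  exact: (@derivable_under_integral R _ _ mu (k a) Rpos mB u u1 u2 Iu ik dk _ G0 iG ub).
rewrite -derive1E.
have := @differentiation_under_integral R _ _ mu (k a) Rpos mB u u1 u2 Iu ik dk _ G0 iG ub.
move=> ->; have -> : - M (a - 1) u = -1 * M (a - 1) u by rewrite mulN1r.
rewrite /macdonald -RintegralZl//; last exact: integrable_kernel.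
by apply: eq_Rintegral => t /set_mem Bt; rewrite mulN1r -dE.
Qed.

Lemma bigcup_pos_scale u : 0 < u ->
  Rpos = \bigcup_(n : nat) `[u / n.+1%:R, u / n.+1%:R^-1]%classic.
Proof.
move=> u0; apply/seteqP; split => t /=; last first.
  move=> [n _] /=; rewrite !in_itv/= andbT => /andP[+ _]; apply: lt_le_trans.
  by rewrite divr_gt0.
rewrite in_itv/= andbT => t0.
have : Rpos (t / u) by rewrite /= in_itv/= andbT divr_gt0.
rewrite bigcup_pos => -[n _] /=; rewrite in_itv/= => /andP[h1 h2].
exists n => //=; rewrite in_itv/= invrK; apply/andP; split.
  by move: h1; rewrite ler_pdivlMr// mulrC.
by move: h2; rewrite ler_pdivrMr// mulrC.
Qed.

(** The substitution t -> u/t preserves t + u/t. It is made on the segments [1/(n+1), n+1], whose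
    images [u/(n+1), u(n+1)] exhaust the half-line as well. *)
Lemma macdonald_sym a u : 0 < u -> M a u = u `^ a * M (- a) u.
Proof.
move=> u0.
have mk b : measurable_fun Rpos (k b u).
  by apply: measurable_fun_pos => t; exact: continuous_kernel.
have Sn0 (n : nat) : (0 : R) < n.+1%:R^-1 by rewrite invr_gt0.
have Sn n m : (n <= m)%N -> (m.+1%:R^-1 : R) <= n.+1%:R^-1.
  by move=> nm; rewrite lef_pV2 ?posrE// ler_nat.
pose F t := u / t.
have dF t : 0 < t -> is_derive t (1 : R) F (- (u / t ^+ 2)).
  move=> t0; have t_neq0 : t != 0 by rewrite gt_eqF.
  have h := is_deriveZ u (is_deriveV t_neq0 (is_derive_id t (1 : R))).
  have E : F = u \*: (fun t => t^-1) by apply/funext.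
  by rewrite E; apply: (is_derive_eq h); rewrite /GRing.scale/= mulr1 mulrN.
have F'E t : 0 < t -> derive1 F t = - (u / t ^+ 2).
  by move=> t0; have h := dF t t0; rewrite derive1E derive_val.
have GF t : 0 < t -> (k a u \o F) t * - (- (u / t ^+ 2)) = u `^ a * k (- a) u t.
  move=> t0; rewrite opprK /= /macdonald_kernel /F.
  have -> : - (u / t) - u / (u / t) = - t - u / t by field; rewrite !gt_eqF.
  have -> : (u / t) `^ (a - 1) = u `^ (a - 1) * (t `^ (- a - 1) * t ^+ 2).
    rewrite powRM ?invr_ge0 ?(ltW u0) ?(ltW t0)//; congr (_ * _).
    rewrite -powR_inv1 ?(ltW t0)// -powRrM -powR_mulrn ?(ltW t0)// -powRD ?(gt_eqF t0) ?implybT//.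
    by congr (_ `^ _); ring.
  have -> : u `^ a = u * u `^ (a - 1).
    rewrite -[X in X * _]powRr1 ?(ltW u0)// -powRD ?(gt_eqF u0) ?implybT//.
    by congr (_ `^ _); ring.
  by field; rewrite gt_eqF.
have sub (n : nat) : (\int[mu]_(t in `[(u / n.+1%:R)%R, (u / n.+1%:R^-1)%R]) (k a u t)%:E =
    \int[mu]_(t in `[(n.+1%:R^-1)%R, n.+1%:R]) (u `^ a * k (- a) u t)%R%:E)%E.
  have le1 : (n.+1%:R^-1 : R) <= n.+1%:R.
    by rewrite (@le_trans _ _ 1)// ?invf_le1 ?ler1n.
  have pos t : t \in `[n.+1%:R^-1, n.+1%:R] -> 0 < t.
    by rewrite in_itv/= => /andP[h _]; exact: lt_le_trans h.
  have poso t : t \in `]n.+1%:R^-1, n.+1%:R[ -> 0 < t.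
    by rewrite in_itv/= => /andP[h _]; exact: lt_trans h.
  have cF' t : 0 < t -> {for t, continuous (derive1 F)}.
    move=> t0; have c : (fun t => - (u / t ^+ 2)) x @[x --> t] --> - (u / t ^+ 2).
      apply: cvgN; apply: cvgM; first exact: cvg_cst.
      apply: cvgV; first by rewrite expf_neq0// gt_eqF.
      exact: exprn_continuous.
    rewrite /prop_for /continuous_at F'E//; apply: cvg_trans c.
    apply: near_eq_cvg; near=> x; rewrite F'E//.
    by near: x; exact: lt_nbhsr.
  have cF t : 0 < t -> {for t, continuous F}.
    by move=> t0; exact: (is_derive_continuous (dF t t0)).
  rewrite (@integration_by_substitution_decreasing _ F (k a u) n.+1%:R^-1 n.+1%:R le1).
  - apply: eq_integral => t; rewrite inE => /pos t0.
    by rewrite -GF// -F'E.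
  - move=> x y /pos x0 /pos y0 xy; rewrite /F ltr_pM2l// ltf_pV2 ?posrE//.
  - by move=> t /poso; exact: cF'.
  - by apply/cvg_ex; exists (derive1 F n.+1%:R^-1); apply: cvg_at_right_filter; exact: cF'.
  - by apply/cvg_ex; exists (derive1 F n.+1%:R); apply: cvg_at_left_filter; exact: cF'.
  - split.
    + by move=> t /poso /dF [].
    + by apply: cvg_at_right_filter; exact: cF.
    + by apply: cvg_at_left_filter; exact: cF.
  - apply: continuous_in_subspaceT => t /set_mem /=; rewrite in_itv/= => /andP[h _].
    by apply: continuous_kernel; rewrite (lt_le_trans _ h)// divr_gt0.
have c1 := @ge0_cvg_integral_pos R (k a u) (fun n => u / n.+1%:R) (fun n => u / n.+1%:R^-1)
  (mk a) (fun t _ => kernel_ge0 a u t).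
have c2 := @ge0_cvg_integral_pos R (fun t => u `^ a * k (- a) u t) (fun n => n.+1%:R^-1)
  (fun n => n.+1%:R).
have E : (\int[mu]_(t in Rpos) (k a u t)%:E = \int[mu]_(t in Rpos) (u `^ a * k (- a) u t)%R%:E)%E.
  rewrite -(cvg_lim (@ereal_hausdorff R) (c1 _ _ _ (bigcup_pos_scale u0))).
  - rewrite -(cvg_lim (@ereal_hausdorff R) (c2 _ _ _ _ _ (bigcup_pos R))).
    + by congr (lim _); apply/funext => P; under eq_fun do rewrite sub.
    + by apply: measurable_funM.
    + by move=> t _; rewrite mulr_ge0 ?powR_ge0 ?kernel_ge0.
    + by [].
    + exact: Sn.
    + by move=> n m nm; rewrite ler_nat.
  - by move=> n; rewrite divr_gt0.
  - by move=> n m nm; rewrite ler_pM2l// Sn.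
  - by move=> n m nm; rewrite ler_pM2l// !invrK ler_nat.
rewrite /macdonald -RintegralZl//; last exact: integrable_kernel.
by rewrite /Rintegral E.
Unshelve. all: end_near. Qed.

(** At u = 0 the kernel becomes the Gamma integrand, which also dominates it. The points 1/(n+1) are
    those at which [wronskian_const] takes its limit. *)
Lemma cvg_macdonald0 a : 0 < a -> M a n.+1%:R^-1 @[n --> \oo] --> gam a.
Proof.
move=> a0.
have [] := @cintegral_cvg R Rpos (fun n t => (k a n.+1%:R^-1 t)%:C)
   (fun t => (t `^ (a - 1) * expR (- t))%:C) (fun t => t `^ (a - 1) * expR (- t)).
- by [].
- by move=> n; apply: cmeasurable_real; apply: measurable_fun_pos => t; exact: continuous_kernel.
- apply: cmeasurable_real; have := integrable_gam a0.
  by case/integrableP => /measurable_EFinP.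
- move=> t; rewrite /= in_itv/= andbT => t0; apply: cvg_real_complex.
  rewrite mulrC; apply: cvgM; last exact: cvg_cst.
  apply: continuous_cvg; first exact: continuous_expR.
  rewrite -[X in _ --> X]subr0; apply: cvgB; first exact: cvg_cst.
  rewrite -(mul0r t^-1); apply: cvgM; last exact: cvg_cst.
  exact: cvg_harmonic.
- exact: integrable_gam.
- move=> n t; rewrite /= in_itv/= andbT => t0.
  rewrite normc_real ger0_norm ?kernel_ge0// /macdonald_kernel mulrC.
  by rewrite ler_wpM2l ?powR_ge0// ler_expR gerBl divr_ge0 ?ltW.
move=> _; rewrite cintegral_real => /cvg_complexP[c _]; move: c.
by rewrite (_ : _ \o _ = fun n => M a n.+1%:R^-1).
Qed.

End Macdonald.

(** * Identification of K_nu with Macdonald's integral by Wronskians *)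

Section BesselK.
Variable R : realType.
Implicit Types (a u v t nu : R) (y q : R -> R).

Local Notation M := (@macdonald R).
Local Notation S := (@hyp0 R).

(* A solution of (u ^ (1 + nu) y')' = u ^ nu y, with q = - u ^ (1 + nu) y'. *)
Definition bessel_system nu y q := forall u, 0 < u ->
  is_derive u (1 : R) y (- (u `^ (- 1 - nu) * q u)) /\
  is_derive u (1 : R) q (- (u `^ nu * y u)).

Lemma eq_pos_of_derive0 (W : R -> R) :
  (forall u, 0 < u -> is_derive u (1 : R) W 0) ->
  forall u v, 0 < u -> 0 < v -> W u = W v.
Proof.
move=> dW; have H u v : 0 < u -> u < v -> W u = W v.
  move=> u0 uv.
  have pos t : u <= t -> 0 < t by exact: lt_le_trans.
  have d t : t \in `]u, v[ -> is_derive t (1 : R) W ((fun=> 0) t).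
    by rewrite in_itv/= => /andP[/ltW/pos t0 _]; exact: dW.
  have c : {within `[u, v], continuous W}.
    apply: derivable_within_continuous => t; rewrite in_itv/= => /andP[/pos t0 _].
    by have [] := dW _ t0.
  have [t _ /eqP] := MVT uv d c.
  by rewrite mul0r subr_eq0 => /eqP.
move=> u v u0 v0; have [uv|vu|->//] := ltgtP u v; first exact: H.
by apply/esym; exact: H.
Qed.

Lemma powR_split u a b : 0 < u -> u `^ (a + b) = u `^ a * u `^ b.
Proof. by move=> u0; rewrite powRD// (gt_eqF u0) implybT. Qed.

(** With [q] in place of y', the weight u^(1+nu) is absorbed and the Wronskian has derivative 0, so
    its value is its limit at 0. *)
Lemma wronskian_const nu y1 q1 y2 q2 (L : R) :
  bessel_system nu y1 q1 -> bessel_system nu y2 q2 ->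
  (fun n : nat => y1 n.+1%:R^-1 * q2 n.+1%:R^-1 - q1 n.+1%:R^-1 * y2 n.+1%:R^-1)
    @ \oo --> L ->
  forall u, 0 < u -> y1 u * q2 u - q1 u * y2 u = L.
Proof.
move=> s1 s2 cL u u0; pose W u := y1 u * q2 u - q1 u * y2 u.
have dW v : 0 < v -> is_derive v (1 : R) W 0.
  move=> v0; have [d1 d2] := s1 _ v0; have [d3 d4] := s2 _ v0.
  have h := is_deriveB (is_deriveM d1 d4) (is_deriveM d2 d3).
  by apply: (is_derive_eq h); rewrite /GRing.scale/=; ring.
rewrite -(cvg_lim (@norm_hausdorff _ R) cL).
rewrite (_ : (fun n : nat => _) = fun=> W u) ?lim_cst//.
apply/funext => n; apply: (eq_pos_of_derive0 dW) => //.
Qed.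

Section Solutions.
Variable nu : R.
Hypothesis nu01 : 0 < nu < 1.
Let nu0 : 0 < nu. Proof. by case/andP: nu01. Qed.
Let nu1 : 0 < 1 - nu. Proof. by rewrite subr_gt0; case/andP: nu01. Qed.

(** Differentiation lowers the parameter by 1; the symmetry [macdonald_sym] then brings - nu - 1
    back to nu + 1, and nu back to - nu. *)
Lemma bessel_system_macdonald : bessel_system nu (M (- nu)) (M (nu + 1)).
Proof.
move=> u u0; split.
  apply: (is_derive_eq (is_derive_macdonald (- nu) u0)).
  have -> : - nu - 1 = - 1 - nu by ring.
  rewrite (macdonald_sym (- 1 - nu) u0).
  by have -> : - (- 1 - nu) = nu + 1 by ring.
apply: (is_derive_eq (is_derive_macdonald (nu + 1) u0)).
by rewrite addrK (macdonald_sym nu u0).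
Qed.

(** Here - u^(1+nu) y' is nu S(1-nu) - u S(2-nu), which [hyp0_rec] at - nu recognizes as -
    S(-nu). *)
Lemma bessel_system_first :
  bessel_system nu (fun u => u `^ (- nu) * S (1 - nu) u) (fun u => - S (- nu) u).
Proof.
move=> u u0; split.
  have h := is_deriveM (is_derive1_powR (- nu) u0) (is_derive_hyp0 (1 - nu) u).
  apply: (is_derive_eq h); rewrite /GRing.scale/=.
  rewrite (hyp0_rec (- nu)).
  have -> : - nu + 1 = 1 - nu by ring.
  have -> : u `^ (- nu) = u * u `^ (- 1 - nu).
    rewrite -[X in X * _](powRr1 (ltW u0)) -(powR_split _ _ u0).
    by have -> : 1 + (- 1 - nu) = - nu by ring.
  have -> : - nu - 1 = - 1 - nu by ring.
  by move: (S (1 - nu) u) (S (1 - nu + 1) u) (u `^ (- 1 - nu)) => x y z; ring.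
have h := is_deriveN (is_derive_hyp0 (- nu) u).
apply: (is_derive_eq h).
have -> : - nu + 1 = 1 - nu by ring.
by rewrite mulrA -(powR_split _ _ u0) subrr powRr0 mul1r.
Qed.

Lemma bessel_system_second :
  bessel_system nu (S (1 + nu)) (fun u => - (u `^ (1 + nu) * S (1 + nu + 1) u)).
Proof.
move=> u u0; split.
  apply: (is_derive_eq (is_derive_hyp0 (1 + nu) u)).
  rewrite mulrN opprK mulrA -(powR_split _ _ u0).
  have -> : - 1 - nu + (1 + nu) = 0 by ring.
  by rewrite powRr0 mul1r.
have h := is_deriveN (is_deriveM (is_derive1_powR (1 + nu) u0)
  (is_derive_hyp0 (1 + nu + 1) u)).
apply: (is_derive_eq h); rewrite /GRing.scale/=.
rewrite (hyp0_rec (1 + nu)) [1 + nu - 1]addrAC subrr add0r.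
rewrite (powR_split 1 nu u0) (powRr1 (ltW u0)).
by move: (S (1 + nu + 1) u) (S (1 + nu + 1 + 1) u) (u `^ nu) => x y z; ring.
Qed.

Lemma cvg_hyp0_0 c : S c n.+1%:R^-1 @[n --> \oo] --> rg c.
Proof.
rewrite -hyp00; apply: continuous_cvg; first exact: continuous_hyp0.
exact: cvg_harmonic.
Qed.

Lemma cvg_powR_harmonic (a : R) : 0 < a -> (n.+1%:R^-1 : R) `^ a @[n --> \oo] --> 0.
Proof.
move=> a0; have /cvg_at_rightP := powR_cvg0 a0.
apply; split; first by move=> n; rewrite invr_gt0.
exact: cvg_harmonic.
Qed.

(* Both sides come from differentiating M nu u = u ^ nu M (- nu) u. *)
Lemma macdonald_contiguous u : 0 < u ->
  M (nu + 1) u = nu * M nu u + u `^ nu * M (1 - nu) u.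
Proof.
move=> u0; have d1 := is_derive_macdonald nu u0.
have d2 := is_deriveM (is_derive1_powR nu u0) (bessel_system_macdonald u0).1.
have d3 : is_derive u (1 : R) (M nu) (- M (nu - 1) u).
  exact: d1.
have d4 : is_derive u (1 : R) (M nu)
    (u `^ nu * - (u `^ (- 1 - nu) * M (nu + 1) u) + M (- nu) u * (nu * u `^ (nu - 1))).
  apply: near_eq_is_derive d2; near=> t.
  have t0 : 0 < t by near: t; exact: lt_nbhsr.
  by rewrite (macdonald_sym nu t0).
have E : - M (nu - 1) u =
    u `^ nu * - (u `^ (- 1 - nu) * M (nu + 1) u) + M (- nu) u * (nu * u `^ (nu - 1)).
  by rewrite -(@derive_val _ _ _ _ _ _ _ d3) -(@derive_val _ _ _ _ _ _ _ d4).
move: E; rewrite (macdonald_sym nu u0) (macdonald_sym (nu - 1) u0).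
rewrite opprB [u `^ nu * - _]mulrN (mulrA (u `^ nu) (u `^ (- 1 - nu))) -(powR_split _ _ u0).
have -> : nu + (- 1 - nu) = - 1 by ring.
have -> : u `^ nu = u * u `^ (nu - 1).
  rewrite -[X in X * _](powRr1 (ltW u0)) -(powR_split _ _ u0).
  by have -> : 1 + (nu - 1) = nu by ring.
rewrite (powR_inv1 (ltW u0)).
move: (M (nu + 1) u) (M (- nu) u) (M (1 - nu) u) (u `^ (nu - 1)) => X Y Z p E.
have u_neq0 : u != 0 by rewrite gt_eqF.
have -> : X = u * (u^-1 * X) by rewrite mulrA divff// mul1r.
have -> : u^-1 * X = p * Z + Y * (nu * p) by move: E; set W := u^-1 * X; lra.
by ring.
Unshelve. all: end_near. Qed.

Let h (n : nat) : R := n.+1%:R^-1.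
Let h0 n : 0 < h n. Proof. by rewrite /h invr_gt0. Qed.
Let ch : h @ \oo --> (0 : R). Proof. exact: cvg_harmonic. Qed.
Let cG : M nu (h n) @[n --> \oo] --> gam nu.
Proof. exact: cvg_macdonald0. Qed.
Let cQ : M (nu + 1) (h n) @[n --> \oo] --> gam (nu + 1).
Proof. by apply: cvg_macdonald0; rewrite addr_gt0. Qed.
Let cM : M (1 - nu) (h n) @[n --> \oo] --> gam (1 - nu).
Proof. exact: cvg_macdonald0. Qed.

Let gam_rg t : 0 < t -> gam t * rg t = 1.
Proof. by move=> t0; rewrite rg_gam// divff// gt_eqF// gam_gt0. Qed.

Lemma wronskian_first_second u : 0 < u ->
  u `^ (- nu) * S (1 - nu) u * - (u `^ (1 + nu) * S (1 + nu + 1) u) -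
  - S (- nu) u * S (1 + nu) u = rg (- nu) * rg (1 + nu).
Proof.
move: u; apply: (wronskian_const bessel_system_first bessel_system_second).
(* The powers u^(-nu) and u^(1+nu) multiply to u, so only the other product survives at 0. *)
have E n : h n `^ (- nu) * S (1 - nu) (h n) * - (h n `^ (1 + nu) * S (1 + nu + 1) (h n)) -
    - S (- nu) (h n) * S (1 + nu) (h n) =
    S (- nu) (h n) * S (1 + nu) (h n) - h n * (S (1 - nu) (h n) * S (1 + nu + 1) (h n)).
  have : h n `^ (- nu) * h n `^ (1 + nu) = h n.
    rewrite -(powR_split _ _ (h0 n)); have -> : - nu + (1 + nu) = 1 by ring.
    by rewrite (powRr1 (ltW (h0 n))).
  move: (S (1 - nu) (h n)) (S (1 + nu + 1) (h n)) (S (- nu) (h n)) (S (1 + nu) (h n)).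
  move: (h n) (h n `^ (- nu)) (h n `^ (1 + nu)) => x p q a b c d <-.
  by ring.
rewrite (funext E) -[X in _ --> X]subr0; apply: cvgB.
  by apply: cvgM; exact: cvg_hyp0_0.
rewrite -(mul0r (rg (1 - nu) * rg (1 + nu + 1))); apply: cvgM; first exact: ch.
by apply: cvgM; exact: cvg_hyp0_0.
Qed.

Lemma wronskian_macdonald_second u : 0 < u ->
  M (- nu) u * - (u `^ (1 + nu) * S (1 + nu + 1) u) - M (nu + 1) u * S (1 + nu) u = - 1.
Proof.
move: u; apply: (wronskian_const bessel_system_macdonald bessel_system_second).
(* [M (- nu)] is unbounded at 0, but by symmetry u^(1+nu) M(-nu) = u M(nu), which tends to 0. *)
have E n : M (- nu) (h n) * - (h n `^ (1 + nu) * S (1 + nu + 1) (h n)) -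
    M (nu + 1) (h n) * S (1 + nu) (h n) =
    - (h n * (M nu (h n) * S (1 + nu + 1) (h n))) - M (nu + 1) (h n) * S (1 + nu) (h n).
  rewrite (macdonald_sym nu (h0 n)) (powR_split 1 nu (h0 n)) (powRr1 (ltW (h0 n))).
  move: (M (- nu) (h n)) (S (1 + nu + 1) (h n)) (M (nu + 1) (h n)) (S (1 + nu) (h n)).
  by move: (h n) (h n `^ nu) => x p a b c d; ring.
rewrite (funext E).
have -> : - 1 = - (0 * (gam nu * rg (1 + nu + 1))) - gam (nu + 1) * rg (1 + nu).
  by rewrite mul0r oppr0 sub0r [1 + nu]addrC gam_rg// addr_gt0.
apply: cvgB; last by apply: cvgM; [exact: cQ|exact: cvg_hyp0_0].
apply: cvgN; apply: cvgM; first exact: ch.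
by apply: cvgM; [exact: cG|exact: cvg_hyp0_0].
Qed.

Lemma wronskian_macdonald_first u : 0 < u ->
  M (- nu) u * - S (- nu) u - M (nu + 1) u * (u `^ (- nu) * S (1 - nu) u) = - 1.
Proof.
move: u; apply: (wronskian_const bessel_system_macdonald bessel_system_first).
(* Both products are of order u^(-nu) at 0. After [macdonald_contiguous] and [hyp0_rec] the terms nu
   u^(-nu) M(nu) S(1-nu) cancel, and everything left has a limit. *)
have E n : M (- nu) (h n) * - S (- nu) (h n) -
    M (nu + 1) (h n) * (h n `^ (- nu) * S (1 - nu) (h n)) =
    - (h n `^ (1 - nu) * (M nu (h n) * S (1 - nu + 1) (h n))) -
    M (1 - nu) (h n) * S (1 - nu) (h n).
  rewrite (macdonald_contiguous (h0 n)) (macdonald_sym (- nu) (h0 n)) opprK.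
  rewrite (hyp0_rec (- nu)); have -> : - nu + 1 = 1 - nu by ring.
  rewrite (powR_split 1 (- nu) (h0 n)) (powRr1 (ltW (h0 n))).
  have : h n `^ nu * h n `^ (- nu) = 1 by rewrite -(powR_split _ _ (h0 n)) subrr powRr0.
  move: (S (1 - nu) (h n)) (S (1 - nu + 1) (h n)) (M nu (h n)) (M (1 - nu) (h n)).
  move: (h n) (h n `^ nu) (h n `^ (- nu)) => x p q a b c d pq.
  transitivity (- (x * q * (c * b)) - p * q * d * a); first by ring.
  by rewrite pq mul1r.
rewrite (funext E).
have -> : - 1 = - (0 * (gam nu * rg (1 - nu + 1))) - gam (1 - nu) * rg (1 - nu).
  by rewrite mul0r oppr0 sub0r gam_rg.
apply: cvgB; last by apply: cvgM; [exact: cM|exact: cvg_hyp0_0].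
apply: cvgN; apply: cvgM; first exact: cvg_powR_harmonic.
by apply: cvgM; [exact: cG|exact: cvg_hyp0_0].
Qed.

(** Any three pairs satisfy P W(A,B) = W(P,B) A - W(P,A) B. For the Macdonald solution P and the
    series solutions A, B the Wronskians W(A,B), W(P,B), W(P,A) are - r, - 1, - 1 with r =
    1/(Gamma(nu) Gamma(1-nu)), whence A - B = r P. *)
Lemma macdonald_hyp0 u : 0 < u ->
  u `^ (- nu) * S (1 - nu) u - S (1 + nu) u = rg nu * rg (1 - nu) * M (- nu) u.
Proof.
move=> u0.
have rnu : rg (- nu) * rg (1 + nu) = - (rg nu * rg (1 - nu)).
  rewrite (rgS (- nu)) (rgS nu); have -> : - nu + 1 = 1 - nu by ring.
  by rewrite [nu + 1]addrC; move: (rg (1 - nu)) (rg (1 + nu)) => x y; ring.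
move: (wronskian_first_second u0) (wronskian_macdonald_second u0) (wronskian_macdonald_first u0).
rewrite rnu; move: (rg nu * rg (1 - nu)) (- (u `^ (1 + nu) * S (1 + nu + 1) u)) (S (1 + nu) u).
move: (u `^ (- nu) * S (1 - nu) u) (- S (- nu) u) (M (- nu) u) (M (nu + 1) u).
move=> A qA P Q r qB B e1 e2 e3.
have : P * (A * qB - qA * B) = (P * qB - Q * B) * A - (P * qA - Q * A) * B by ring.
rewrite e1 e2 e3 => hP; have -> : r * P = - (P * - r) by ring.
by rewrite hP; ring.
Qed.

Lemma besselK_macdonald u : 0 < u ->
  besselK nu%:C (2 * Num.sqrt u) = pi%:C / (2 * csin (pi%:C * nu%:C)) *
    (rg nu * rg (1 - nu) * (u `^ (nu / 2) * M (- nu) u))%:C.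
Proof.
move=> u0; rewrite /besselK; congr (_ * _).
rewrite -raddfN (besselI_hyp0 _ u0) (besselI_hyp0 _ u0) -raddfB; congr (_%:C).
have -> : u `^ (- nu / 2) = u `^ (nu / 2) * u `^ (- nu).
  rewrite -(powR_split _ _ u0); have -> : nu / 2 + - nu = - nu / 2 by field.
  by [].
rewrite mulrCA -(macdonald_hyp0 u0).
by move: (S _ _) (S _ _) (u `^ _) (u `^ _) => x y z w; ring.
Qed.

End Solutions.
End BesselK.

(** * The Mellin transform of Macdonald's integral by Fubini *)

Section Mellin.
Variable R : realType.
Local Notation mu := (@lebesgue_measure R).
Local Notation Rpos := (`]0%R, +oo[%classic : set R).
Local Notation T := (measurableTypeR R).

(** The function is extended by zero to the plane; its absolute integrability is checked by
    integrating in [u] first, where [g] bounds the result. *)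
Lemma fubini_pos (F : R -> R -> R) (g : R -> R) :
  measurable_fun [set: T * T] (fun z : T * T => F z.1 z.2) ->
  (forall u, 0 < u -> mu.-integrable Rpos (EFin \o F u)) ->
  (forall t, 0 < t -> mu.-integrable Rpos (EFin \o (fun u => F u t))) ->
  mu.-integrable Rpos (EFin \o g) ->
  (forall t, 0 < t -> Rintegral mu Rpos (fun u => `|F u t|) <= g t) ->
  mu.-integrable Rpos (EFin \o (fun u => Rintegral mu Rpos (F u))) /\
  Rintegral mu Rpos (fun u => Rintegral mu Rpos (F u)) =
  Rintegral mu Rpos (fun t => Rintegral mu Rpos (fun u => F u t)).
Proof.
move=> mF F1 F2 ig Fg.
have mpos : @measurable _ T Rpos by exact: measurable_itv.
pose f : T * T -> \bar R := (fun z => (F z.1 z.2)%:E) \_ (Rpos `*` Rpos).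
have mf : measurable_fun setT f.
  have mE : measurable_fun [set: T * T] (EFin \o (fun z : T * T => F z.1 z.2)).
    exact/measurable_EFinP.
  exact: (measurable_restrictT _ (measurableX mpos mpos)).1 (measurable_funTS mE).
have fE (u t : R) : f (u, t) = ((fun t => ((EFin \o (fun u => F u t)) \_ Rpos) u) \_ Rpos) t.
  rewrite /f /patch in_setX /=; case: (u \in Rpos); case: (t \in Rpos) => //.
have f1 u : (\int[mu]_t f (u, t) = ((EFin \o (fun u => Rintegral mu Rpos (F u))) \_ Rpos) u)%E.
  transitivity (\int[mu]_t ((fun t => ((EFin \o (fun u => F u t)) \_ Rpos) u) \_ Rpos) t)%E.
    by apply: eq_integral => t _; exact: fE.
  rewrite -integral_mkcond /patch.
  have [uP|uN] := boolP (u \in Rpos); last by rewrite integral0.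
  rewrite /= fineK//; apply: integrable_fin_num => //.
  by move: uP; rewrite inE/= in_itv/= andbT => /F1.
have fE2 (u t : R) : f (u, t) = ((fun u => ((EFin \o F u) \_ Rpos) t) \_ Rpos) u.
  rewrite /f /patch in_setX /=; case: (u \in Rpos); case: (t \in Rpos) => //.
have f2 t : (\int[mu]_u f (u, t) =
    ((EFin \o (fun t => Rintegral mu Rpos (fun u => F u t))) \_ Rpos) t)%E.
  transitivity (\int[mu]_u ((fun u => ((EFin \o F u) \_ Rpos) t) \_ Rpos) u)%E.
    by apply: eq_integral => u _; exact: fE2.
  rewrite -integral_mkcond /patch.
  have [tP|tN] := boolP (t \in Rpos); last by rewrite integral0.
  rewrite /= fineK//; apply: integrable_fin_num => //.
  by move: tP; rewrite inE/= in_itv/= andbT => /F2.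
have fi : (mu \x mu)%E.-integrable setT f.
  apply/integrable21ltyP => //.
  have h t : (\int[mu]_u `|f (u, t)| <= ((EFin \o g) \_ Rpos) t)%E.
    rewrite [leLHS](_ : _ = \int[mu]_(u in Rpos) (if t \in Rpos then (`|F u t|)%:E else 0))%E.
      rewrite /patch; have [tP|tN] := boolP (t \in Rpos); last by rewrite integral0.
      have t0 : 0 < t by move: tP; rewrite inE/= in_itv/= andbT.
      have fin : (\int[mu]_(u in Rpos) (`|F u t|)%:E)%E \is a fin_num.
        by apply: integrable_fin_num => //; exact: (integrable_norm (F2 _ t0)).
      by rewrite -(fineK fin) lee_fin; exact: Fg.
    rewrite [RHS]integral_mkcond; apply: eq_integral => u _.
    by rewrite /f /patch in_setX /=; case: (u \in Rpos); case: (t \in Rpos) => //=; rewrite normr0.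
  apply: (@le_lt_trans _ _ (\int[mu]_t ((EFin \o g) \_ Rpos) t)%E).
    apply: ge0_le_integral => //.
    - by move=> t _; apply: integral_ge0.
    - apply: (measurable_fun_fubini_tonelli_G (abse \o f)).
        exact: measurableT_comp.
      by move=> z; exact: abse_ge0.
    - by case/integrableP : ig => m _; exact: ((measurable_restrictT _ mpos).1 m).
  rewrite -integral_mkcond; apply: (@le_lt_trans _ _ (\int[mu]_(t in Rpos) `|(EFin \o g) t|)%E).
    apply: le_integral => //; last by move=> t _; exact: lee_abs.
    exact: integrable_abse.
  by case/integrableP : ig.
split.
  apply/(integrable_mkcond _ mpos).2.
  have := integrable_fubini_F fi; apply: eq_integrable => // u _.
  by rewrite /fubini_F f1.
rewrite /Rintegral; congr fine.
rewrite integral_mkcond [RHS]integral_mkcond.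
transitivity (\int[mu]_u \int[mu]_t f (u, t))%E.
  by apply: eq_integral => u _; rewrite f1.
rewrite (Fubini fi).
by apply: eq_integral => t _; rewrite f2.
Qed.

Lemma Rintegral_laplace (lam x : R) : 0 < lam -> 0 < x ->
  Rintegral mu Rpos (fun t => t `^ (x - 1) * expR (- (lam * t))) = lam `^ (- x) * gam x.
Proof.
move=> l0 x0; apply: (@complexI R).
rewrite rmorphM/= -GammaC_real// -cpowR_real// -cintegral_real rmorphN -laplaceE//.
apply: eq_cintegral => t; rewrite /= in_itv/= andbT => t0.
by rewrite -(rmorph1 (real_complex R)) -rmorphB cpowR_real// -rmorphM.
Qed.

Lemma RintegralZpos (c : R) (f : R -> R) : mu.-integrable Rpos (EFin \o f) ->
  mu.-integrable Rpos (EFin \o (fun t => c * f t)) /\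
  Rintegral mu Rpos (fun t => c * f t) = c * Rintegral mu Rpos f.
Proof.
move=> fi; split; last by rewrite RintegralZl.
rewrite (_ : _ \o _ = fun t => (c%:E * (EFin \o f) t)%E)//.
exact: integrableZl.
Qed.

Lemma Rpos_gt0 (t : R) : Rpos t -> 0 < t. Proof. by rewrite /= in_itv/= andbT. Qed.

Section Component.
Variables (nu : R) (p : R[i]) (P : R[i] -> R).
Hypotheses (nu0 : 0 < nu) (nup : nu < Re p).
Hypothesis Pnormc : forall z, `|P z| <= normc z.
Hypothesis PZr : forall z x, P (z * x%:C) = P z * x.
Hypothesis mP : forall s : R[i], measurable_fun [set: R] (fun u => P (cpowR u s)).
Hypothesis iP : forall f, cinteg Rpos f -> mu.-integrable Rpos (EFin \o (P \o f)).
Hypothesis PcI : forall f, P (cintegral Rpos f) = Rintegral mu Rpos (P \o f).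

Let p0 : 0 < Re p. Proof. exact: lt_trans nup. Qed.

(* Written with [t `^ (- 1)], which is measurable on the whole line. *)
Let F (u t : R) : R :=
  P (cpowR u (p - 1)) * (expR (- t - u * t `^ (- 1)) * t `^ (- nu - 1)).

Let FE u t : 0 < t -> F u t = P (cpowR u (p - 1)) * macdonald_kernel (- nu) u t.
Proof. by move=> t0; rewrite /F powR_inv1// ltW. Qed.

Let FE2 u t : 0 < t -> F u t = (expR (- t) * t `^ (- nu - 1)) *
  P (cpowR u (p - 1) * (expR (- (t^-1 * u)))%:C).
Proof.
move=> t0; rewrite FE// PZr /macdonald_kernel expRD [t^-1 * u]mulrC.
by move: (P _) (expR _) (expR _) (_ `^ _) => a b c d; ring.
Qed.

Let iL t : 0 < t -> cinteg Rpos (fun u => cpowR u (p - 1) * (expR (- (t^-1 * u)))%:C).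
Proof. by move=> t0; have [] := @laplace_cpowR R t^-1 p _ p0; rewrite ?invr_gt0. Qed.

(** [P] stands for [Re] or [Im], Fubini being stated for real functions. Integrating first in u
    gives the Laplace transform of u^(p-1) at 1/t, which is t^p Gamma(p). *)
Lemma mellin_component :
  mu.-integrable Rpos (EFin \o (fun u => P (cpowR u (p - 1)) * macdonald (- nu) u)) /\
  Rintegral mu Rpos (fun u => P (cpowR u (p - 1)) * macdonald (- nu) u) =
  Rintegral mu Rpos (fun t => expR (- t) * t `^ (- nu - 1) * P (cpowR t p * GammaC p)).
Proof.
have mF : measurable_fun [set: T * T] (fun z : T * T => F z.1 z.2).
  apply: measurable_funM.
    exact: (measurableT_comp (mP (p - 1)) measurable_fst).
  apply: measurable_funM.
    apply: (measurableT_comp (@measurable_expR R)).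
    apply: measurable_funB.
      exact: (measurableT_comp (@oppr_measurable R setT) measurable_snd).
    apply: measurable_funM; first exact: measurable_fst.
    exact: (measurableT_comp (measurable_powR (- 1)) measurable_snd).
  exact: (measurableT_comp (measurable_powR (- nu - 1)) measurable_snd).
have eqi (f h : R -> R) : (forall t, 0 < t -> f t = h t) ->
    mu.-integrable Rpos (EFin \o f) -> mu.-integrable Rpos (EFin \o h).
  move=> fh; apply: (@eq_integrable _ T) => // t; rewrite inE => /Rpos_gt0 t0 /=.
  by rewrite fh.
have eqR (f h : R -> R) : (forall t, 0 < t -> f t = h t) ->
    Rintegral mu Rpos f = Rintegral mu Rpos h.
  by move=> fh; apply: eq_Rintegral => t; rewrite inE => /Rpos_gt0; exact: fh.
have F1E u : 0 < u -> mu.-integrable Rpos (EFin \o F u) /\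
    Rintegral mu Rpos (F u) = P (cpowR u (p - 1)) * macdonald (- nu) u.
  move=> u0; have [i e] := RintegralZpos (P (cpowR u (p - 1))) (integrable_kernel (- nu) u0).
  by split; [apply: eqi i => t t0; rewrite FE|rewrite -e; apply: eqR => t t0; rewrite FE].
have F2E t : 0 < t -> mu.-integrable Rpos (EFin \o (fun u => F u t)) /\
    Rintegral mu Rpos (fun u => F u t) =
    expR (- t) * t `^ (- nu - 1) * P (cpowR t p * GammaC p).
  move=> t0; have [i e] := RintegralZpos (expR (- t) * t `^ (- nu - 1)) (iP (iL t0)).
  split; first by apply: eqi i => u u0; rewrite FE2.
  have ti0 : 0 < t^-1 by rewrite invr_gt0.
  have := laplaceE ti0 p0; rewrite cpowRN cpowRV// invrK => <-.
  by rewrite PcI -e; apply: eqR => u u0; rewrite FE2.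
(* The same Laplace transform for moduli, hence at Re p. What remains is t^(Re p - nu - 1) exp(-t),
   integrable because nu < Re p. *)
pose g t := expR (- t) * t `^ (- nu - 1) * (t `^ Re p * gam (Re p)).
have gE t : 0 < t -> g t = gam (Re p) * (t `^ (Re p - nu - 1) * expR (- t)).
  move=> t0; rewrite /g (_ : Re p - nu - 1 = - nu - 1 + Re p); last by ring.
  rewrite [t `^ (_ + Re p)]powRD ?(gt_eqF t0) ?implybT//.
  by move: (expR _) (_ `^ _) (_ `^ _) (gam _) => a b c d; ring.
have pnu : 0 < Re p - nu by rewrite subr_gt0.
have ig : mu.-integrable Rpos (EFin \o g).
  have [i _] := RintegralZpos (gam (Re p)) (integrable_gam pnu).
  by apply: eqi i => t t0; rewrite gE.
have Fg t : 0 < t -> Rintegral mu Rpos (fun u => `|F u t|) <= g t.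
  move=> t0; have ti0 : 0 < t^-1 by rewrite invr_gt0.
  have [i e] := RintegralZpos (expR (- t) * t `^ (- nu - 1)) (integrable_gamma p0 ti0).
  rewrite /g; have -> : t `^ Re p * gam (Re p) = t^-1 `^ (- Re p) * gam (Re p).
    by rewrite -powR_inv1 ?(ltW t0)// -powRrM mulN1r opprK.
  rewrite -Rintegral_laplace// -e; apply: le_Rintegral => //.
  - exact: (integrable_norm (F2E _ t0).1).
  - move=> u /Rpos_gt0 u0; rewrite FE2// normrM ger0_norm ?mulr_ge0 ?expR_ge0 ?powR_ge0//.
    rewrite ler_wpM2l ?mulr_ge0 ?expR_ge0 ?powR_ge0// (le_trans (Pnormc _))//.
    rewrite Normc.normcM normc_cpowR// normc_real ger0_norm ?expR_ge0//.
    by rewrite ReD ReN.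
have [i e] := fubini_pos mF (fun u u0 => (F1E u u0).1) (fun t t0 => (F2E t t0).1) ig Fg.
split; first by apply: eqi i => u u0; rewrite (F1E u u0).2.
rewrite (eqR _ _ (fun u u0 => esym (F1E u u0).2)) e.
by apply: eqR => t t0; rewrite (F2E t t0).2.
Qed.

End Component.

Lemma mellin_macdonald (nu : R) (p : R[i]) : 0 < nu -> nu < Re p ->
  let f := fun u => cpowR u (p - 1) * (macdonald (- nu) u)%:C in
  cinteg Rpos f /\ cintegral Rpos f = GammaC p * GammaC (p - nu%:C).
Proof.
move=> nu0 nup f.
have mRe (s : R[i]) : measurable_fun [set: R] (fun u => Re (cpowR u s)).
  by have [] := @cmeasurable_cpowR R setT s.
have mIm (s : R[i]) : measurable_fun [set: R] (fun u => Im (cpowR u s)).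
  by have [] := @cmeasurable_cpowR R setT s.
have [ir er] := @mellin_component nu p (@complex.Re R) nu0 nup (@Re_le_normc R)
  (@ReZr R) mRe (fun f => @proj1 _ _) (fun f => erefl).
have [ii ei] := @mellin_component nu p (@complex.Im R) nu0 nup (@Im_le_normc R)
  (@ImZr R) mIm (fun f => @proj2 _ _) (fun f => erefl).
have fR : Re \o f = fun u => Re (cpowR u (p - 1)) * macdonald (- nu) u.
  by apply/funext => u; exact: ReZr.
have fI : Im \o f = fun u => Im (cpowR u (p - 1)) * macdonald (- nu) u.
  by apply/funext => u; exact: ImZr.
split; first by split; [move: ir; rewrite -fR|move: ii; rewrite -fI].
have pnu : 0 < Re (p - nu%:C) by rewrite ReD ReN subr_gt0.
rewrite {2}/GammaC -cintegralZ//; last exact: cinteg_GammaC.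
transitivity (cintegral Rpos (fun t => cpowR t p * GammaC p *
   (expR (- t) * t `^ (- nu - 1))%:C)).
  apply: complex_ext.
    change (Rintegral mu Rpos (Re \o f) = Rintegral mu Rpos (fun t =>
      Re (cpowR t p * GammaC p * (expR (- t) * t `^ (- nu - 1))%:C))).
    by rewrite fR er; apply: eq_Rintegral => t _; rewrite ReZr mulrC.
  change (Rintegral mu Rpos (Im \o f) = Rintegral mu Rpos (fun t =>
    Im (cpowR t p * GammaC p * (expR (- t) * t `^ (- nu - 1))%:C))).
  by rewrite fI ei; apply: eq_Rintegral => t _; rewrite ImZr mulrC.
apply: eq_cintegral => t; rewrite /= in_itv/= andbT => t0.
rewrite [(_ * _)%:C]rmorphM/= -cpowR_real//.
have -> : cpowR t (p - nu%:C - 1) = cpowR t p * cpowR t (- nu - 1)%:C.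
  by rewrite -cpowRD rmorphB rmorphN rmorph1 addrA.
by move: (cpowR t p) (cpowR t _) (GammaC p) (_%:C) => a b c d; ring.
Qed.

End Mellin.

(** * Termwise integration of series *)

Section SeriesIntegral.
Variable R : realType.
Local Notation mu := (@lebesgue_measure R).
Local Notation T := (measurableTypeR R).

Lemma Re_series (u : nat -> R[i]) n : Re (series u n) = series (Re \o u) n.
Proof. by rewrite /series/=; elim/big_rec2: _ => // k x y _ <-; rewrite ReD. Qed.
Lemma Im_series (u : nat -> R[i]) n : Im (series u n) = series (Im \o u) n.
Proof. by rewrite /series/=; elim/big_rec2: _ => // k x y _ <-; rewrite ImD. Qed.

(** [w] keeps the terms of [u] below [N], so that v + w dominates from the start and only finitely
    many terms are added. *)
Lemma series_le_cvg_near (N : nat) (u v : R^nat) :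
  (forall k, 0 <= u k) -> (forall k, 0 <= v k) ->
  (forall k, (N <= k)%N -> u k <= v k) -> cvgn (series v) -> cvgn (series u).
Proof.
move=> u0 v0 uv cv; pose w k := if (k < N)%N then u k else 0.
have cw : cvgn (series w).
  rewrite -(is_cvg_series_restrict N); apply/cvg_ex; exists 0.
  rewrite (_ : (fun n => _) = fun=> 0); first exact: cvg_cst.
  apply/funext => n; rewrite big_nat_cond big1// => k /andP[/andP[Nk _] _].
  by rewrite /w ltnNge Nk.
apply: (@series_le_cvg _ _ (v + w)) => //.
- by move=> k; rewrite addr_ge0// /w; case: ifP.
- move=> k; rewrite /w !fctE; case: ltnP => kN; first by rewrite lerDr.
  by rewrite addr0 uv.
- by rewrite seriesD; exact: is_cvgD.
Qed.

Lemma cvg_series_normc (u : nat -> R[i]) : cvgn (series (normc \o u)) ->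
  exists l : R[i]^o, (series u : nat -> R[i]^o) @ \oo --> l.
Proof.
move=> cu; have H (P : R[i] -> R) : (forall z, `|P z| <= normc z) -> cvgn (series (P \o u)).
  move=> PN; apply: normed_cvg; apply: series_le_cvg cu => k /=.
  - exact: normr_ge0.
  - exact: normc_ge0.
  - exact: PN.
have cr := H _ (@Re_le_normc R); have ci := H _ (@Im_le_normc R).
exists (limn (series (Re \o u)) +i* limn (series (Im \o u))).
apply/cvg_complexP; split => /=.
  by rewrite (_ : _ \o _ = series (Re \o u)) //; apply/funext => n; exact: Re_series.
by rewrite (_ : _ \o _ = series (Im \o u)) //; apply/funext => n; exact: Im_series.
Qed.

(** Monotone convergence of the partial sums: the integral of the sum is the sum of the integrals,
    which is finite. *)
Lemma integrable_series (D : set R) (h : nat -> R -> R) : measurable D ->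
  (forall k, mu.-integrable D (EFin \o h k)) ->
  (forall k x, D x -> 0 <= h k x) ->
  (forall x, D x -> cvgn (series (h ^~ x))) ->
  cvgn (series (fun k => Rintegral mu D (h k))) ->
  mu.-integrable D (EFin \o (fun x => limn (series (h ^~ x)))).
Proof.
move=> mD ih h0 ch cI.
have ms n : measurable_fun D (fun x => series (h ^~ x) n).
  rewrite /series/=; apply: measurable_sum => k.
  by case/integrableP : (ih k) => /measurable_EFinP.
have isn n : mu.-integrable D (EFin \o (fun x => series (h ^~ x) n)) /\
    Rintegral mu D (fun x => series (h ^~ x) n) = series (fun k => Rintegral mu D (h k)) n.
  elim: n => [|n [IH1 IH2]].
    split.
      rewrite (_ : _ \o _ = cst 0%E); first exact: integrable0.
      by apply/funext => x /=; rewrite /series/= big_geq.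
    rewrite [RHS]/series/= big_geq// (_ : (fun x => _) = cst 0).
      by rewrite /Rintegral integral0.
    by apply/funext => x /=; rewrite /series/= big_geq.
  have E : (fun x => series (h ^~ x) n.+1) = (fun x => series (h ^~ x) n + h n x).
    by apply/funext => x; rewrite seriesSr.
  split.
    rewrite E (_ : _ \o _ = ((EFin \o (fun x => series (h ^~ x) n)) \+ (EFin \o h n))%E)//.
    exact: integrableD.
  by rewrite E RintegralD// IH2 seriesSr.
have cl x : D x -> series (h ^~ x) n @[n --> \oo] --> limn (series (h ^~ x)) by move/ch.
have ml : measurable_fun D (fun x => limn (series (h ^~ x))).
  exact: (measurable_fun_cvg ms cl).
apply/integrableP; split; first exact: measurable_EFinR.
have E x : D x -> ((EFin \o (fun x => limn (series (h ^~ x)))) x =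
    limn (fun n => (series (h ^~ x) n)%:E))%E.
  by move=> Dx; apply/esym/cvg_lim => //; apply: cvg_EFin; [exact: nearW|exact: cl].
have l0 x : D x -> 0 <= limn (series (h ^~ x)).
  move=> Dx; apply: limr_ge; first exact: ch.
  by apply: nearW => n; rewrite /series/= sumr_ge0// => k _; exact: h0.
have -> : (\int[mu]_(x in D) `|(EFin \o (fun x => limn (series (h ^~ x)))) x| =
    \int[mu]_(x in D) limn (fun n => (series (h ^~ x) n)%:E))%E.
  by apply: eq_integral => x; rewrite inE => Dx; rewrite -E//= ger0_norm// l0.
have c1 := @cvg_monotone_convergence _ T R mu D mD (fun n x => (series (h ^~ x) n)%:E).
have {}c1 : (\int[mu]_(x in D) (series (h ^~ x) n)%:E)%E @[n --> \oo] -->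
   (\int[mu]_(x in D) limn (fun n => (series (h ^~ x) n)%:E))%E.
  apply: c1.
  - by move=> n; exact: measurable_EFinR.
  - by move=> n x Dx; rewrite lee_fin /series/= sumr_ge0// => k _; exact: h0.
  - move=> x Dx m n mn; rewrite lee_fin.
    rewrite -subr_ge0 sub_series_geq// sumr_ge0// => k _; exact: h0.
have c2 : (\int[mu]_(x in D) (series (h ^~ x) n)%:E)%E @[n --> \oo] -->
   (limn (series (fun k => Rintegral mu D (h k))))%:E.
  apply: cvg_EFin; first by apply: nearW => n; apply: integrable_fin_num => //; exact: (isn n).1.
  by rewrite (_ : _ \o _ = series (fun k => Rintegral mu D (h k)))//;
     apply/funext => n; rewrite -(isn n).2.
rewrite -(cvg_lim (@ereal_hausdorff R) c1) (cvg_lim (@ereal_hausdorff R) c2).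
exact: ltry.
Qed.

(** The sum of the moduli dominates all partial sums at once and is integrable by
    [integrable_series]. *)
Lemma cintegral_series (D : set R) (F : nat -> R -> R[i]) (S : R -> R[i]) :
  measurable D -> (forall k, cinteg D (F k)) ->
  (forall x, D x -> cvgn (series (fun k => normc (F k x)))) ->
  (forall x, D x -> (series (F ^~ x) : nat -> R[i]^o) @ \oo --> (S x : R[i]^o)) ->
  cvgn (series (fun k => Rintegral mu D (normc \o F k))) ->
  cinteg D S /\
  (series (fun k => cintegral D (F k)) : nat -> R[i]^o) @ \oo --> (cintegral D S : R[i]^o).
Proof.
move=> mD iF cF cS cI; pose g x := limn (series (fun k => normc (F k x))).
have ig : mu.-integrable D (EFin \o g).
  apply: (@integrable_series D (fun k x => normc (F k x))) => //.
  - by move=> k; exact: cintegrable_normc.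
  - by move=> k x _; exact: normc_ge0.
have sF n := cintegral_sum n mD iF.
have mSn n : cmeasurable D (fun x => series (F ^~ x) n).
  by apply: cintegrable_cmeasurable; exact: (sF n).1.
have mS : cmeasurable D S.
  split.
    apply: (measurable_fun_cvg (fun n => (mSn n).1)) => x Dx.
    by have /cvg_complexP[] := cS x Dx.
  apply: (measurable_fun_cvg (fun n => (mSn n).2)) => x Dx.
  by have /cvg_complexP[] := cS x Dx.
have gF n x : D x -> normc (series (F ^~ x) n) <= g x.
  move=> Dx; rewrite /series/= (le_trans (normc_sum _ _ _))//.
  have nd : nondecreasing_seq (series (fun k => normc (F k x))).
    by apply: nondecreasing_series => k _ _; exact: normc_ge0.
  exact: (nondecreasing_cvgn_le nd (cF x Dx) n).
have [i c] := cintegral_cvg mD mSn mS cS ig gF.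
split=> //; apply: eq_cvgC c => n.
by rewrite (sF n).2.
Qed.

End SeriesIntegral.

(** * Decay of 1/Gamma along q + a k and convergence of the Mittag-Leffler series *)

Section Growth.
Variable R : realType.
Implicit Types (a q w : R[i]).

Lemma eventually_ge (x0 al c : R) : 0 < al ->
  exists N : nat, forall k, (N <= k)%N -> c <= x0 + k%:R * al.
Proof.
move=> al0; exists (Num.truncn ((c - x0) / al)).+1 => k Nk.
rewrite -lerBlDl -ler_pdivrMr// ltW// (lt_le_trans (truncnS_gt _))//.
by rewrite ler_nat.
Qed.

Lemma rg_series_cvg (r x0 al : R) : 0 <= r -> 0 < al ->
  cvgn (series (fun k => r ^+ k * `|rg (x0 + k%:R * al)|)).
Proof.
move=> r0 al0; have [N HN] := eventually_ge x0 1 al0.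
(* [D] exceeds [r], and taking t = D^(1/al) in [rg_le_powR] turns t^(-k al) into D^(-k): the
   majorant is geometric of ratio r/D. *)
pose D := 2 * r + 1; have D0 : 0 < D by rewrite ltr_wpDl ?mulr_ge0.
pose t := D `^ al^-1; have t0 : 0 < t by rewrite powR_gt0.
have tal : t `^ al = D by rewrite -powRrM mulVf ?gt_eqF// powRr1// ltW.
pose C := expR (t + 1) * t `^ (1 - x0).
apply: (@series_le_cvg_near _ N _ (geometric C (r / D))).
- by move=> k; rewrite mulr_ge0// exprn_ge0.
- by move=> k; rewrite /geometric/= !mulr_ge0 ?expR_ge0 ?powR_ge0// exprn_ge0// divr_ge0// ltW.
- move=> k /HN h1; have h0 : 0 < x0 + k%:R * al by exact: lt_le_trans h1.
  rewrite ger0_norm ?(ltW (rg_gt0 h0))// /geometric/= expr_div_n.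
  apply: (le_trans (ler_wpM2l (exprn_ge0 _ r0) (rg_le_powR h1 t0))).
  have -> : 1 - (x0 + k%:R * al) = (1 - x0) - al * k%:R by ring.
  rewrite powRB ?(gt_eqF t0) ?implybT// powRrM tal powR_mulrn ?(ltW D0)//.
  rewrite /C le_eqVlt; apply/orP; left; apply/eqP.
  by move: (expR _) (t `^ _) (r ^+ k) (D ^+ k)^-1 => x y z v; ring.
- apply: is_cvg_geometric_series; rewrite ger0_norm ?divr_ge0 ?(ltW D0)//.
  by rewrite ltr_pdivrMr// mul1r /D; lra.
Qed.

(* The imaginary part of q + a k is at most a constant times k, hence costs only
   a geometric factor in 1 / Gamma. *)
Lemma rGamma_growth q a : 0 < Re a -> exists (N : nat) (K : R), 0 <= K /\
  forall k, (N <= k)%N -> 0 < Re q + k%:R * Re a /\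
    normc (rGamma (q + a * k%:R)) <= K ^+ k * rg (Re q + k%:R * Re a).
Proof.
move=> a0; have [N1 H1] := eventually_ge (Re q) 1 a0.
have a20 : 0 < Re a / 2 by rewrite divr_gt0.
have [N2 H2] := eventually_ge (Re q) 0 a20.
pose m := `|Im q| + `|Im a|.
(* With x and y the real and imaginary parts of q + a k, one has |y| <= k m for k >= 1 (hence the
   successor), x >= k Re a / 2 past [N2] and x >= 1 past [N1]. So (y^2/2)(1/x^2 + 1/x) <= y^2/x <= k
   (2 m^2 / Re a). *)
exists (maxn N1 N2).+1, (expR (2 * m ^+ 2 / Re a)); split; first exact: expR_ge0.
move=> k kN; have k1 : (N1 <= k)%N by rewrite (leq_trans (leq_maxl _ _) (ltnW kN)).
have k2 : (N2 <= k)%N by rewrite (leq_trans (leq_maxr _ _) (ltnW kN)).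
have kR1 : 1 <= k%:R :> R by rewrite ler1n (leq_trans _ kN).
have x1 := H1 _ k1; have x2 := H2 _ k2.
have ReE : Re (q + a * k%:R) = Re q + k%:R * Re a.
  by rewrite ReD natC ReZr mulrC.
have ImE : Im (q + a * k%:R) = Im q + k%:R * Im a.
  by rewrite ImD natC ImZr mulrC.
have x0 : 0 < Re q + k%:R * Re a by exact: lt_le_trans x1.
split=> //; rewrite -ReE; apply: (le_trans (normc_rGamma_le _)); first by rewrite ReE.
rewrite ler_wpM2r ?(ltW (rg_gt0 _)) ?ReE// ImE /phase_bound -expRM_natl ler_expR.
move: x0 x1 x2; set x := Re q + k%:R * Re a; set y := Im q + _ => x0 x1 x2.
have xk : k%:R * Re a / 2 <= x.
  by move: x2; rewrite /x; lra.
have yk : y ^+ 2 <= (k%:R * m) ^+ 2.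
  rewrite -[y ^+ 2]real_normK ?num_real// ler_pXn2r ?nnegrE ?mulr_ge0 ?addr_ge0//.
  rewrite /y /m mulrDr (le_trans (ler_normD _ _))// lerD//.
    by rewrite ler_peMl.
  by rewrite normrM ger0_norm.
have ix : x^-1 ^+ 2 <= x^-1.
  by rewrite expr2 ler_piMl ?invr_ge0 ?(ltW x0)// invf_le1.
apply: (@le_trans _ _ (y ^+ 2 / x)).
  rewrite -mulrA ler_wpM2l ?sqr_ge0//.
  by move: ix; lra.
have ka0 : 0 < k%:R * Re a / 2 by rewrite divr_gt0// mulr_gt0// (lt_le_trans _ kR1).
apply: (@le_trans _ _ ((k%:R * m) ^+ 2 / (k%:R * Re a / 2))).
  by apply: ler_pM => //; rewrite ?sqr_ge0 ?invr_ge0 ?(ltW x0)// lef_pV2 ?posrE.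
rewrite le_eqVlt; apply/orP; left; apply/eqP.
by field; rewrite !gt_eqF// (lt_le_trans _ kR1).
Qed.

Lemma rGamma_series_cvg q a (r : R) : 0 <= r -> 0 < Re a ->
  cvgn (series (fun k => r ^+ k * normc (rGamma (q + a * k%:R)))).
Proof.
move=> r0 a0; have [N [K [K0 HN]]] := rGamma_growth q a0.
apply: (@series_le_cvg_near _ N _ (fun k => (r * K) ^+ k * `|rg (Re q + k%:R * Re a)|)).
- by move=> k; rewrite mulr_ge0 ?exprn_ge0 ?normc_ge0.
- by move=> k; rewrite mulr_ge0 ?exprn_ge0 ?mulr_ge0.
- move=> k /HN[x0 h]; rewrite exprMn -mulrA ler_wpM2l ?exprn_ge0//.
  by rewrite ger0_norm// ltW// rg_gt0.
- by apply: rg_series_cvg => //; rewrite mulr_ge0.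
Qed.

Lemma MittagLeffler_cvg a q w : 0 < Re a ->
  cvgn (series (fun k => normc (w ^+ k * rGamma (q + a * k%:R)))) /\
  (series (fun k => w ^+ k * rGamma (q + a * k%:R)) : nat -> R[i]^o) @ \oo -->
    (MittagLeffler a q w : R[i]^o).
Proof.
move=> a0; have cn : cvgn (series (fun k => normc (w ^+ k * rGamma (q + a * k%:R)))).
  rewrite (_ : (fun k => _) = fun k => normc w ^+ k * normc (rGamma (q + a * k%:R))).
    by apply: rGamma_series_cvg => //; exact: normc_ge0.
  by apply/funext => k; rewrite Normc.normcM normcX.
split=> //; have [l cl] := @cvg_series_normc R (fun k => w ^+ k * rGamma (q + a * k%:R)) cn.
by rewrite /MittagLeffler (cvgC_lim cl).
Qed.

End Growth.

(** * The case nu = 1/3: constants, triplication, and the integral identities *)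

Section BesselTransform.
Variable R : realType.
Local Notation mu := (@lebesgue_measure R).
Local Notation Rpos := (`]0%R, +oo[%classic : set R).
Implicit Types (a b p q e s w z : R[i]).

Let nu : R := 3^-1.
Let M := @macdonald R (- nu).

Lemma third_real : 3^-1 = nu%:C :> R[i].
Proof. by rewrite /nu fmorphV /= -natC. Qed.

(** [M] is nonnegative, so the modulus of the integrand is the same integrand at the real parameter
    Re p. *)
Lemma Rmellin_macdonald p : nu < Re p ->
  Rintegral mu Rpos (normc \o (fun u => cpowR u (p - 1) * (M u)%:C)) =
  gam (Re p) * gam (Re p - nu).
Proof.
move=> pnu; have nu0 : 0 < nu by rewrite invr_gt0.
have p0 : 0 < Re p by exact: lt_trans pnu.
apply: (@complexI R); rewrite rmorphM/= -!GammaC_real ?subr_gt0// rmorphB.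
have [_ <-] := @mellin_macdonald R nu (Re p)%:C nu0 pnu.
rewrite -cintegral_real; apply: eq_cintegral => u /Rpos_gt0 u0.
have M0 : 0 <= M u by apply: Rintegral_ge0 => t _; exact: kernel_ge0.
rewrite /= Normc.normcM normc_cpowR// normc_real ger0_norm// ReD ReN /=.
by rewrite -(rmorph1 (real_complex R)) -rmorphB cpowR_real// rmorphM.
Qed.

(* What the triplication formula gives for the k-th term, with s = a k. *)
Definition triple_rel b p q e := forall s, 0 <= Re s ->
  rGamma (q + 3 * s) * (GammaC (p + s) * GammaC (p + s - 3^-1)) =
  e * cpowR 3 (- (3 * s)) * rGamma (b + s).

Let r : R[i] := rGamma 3^-1 * rGamma (2 / 3).

Let r_neq0 : r != 0.
Proof.
rewrite mulf_neq0// rGamma_neq0//; first by rewrite third_real /= invr_gt0.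
by rewrite (natC R 2) third_real -rmorphM /= divr_gt0.
Qed.

Lemma two_thirds_real : 2 / 3 = (2 / 3 : R)%:C :> R[i].
Proof. by rewrite (natC R 2) third_real -rmorphM. Qed.

(** With w = b + s the two Gammas sit at w + 2/3 and w + 1/3: they cancel two of the three factors
    in the triplication formula and leave 1/Gamma(b + s). *)
Lemma triple_rel_first b : - 3^-1 < Re b ->
  triple_rel b (b + 2 / 3) (3 * b) (3 / r * cpowR 3 (- (3 * b))).
Proof.
move=> hb s s0; pose w := b + s.
have -> : 3 * b + 3 * s = 3 * w by rewrite mulrDr.
have -> : b + 2 / 3 + s = w + 2 / 3 by rewrite addrAC.
have -> : w + 2 / 3 - 3^-1 = w + 3^-1 by field.
have w1 : 0 < Re (w + 3^-1).
  by rewrite third_real !ReD /= /nu; move: hb s0; lra.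
have w2 : 0 < Re (w + 2 / 3).
  by rewrite two_thirds_real !ReD /=; move: hb s0; lra.
have g1 : GammaC (w + 3^-1) = (rGamma (w + 3^-1))^-1 by rewrite rGamma_GammaC// invrK.
have g2 : GammaC (w + 2 / 3) = (rGamma (w + 2 / 3))^-1 by rewrite rGamma_GammaC// invrK.
have n1 := rGamma_neq0 w1; have n2 := rGamma_neq0 w2.
have c0 : cpowR 3 (3 * w) != 0 :> R[i] by exact: cpowR_neq0.
have -> : 3 / r * cpowR 3 (- (3 * b)) * cpowR 3 (- (3 * s)) = 3 / r / cpowR 3 (3 * w).
  by rewrite -mulrA -cpowRD -opprD -mulrDr cpowRN.
have := rGamma_triplication w; rewrite -/r g1 g2.
move: n1 n2 c0 r_neq0 (rGamma (3 * w)) (rGamma w).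
move: (rGamma (w + 3^-1)) (rGamma (w + 2 / 3)) (cpowR 3 (3 * w)) r => x y c r0.
move=> x0 y0 c0 r00 X W E.
have -> : W = r0 / 3 * c * X / (x * y).
  by rewrite -E; field; rewrite x0 y0.
by field; rewrite x0 y0 c0 r00.
Qed.

(** With w = b - 2/3 + s the two Gammas sit at w + 1/3 and w, and the surviving factor is at w + 2/3
    = b + s. The range of b makes Re w positive, where 1/Gamma inverts Euler's integral. *)
Lemma triple_rel_second b : 2 / 3 < Re b ->
  triple_rel b (b - 3^-1) (3 * b - 2) (3 / r * cpowR 3 (- (3 * b - 2))).
Proof.
move=> hb s s0; pose w := b - 2 / 3 + s.
have -> : 3 * b - 2 + 3 * s = 3 * w by rewrite /w; field.
have -> : b - 3^-1 + s = w + 3^-1 by rewrite /w; field.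
have -> : b + s = w + 2 / 3 by rewrite /w; field.
have -> : w + 3^-1 - 3^-1 = w by rewrite addrK.
have w0 : 0 < Re w.
  by rewrite /w two_thirds_real !ReD ReN /=; move: hb s0; lra.
have w1 : 0 < Re (w + 3^-1) by rewrite third_real ReD /= addr_gt0// invr_gt0.
have g1 : GammaC (w + 3^-1) = (rGamma (w + 3^-1))^-1 by rewrite rGamma_GammaC// invrK.
have g2 : GammaC w = (rGamma w)^-1 by rewrite rGamma_GammaC// invrK.
have n1 := rGamma_neq0 w1; have n2 := rGamma_neq0 w0.
have c0 : cpowR 3 (3 * w) != 0 :> R[i] by exact: cpowR_neq0.
have -> : 3 / r * cpowR 3 (- (3 * b - 2)) * cpowR 3 (- (3 * s)) = 3 / r / cpowR 3 (3 * w).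
  by rewrite -mulrA -cpowRD -opprD cpowRN; congr (_ / cpowR _ _); rewrite /w; field.
have := rGamma_triplication w; rewrite -/r g1 g2.
move: n1 n2 c0 r_neq0 (rGamma (3 * w)) (rGamma (w + 2 / 3)).
move: (rGamma (w + 3^-1)) (rGamma w) (cpowR 3 (3 * w)) r => x y c r0.
move=> x0 y0 c0 r00 X W E.
have -> : W = r0 / 3 * c * X / (x * y).
  by rewrite -E; field; rewrite x0 y0.
by field; rewrite x0 y0 c0 r00.
Qed.

Lemma sin_pi3 : sin (pi / 3) = Num.sqrt 3 / 2 :> R.
Proof.
pose t : R := pi / 3; have t0 : 0 < sin t.
  apply: sin_gt0_pi; rewrite /t divr_gt0 ?pi_gt0//= ltr_pdivrMr// ltr_pMr ?pi_gt0//.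
  by rewrite ltr1n.
(* sin(3t) = sin t (3 - 4 sin^2 t) vanishes at t = pi/3 while sin t > 0, so sin^2 t = 3/4. *)
have : sin (t + t + t) = 0 by rewrite /t (_ : _ + _ = pi) ?sinpi//; field.
rewrite !sinD cosD => h.
have c2 := cos2Dsin2 t.
have h3 : sin t * (3 - 4 * sin t ^+ 2) = 0.
  transitivity ((sin t * cos t + cos t * sin t) * cos t +
      (cos t * cos t - sin t * sin t) * sin t -
      3 * sin t * (cos t ^+ 2 + sin t ^+ 2 - 1)); first by ring.
  by rewrite h c2; ring.
have {}h3 : sin t ^+ 2 = 3 / 4.
  move/eqP : h3; rewrite mulf_eq0 gt_eqF//= subr_eq0 => /eqP h3.
  by apply: (mulfI (_ : 4 != 0)) => //; rewrite -h3; field.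
apply/eqP; rewrite -(eqrXn2 (n := 2)) ?(ltW t0) ?divr_ge0 ?sqrtr_ge0//.
by rewrite h3 expr_div_n sqr_sqrtr//; apply/eqP; field.
Qed.

Lemma csin_real (x : R) : csin x%:C = (sin x)%:C.
Proof.
rewrite /csin; have i2 : 2 * 'i != 0 :> R[i].
  by rewrite mulf_neq0 ?natC_neq0// eq_complex/= oner_eq0 andbF.
apply: (mulIf i2); rewrite mulfVK//.
apply: complex_ext.
  rewrite ReD ReN !Re_cexp ReN ImN !ReM !ImM /=.
  rewrite !(mul0r, mulr0, mul1r, subr0, addr0, add0r, oppr0, expR0) cosN.
  by ring.
rewrite ImD ImN !Im_cexp ReN ImN !ReM !ImM /=.
rewrite !(mul0r, mulr0, mul1r, subr0, addr0, add0r, oppr0, expR0) sinN.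
by ring.
Qed.

(* The factor r cancels against the one of the triplication formula, so that no
   reflection formula is needed. *)
Let kappa : R[i] := pi%:C / (2 * csin (pi%:C * nu%:C)) * r.

Lemma kappaE : kappa = pi%:C / cpowR 3 2^-1 * r.
Proof.
rewrite /kappa -rmorphM csin_real sin_pi3; congr (_ / _ * _).
have -> : 2^-1 = (2^-1 : R)%:C :> R[i] by rewrite fmorphV /= -natC.
rewrite cpowR_real// powR12_sqrt// (natC R 2) -rmorphM; congr (_%:C).
by rewrite mulrC divfK.
Qed.

(** The factor u^(nu/2) = u^(1/6) in front of Macdonald's integral accounts for the passage from p -
    7/6 to p - 1. *)
Lemma besselK_third (u : R) (p : R[i]) : 0 < u ->
  besselK 3^-1 (2 * Num.sqrt u) * cpowR u (p - 7 / 6) =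
  kappa * (cpowR u (p - 1) * (M u)%:C).
Proof.
move=> u0; have nu01 : 0 < nu < 1 by rewrite /nu; apply/andP; split; lra.
rewrite third_real besselK_macdonald//.
rewrite rmorphM/=.
have -> : (rg nu * rg (1 - nu))%:C = r.
  have e : 1 - nu = 2 / 3 by rewrite /nu; lra.
  by rewrite rmorphM/= -!rGamma_real e -two_thirds_real -third_real.
rewrite rmorphM/= -cpowR_real//.
have -> : cpowR u (p - 1) = cpowR u (nu / 2)%:C * cpowR u (p - 7 / 6).
  have -> : (nu / 2)%:C = 3^-1 / 2 :> R[i] by rewrite rmorphM /= -third_real fmorphV /= -natC.
  by rewrite -cpowRD; congr (cpowR _ _); field.
rewrite /kappa; move: (pi%:C / _) r (cpowR u _) (cpowR u _) ((macdonald _ _)%:C).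
by move=> x y c d m; ring.
Qed.

Lemma bessel_transform a b p q z e e' : 0 < Re a -> nu < Re p ->
  triple_rel b p q e -> triple_rel (Re b)%:C (Re p)%:C (Re q)%:C e' ->
  let f := fun u => besselK 3^-1 (2 * Num.sqrt u) * cpowR u (p - 7 / 6) *
    MittagLeffler (3 * a) q (cpowR 3 (3 * a) * cpowR u a * z) in
  cinteg Rpos f /\ kappa * e * MittagLeffler a b z = cintegral Rpos f.
Proof.
move=> a0 pnu He He' f.
have BK u : 0 < u -> _ := @besselK_third u p.
move: kappa BK => kap BK.
have [c3 c3E] : exists c3, c3 = cpowR (3 : R) (3 * a) by eexists.
have nu0 : 0 < nu by rewrite invr_gt0.
pose A k := kap * ((c3 * z) ^+ k * rGamma (q + 3 * a * k%:R)).
pose F k u := A k * (cpowR u (p + a * k%:R - 1) * (M u)%:C).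
have Re_ak (k : nat) : Re (a * k%:R) = k%:R * Re a by rewrite natC ReZr mulrC.
have ak0 (k : nat) : 0 <= Re (a * k%:R) by rewrite Re_ak mulr_ge0// ltW.
have pk (k : nat) : nu < Re (p + a * k%:R) by rewrite ReD ltr_wpDr.
have pk0 (k : nat) : 0 < Re (p + a * k%:R) by exact: lt_trans (pk k).
have mel k := mellin_macdonald nu0 (pk k).
have iF k : cinteg Rpos (F k) by apply: cintegrableZ => //; exact: (mel k).1.
have IF k : cintegral Rpos (F k) = kap * e * (z ^+ k * rGamma (b + a * k%:R)).
  rewrite /F cintegralZ//; last exact: (mel k).1.
  rewrite (mel k).2 -third_real /A.
  have := He _ (ak0 k); rewrite (mulrA 3 a).
  (* The scaling 3^(3a) of the Mittag-Leffler argument is there to cancel the 3^(-3ak) of the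
     triplication formula. *)
  have : c3 ^+ k * cpowR 3 (- (3 * (a * k%:R))) = 1.
    by rewrite c3E cpowRX -(mulrA 3 a) cpowRN divff// cpowR_neq0.
  rewrite exprMn -(mulrA 3 a).
  move: (z ^+ k) (c3 ^+ k) (cpowR _ _) (rGamma (b + _)) (rGamma _) (GammaC _ * GammaC _).
  move=> zk x y g h G xy hG.
  transitivity (kap * (x * zk) * (h * G)); first by ring.
  by rewrite hG; transitivity (x * y * (kap * e * (zk * g))); [ring|rewrite xy mul1r].
have a30 : 0 < Re (3 * a) by rewrite natC mulrC ReZr mulr_gt0.
pose w u := c3 * cpowR u a * z.
have FE u k : 0 < u -> F k u = kap * (cpowR u (p - 1) * (M u)%:C) *
    (w u ^+ k * rGamma (q + 3 * a * k%:R)).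
  move=> u0; rewrite /F /A /w addrAC [cpowR u (_ + a * _)]cpowRD -cpowRX !exprMn.
  move: (c3 ^+ k) (z ^+ k) (rGamma _) (cpowR u _) (cpowR u a ^+ k) ((M u)%:C).
  by move=> x y g c d m; ring.
have ML u := @MittagLeffler_cvg R (3 * a) q (w u) a30.
have fE u : 0 < u -> f u = kap * (cpowR u (p - 1) * (M u)%:C) * MittagLeffler (3 * a) q (w u).
  by move=> u0; rewrite /f /w c3E BK.
have [N [K [K0 HN]]] := @rGamma_growth R q (3 * a) a30.
pose D := normc kap * normc e'.
(* The integral of |F k| is |A k| times the two Gammas at real arguments. [rGamma_growth] replaces
   the reciprocal Gamma inside |A k| by K^k times its value at the real part, and the relation [He']
   collapses the three Gamma values into |1/Gamma(Re b + k Re a)|. *)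
have cI : cvgn (series (fun k => Rintegral mu Rpos (normc \o F k))).
  have E k : Rintegral mu Rpos (normc \o F k) =
      normc (A k) * (gam (Re (p + a * k%:R)) * gam (Re (p + a * k%:R) - nu)).
    rewrite -Rmellin_macdonald// -RintegralZl//; last first.
      exact: (cintegrable_normc _ (mel k).1).
    by apply: eq_Rintegral => u _; rewrite /F /= Normc.normcM.
  apply: (@series_le_cvg_near R N _
    (D *: (fun k => (normc z * K) ^+ k * `|rg (Re b + k%:R * Re a)|))).
  - by move=> k; apply: Rintegral_ge0 => u _; exact: normc_ge0.
  - by move=> k; apply: mulr_ge0; rewrite mulr_ge0 ?exprn_ge0 ?mulr_ge0 ?normc_ge0.
  - move=> k /HN[q0 gr]; rewrite E.
    have nA : normc (A k) = normc kap * ((3 `^ (3 * Re a)) ^+ k * normc z ^+ k *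
        normc (rGamma (q + 3 * a * k%:R))).
      rewrite /A !Normc.normcM normcX Normc.normcM exprMn c3E normc_cpowR//.
      by rewrite natC [_%:C * a]mulrC ReZr [_ * 3]mulrC.
    rewrite nA; clear nA.
    have pr0 : 0 < Re (p + a * k%:R) - nu by rewrite subr_gt0.
    have Rk0 : 0 <= Re (Re (a * k%:R))%:C by exact: ak0.
    have := congr1 normc (He' (Re (a * k%:R))%:C Rk0).
    have -> : (Re q)%:C + 3 * (Re (a * k%:R))%:C = (Re q + k%:R * Re (3 * a))%:C.
      have -> : Re (3 * a) = 3 * Re a by rewrite natC mulrC ReZr mulrC.
      by rewrite Re_ak (natC R 3) -rmorphM -rmorphD; congr (_%:C); ring.
    rewrite third_real -!rmorphD -rmorphB -ReD GammaC_real// GammaC_real//.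
    have : normc (cpowR 3 (- (3 * (Re (a * k%:R))%:C))) = 3 `^ (- (3 * Re (a * k%:R))).
      by rewrite normc_cpowR// ReN natC mulrC ReZr mulrC.
    move: (cpowR 3 _) => cp ncp.
    rewrite !rGamma_real !Normc.normcM !normc_real ncp.
    rewrite (gtr0_norm (rg_gt0 q0)) !(gtr0_norm (gam_gt0 _))// ?pk0//.
    rewrite Re_ak.
    move=> Hr.
    have c33 : (3 `^ (3 * Re a)) ^+ k * 3 `^ (- (3 * (k%:R * Re a))) = 1 :> R.
      rewrite -powR_mulrn ?powR_ge0// -powRrM -powRD; last by rewrite pnatr_eq0 implybT.
      by rewrite (_ : _ + _ = 0) ?powRr0//; ring.
    have gg : 0 <= gam (Re (p + a * k%:R)) * gam (Re (p + a * k%:R) - nu).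
      by rewrite mulr_ge0// ltW// gam_gt0.
    apply: (@le_trans _ _ (normc kap * ((3 `^ (3 * Re a)) ^+ k * normc z ^+ k *
        (K ^+ k * rg (Re q + k%:R * Re (3 * a)))) *
        (gam (Re (p + a * k%:R)) * gam (Re (p + a * k%:R) - nu)))).
      rewrite ler_wpM2r// ler_wpM2l ?normc_ge0// ler_wpM2l//.
      by rewrite mulr_ge0 ?exprn_ge0 ?powR_ge0 ?normc_ge0.
    rewrite le_eqVlt; apply/orP; left; apply/eqP.
    rewrite /D /GRing.scale/= exprMn; move: Hr c33.
    move: (gam _ * gam _) (rg (Re q + _)) (`|rg _|) ((3 `^ (3 * Re a)) ^+ k) (3 `^ _).
    move: (normc kap) (normc e') (normc z ^+ k) (K ^+ k) => x1 x2 x3 x4 x5 x6 x7 x8 x9.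
    move=> h1 h2; transitivity (x1 * x2 * (x3 * x4 * x7)) => //.
    transitivity (x1 * x3 * x4 * x8 * (x6 * x5)); first by ring.
    rewrite h1; transitivity (x1 * x2 * x3 * x4 * x7 * (x8 * x9)); first by ring.
    by rewrite h2; ring.
  - have zK : 0 <= normc z * K by rewrite mulr_ge0 ?normc_ge0.
    by apply: is_cvg_seriesZ; exact: rg_series_cvg.
have [] := @cintegral_series R Rpos F f _ iF _ _ cI => //.
- move=> u /Rpos_gt0 u0; have [c _] := ML u.
  rewrite (_ : (fun k => _) = normc (kap * (cpowR u (p - 1) * (M u)%:C)) *:
      (fun k => normc (w u ^+ k * rGamma (q + 3 * a * k%:R)))).
    exact: is_cvg_seriesZ.
  by apply/funext => k; rewrite FE// Normc.normcM.
- move=> u /Rpos_gt0 u0; have [_ c] := ML u; rewrite (fE _ u0).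
  have c' : ((fun n => kap * (cpowR u (p - 1) * (M u)%:C) *
     series (fun k => w u ^+ k * rGamma (q + 3 * a * k%:R)) n) : nat -> R[i]^o) @ \oo -->
     (kap * (cpowR u (p - 1) * (M u)%:C) * MittagLeffler (3 * a) q (w u) : R[i]^o).
    by apply: (@cvgM R[i]); first exact: cvg_cst.
  apply: eq_cvgC c' => n; rewrite /series/= mulr_sumr; apply: eq_bigr => k _.
  by rewrite FE.
move=> i c; split=> //.
have [_ cM] := @MittagLeffler_cvg R a b z a0.
have c' : ((fun n => kap * e * series (fun k => z ^+ k * rGamma (b + a * k%:R)) n)
   : nat -> R[i]^o) @ \oo --> (kap * e * MittagLeffler a b z : R[i]^o).
  by apply: (@cvgM R[i]); first exact: cvg_cst.
apply: (cvgC_uniq c'); apply: eq_cvgC c => n.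
by rewrite /series/= mulr_sumr; apply: eq_bigr => k _; rewrite IF.
Qed.

(** [kappa] is pi 3^(-1/2) r, so [r] cancels and 3 * 3^(-1/2) = 3^(1/2) produces the half in the
    exponent of the final prefactor. *)
Lemma kappa_scale q :
  kappa * (3 / r * cpowR 3 (- q)) = pi%:C / cpowR 3 (q - 2^-1).
Proof.
rewrite kappaE cpowRD !cpowRN.
have : cpowR 3 2^-1 * cpowR 3 2^-1 = 3 :> R[i].
  rewrite -cpowRD (_ : 2^-1 + 2^-1 = 1%:C); last by rewrite rmorph1; field.
  by rewrite cpowR_real// powRr1// -natC.
have : cpowR 3 q != 0 :> R[i] by exact: cpowR_neq0.
have : cpowR 3 2^-1 != 0 :> R[i] by exact: cpowR_neq0.
move: (pi%:C) (cpowR 3 q) (cpowR 3 2^-1) r r_neq0 => P x y r0 r00 y0 x0 <-.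
by field; rewrite r00 x0 y0.
Qed.

Lemma MittagLeffler_bessel a b p q z : 0 < Re a -> nu < Re p ->
  triple_rel b p q (3 / r * cpowR 3 (- q)) ->
  triple_rel (Re b)%:C (Re p)%:C (Re q)%:C (3 / r * cpowR 3 (- (Re q)%:C)) ->
  let f := fun u => besselK 3^-1 (2 * Num.sqrt u) * cpowR u (p - 7 / 6) *
    MittagLeffler (3 * a) q (cpowR 3 (3 * a) * cpowR u a * z) in
  cintegrable Rpos f /\
  MittagLeffler a b z = cpowR 3 (q - 2^-1) / pi%:C * cintegral Rpos f.
Proof.
move=> a0 pnu h h' f; have [i <-] := bessel_transform z a0 pnu h h'.
split; first exact: cinteg_cintegrable.
rewrite kappa_scale; have c0 : cpowR 3 (q - 2^-1) != 0 :> R[i] by exact: cpowR_neq0.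
have pi0 : pi%:C != 0 :> R[i] by rewrite eq_complex /= gt_eqF ?pi_gt0.
by rewrite mulrA mulrA mulfVK// divff// mul1r.
Qed.

(** The case p = b + 2/3, q = 3b, for which Re p > 1/3 reads Re b > - 1/3. *)
Lemma MittagLeffler_bessel_first a b z : 0 < Re a -> - 3^-1 < Re b ->
  let f := fun u => besselK 3^-1 (2 * Num.sqrt u) * cpowR u (b - 2^-1) *
    MittagLeffler (3 * a) (3 * b) (cpowR 3 (3 * a) * cpowR u a * z) in
  cintegrable Rpos f /\
  MittagLeffler a b z = cpowR 3 (3 * b - 2^-1) / pi%:C * cintegral Rpos f.
Proof.
move=> a0 b0; rewrite (_ : b - 2^-1 = b + 2 / 3 - 7 / 6); last by field.
have pE : Re (b + 2 / 3) = Re b + 2 / 3 by rewrite two_thirds_real ReD.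
have qE : Re (3 * b) = 3 * Re b by rewrite natC mulrC ReZr mulrC.
apply: MittagLeffler_bessel => //.
- by rewrite pE /nu; move: b0; lra.
- exact: triple_rel_first.
- rewrite pE qE rmorphD /= -two_thirds_real rmorphM /= -natC.
  exact: triple_rel_first.
Qed.

(** The case p = b - 1/3, q = 3b - 2, for which q - 1/2 = 3(b - 1) + 1/2 and Re p > 1/3 reads Re b >
    2/3. *)
Lemma MittagLeffler_bessel_second a b z : 0 < Re a -> 2 / 3 < Re b ->
  let f := fun u => besselK 3^-1 (2 * Num.sqrt u) * cpowR u (b - 3 / 2) *
    MittagLeffler (3 * a) (3 * b - 2) (cpowR 3 (3 * a) * cpowR u a * z) in
  cintegrable Rpos f /\
  MittagLeffler a b z = cpowR 3 (3 * (b - 1) + 2^-1) / pi%:C * cintegral Rpos f.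
Proof.
move=> a0 b0; rewrite (_ : b - 3 / 2 = b - 3^-1 - 7 / 6); last by field.
rewrite (_ : 3 * (b - 1) + 2^-1 = 3 * b - 2 - 2^-1); last by field.
have pE : Re (b - 3^-1) = Re b - nu by rewrite third_real ReD ReN.
have qE : Re (3 * b - 2) = 3 * Re b - 2.
  by rewrite ReD ReN natC mulrC ReZr mulrC (natC R 2).
apply: MittagLeffler_bessel => //.
- by rewrite pE /nu; move: b0; lra.
- exact: triple_rel_second.
- rewrite pE qE !rmorphB rmorphM /= -third_real -!natC.
  exact: triple_rel_second.
Qed.

End BesselTransform.

Theorem mainTheorem10 (R : realType) (a b z : R[i])
    (ha : 0 < complex.Re a) :
  (- 3%:R^-1 < complex.Re b ->
    let f := fun u : R =>
      besselK 3%:R^-1 (2%:R * Num.sqrt u) * cpowR u (b - 2%:R^-1) *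
      MittagLeffler (3%:R * a) (3%:R * b)
        (cpowR 3%:R (3%:R * a) * cpowR u a * z) in
    cintegrable `]0, +oo[ f /\
    MittagLeffler a b z =
      cpowR 3%:R (3%:R * b - 2%:R^-1) / pi%:C * cintegral `]0, +oo[ f) /\
  (2%:R / 3%:R < complex.Re b ->
    let g := fun u : R =>
      besselK 3%:R^-1 (2%:R * Num.sqrt u) * cpowR u (b - 3%:R / 2%:R) *
      MittagLeffler (3%:R * a) (3%:R * b - 2%:R)
        (cpowR 3%:R (3%:R * a) * cpowR u a * z) in
    cintegrable `]0, +oo[ g /\
    MittagLeffler a b z =
      cpowR 3%:R (3%:R * (b - 1) + 2%:R^-1) / pi%:C * cintegral `]0, +oo[ g).
Proof.
by split=> [b0|b0]; [exact: MittagLeffler_bessel_first|exact: MittagLeffler_bessel_second].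
Qed.
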